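(* For any $r\in(0,1)$, let $$v_m=\max\Big\{\Big\lfloor\frac m2+\frac{\sqrt m}{2}Q^{-1}(1-r)\Big\rfloor,0\Big\}.$$ Then the rate $r_m$ of $\mathrm{RM}(v_m,m)$ satisfies $r_m\to r$, and the sequence $\{\mathrm{RM}(v_m,m)\}_m$ is capacity achieving on the BEC under block-MAP decoding.
   Context: $Q(t)=\frac1{\sqrt{2\pi}}\int_t^\infty e^{-\tau^2/2}d\tau$. $\mathrm{RM}(v,m)$ is the binary code of length $N=2^m$ consisting of the evaluation vectors $(f(\underline{x}))_{\underline{x}\in\{0,1\}^m}$ of all polynomials over $\mathbb{F}_2$ in the span of multilinear monomials in $x_1,\dots,x_m$ of degree at most $v$; its rate is $2^{-m}\sum_{k=0}^v\binom mk$. A uniform codeword $\underline{X}$ is sent over $\mathrm{BEC}(p)$ (each bit erased independently with probability $p$), giving $\underline{Y}$; $P_B(p)$ is the probability that $\underline{X}$ is not uniquely determined by $\underline{Y}$. A code sequence with rates $r_n\to r\in(0,1)$ is capacity achieving under block-MAP decoding if $P_B^{(n)}(p)\to0$ for every $p\in[0,1-r)$. *)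

(* Defs.v *)
From HB Require Import structures.
From Stdlib Require Import Reals ClassicalEpsilon.
From mathcomp Require Import all_boot.
Set Implicit Arguments. Unset Strict Implicit. Unset Printing Implicit Defensive.

Open Scope R_scope.

Definition gauss_density (tau : R) : R := exp (- (tau * tau) / 2) / sqrt (2 * PI).

Definition gauss_int_is (a b v : R) : Prop :=
  exists pr : Riemann_integrable gauss_density a b, RiemannInt pr = v.

Definition gauss_int (a b : R) : R := epsilon (inhabits 0) (gauss_int_is a b).

Definition Q (t : R) : R :=
  epsilon (inhabits 0) (fun q => Un_cv (fun n => gauss_int t (t + INR n)) q).

(* Q is a strictly decreasing bijection R -> (0,1); Qinv y is the t with Q t = y *)
Definition Qinv (y : R) : R := epsilon (inhabits 0) (fun t => Q t = y).

Definition point (m : nat) := {ffun 'I_m -> bool}.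
Definition word (m : nat) := {ffun point m -> bool}.

(* evaluation of the multilinear monomial prod_{i in A} x_i at x *)
Definition monomial_eval (m : nat) (A : {set 'I_m}) (x : point m) : bool :=
  [forall i in A, x i].

(* RM(v,m): the F_2-span of evaluation vectors of monomials of degree <= v,
   i.e. sums (xor) of sub-collections S of such monomials *)
Definition RM (v m : nat) : {set word m} :=
  [set w : word m | [exists S : {set {set 'I_m}},
      (S \subset [set A : {set 'I_m} | (#|A| <= v)%N]) &&
      [forall x : point m, w x == \big[addb/false]_(A in S) monomial_eval A x]]].

Definition RM_rate (v m : nat) : R :=
  INR (\sum_(0 <= k < v.+1) 'C(m, k))%N / (2 ^ m).

(* x is not uniquely determined when the positions in E are erased *)
Definition ambiguous (m : nat) (C : {set word m}) (x : word m) (E : {set point m}) : bool :=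
  [exists x' in C, (x' != x) && [forall i in ~: E, x' i == x i]].

(* P_B(p): X uniform on C, each of the N positions erased independently w.p. p *)
Definition PB (m : nat) (C : {set word m}) (p : R) : R :=
  \big[Rplus/0]_(x in C)
    (/ INR #|C| *
     \big[Rplus/0]_(E : {set point m})
        (p ^ #|E| * (1 - p) ^ (#|point m| - #|E|)%N *
         (if ambiguous C x E then 1 else 0))).

Definition v_seq (r : R) (m : nat) : nat :=
  Z.to_nat (Z.max (Int_part (INR m / 2 + sqrt (INR m) / 2 * Qinv (1 - r))) 0).

(* Main.v *)
(** For RM(v, m) of length [N] let [H(p)] be the probability that the bit at the origin is
    not determined by the other received bits, and let [D] be the dimension of the subcode
    supported on the erasures, so that [(E D)' = N H].

    Restricting RM(v, n+a) to two n-dimensional subspaces that meet in the kernel of a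
    random n x a matrix, and expanding the loss event in the p-biased Fourier basis, gives
    [H_(n+a) <= sum_T fhat(T)^2 (|T|+1)^(-a)].  In particular [H_(n+a) <= H_n^2 + 2^(-a)].
    By the De Moivre-Laplace theorem RM(v, n) and RM(v, n+a) have asymptotically the same
    rate, so the integral of [H (1 - H)] tends to [0] and the monotone function [H] jumps
    from [0] to [1] at one minus the rate.  Below the jump, hypercontractivity bounds the
    low-degree part of the same sum by a power of [H] larger than one, and [o(sqrt m)]
    additional dimensions, which do not change the limiting rate either, bring [H] down to
    [exp (- X)] with [X] of order [sqrt (m log m)].

    When [p] decreases, [D] is a pure death process whose rate at [D = j] is at least the
    smallest support of a j-dimensional subcode.  Such a support of size [u] satisfies
    [j <= (2^s - 1)^(v-m) u^s] for every [s >= 1], which makes the total death time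
    negligible as soon as the support is below [2^m exp (- X / 2)].

    The rate itself is a central limit theorem: [Phi (y / sqrt t)] solves the heat equation,
    and one step of the simple random walk follows it up to a third order error. *)
Require Import Defs.
From HB Require Import structures.
From Stdlib Require Import Reals Lra Lia ZArith ClassicalEpsilon.
From Coquelicot Require Import Coquelicot.
From mathcomp Require Import all_boot.
From mathcomp Require all_order all_algebra ring lra finfield mxabelem.
From mathcomp Require Import Rstruct.
Set Implicit Arguments. Unset Strict Implicit. Unset Printing Implicit Defensive.
Open Scope R_scope.
Delimit Scope R_scope with coqR.

(** * The normal distribution function *)

Lemma exp_le_mono x y : x <= y -> exp x <= exp y.
Proof. by case=> [/exp_increasing/Rlt_le|->] //; right. Qed.

Lemma is_lim_seq_div_infty (u v : nat -> R) (l : R) :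
  is_lim_seq u l -> is_lim_seq v p_infty -> is_lim_seq (fun n => u n / v n) 0.
Proof.
move=> u_l v_oo; apply: is_lim_seq_div u_l v_oo _ _ => //.
by rewrite /is_Rbar_div /= /is_Rbar_mult /= Rmult_0_r.
Qed.

Lemma is_lim_seq_comp_infty (f : R -> R) (u : nat -> R) (l : Rbar) :
  is_lim f p_infty l -> is_lim_seq u p_infty -> is_lim_seq (fun n => f (u n)) l.
Proof. by move=> f_l; apply: is_lim_comp_seq f_l _; exists 0%N. Qed.

Lemma is_lim_seq_sqrt (u : nat -> R) :
  is_lim_seq u p_infty -> is_lim_seq (fun n => sqrt (u n)) p_infty.
Proof. by move=> u_oo; exact: filterlim_comp u_oo filterlim_sqrt_p. Qed.

Lemma is_lim_seq_gt (u : nat -> R) (c : R) : is_lim_seq u p_infty -> eventually (fun n => c < u n).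
Proof. by move=> /is_lim_seq_spec/(_ c). Qed.

Lemma is_lim_seq_lt (u : nat -> R) (l c : R) :
  is_lim_seq u l -> l < c -> eventually (fun n => u n < c).
Proof.
move=> /is_lim_seq_spec u_l lc; have cl0 : 0 < c - l by lra.
by have := u_l (mkposreal _ cl0); apply: filter_imp => n /Rabs_lt_between /=; lra.
Qed.

Lemma mean_value_ge (f df : R -> R) (a b c : R) : a <= b ->
  (forall x, a <= x <= b -> is_derive f x (df x)) ->
  (forall x, a < x < b -> c <= df x) -> c * (b - a) <= f b - f a.
Proof.
move=> [ab|->] fd dfc; last lra.
have [x [-> x_ab]] : exists x, f b - f a = df x * (b - a) /\ a < x < b.
  by apply: MVT_cor2 => // x /fd; rewrite is_derive_Reals.
by apply: Rmult_le_compat_r; [lra | exact: dfc].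
Qed.

Lemma mean_value_abs_le (f df : R -> R) (a b c : R) :
  (forall x, Rmin a b <= x <= Rmax a b -> is_derive f x (df x)) ->
  (forall x, Rmin a b <= x <= Rmax a b -> Rabs (df x) <= c) ->
  Rabs (f b - f a) <= c * Rabs (b - a).
Proof.
move=> fd dfc; have [||x [x_ab ->]] := MVT_gen f a b df.
- by move=> x x_ab; apply: fd; lra.
- move=> x /fd df_x; apply/continuity_pt_filterlim.
  by apply: (ex_derive_continuous f); eexists; exact: df_x.
by rewrite Rabs_mult; apply: Rmult_le_compat_r; [exact: Rabs_pos | exact: dfc].
Qed.

Section GaussianIntegral.

Definition bell (x : R) : R := exp (- (x * x) / 2).
Definition bell_primitive (t : R) : R := RInt bell 0 t.

(* Half the amount by which [bell_primitive t ^ 2] falls short of its limit [PI / 2]. *)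
Definition bell_defect_integrand (t x : R) : R :=
  exp (- (t * t) * (1 + x * x) / 2) / (1 + x * x).
Definition bell_defect (t : R) : R := RInt (bell_defect_integrand t) 0 1.

Lemma bell_gt0 x : 0 < bell x.
Proof. exact: exp_pos. Qed.

Lemma ex_RInt_bell a b : ex_RInt bell a b.
Proof.
apply: (ex_RInt_continuous (V := R_CompleteNormedModule)) => z _.
by apply: (ex_derive_continuous bell); rewrite /bell; auto_derive.
Qed.

Lemma is_derive_bell_primitive t : is_derive bell_primitive t (bell t).
Proof.
apply: (is_derive_RInt bell _ 0).
  by apply: filter_forall => b; apply: RInt_correct; exact: ex_RInt_bell.
by apply: (ex_derive_continuous bell); rewrite /bell; auto_derive.
Qed.

Lemma bell_primitive_opp t : bell_primitive (- t) = - bell_primitive t.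
Proof.
have := RInt_comp_lin bell (-1) 0 0 t (ex_RInt_bell _ _).
rewrite Rmult_0_r Rplus_0_r (_ : -1 * t + 0 = - t); last ring.
rewrite /bell_primitive => <-; rewrite (RInt_ext _ (fun x => opp (bell x))).
  by rewrite RInt_opp //; exact: ex_RInt_bell.
move=> x _; rewrite /scal /= /mult /= /opp /= /bell.
rewrite (_ : (-1 * x + 0) * (-1 * x + 0) = x * x); ring.
Qed.

Lemma bell_primitive_ge0 t : 0 <= t -> 0 <= bell_primitive t.
Proof.
move=> t_ge0; apply: RInt_ge_0 => //; first exact: ex_RInt_bell.
by move=> x _; left; exact: bell_gt0.
Qed.

Lemma one_plus_sqr_gt0 x : 0 < 1 + x * x.
Proof. nra. Qed.

Lemma ex_RInt_bell_defect_integrand t a b : ex_RInt (bell_defect_integrand t) a b.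
Proof.
apply: (ex_RInt_continuous (V := R_CompleteNormedModule)) => x _.
apply: (ex_derive_continuous (bell_defect_integrand t)).
by rewrite /bell_defect_integrand; auto_derive; have := one_plus_sqr_gt0 x; lra.
Qed.

Lemma is_derive_bell_defect_integrand t x :
  is_derive (fun u => bell_defect_integrand u x) t
    (- t * exp (- (t * t) * (1 + x * x) / 2)).
Proof.
have x1 := one_plus_sqr_gt0 x.
by rewrite /bell_defect_integrand; auto_derive; [lra | rewrite /Rdiv; field; lra].
Qed.

Lemma continuity_2d_Derive_bell_defect_integrand t x :
  continuity_2d_pt (fun u v => Derive (bell_defect_integrand^~ v) u) t x.
Proof.
apply: (continuity_2d_pt_ext (fun u v => - u * exp (- (u * u) * (1 + v * v) * / 2))).
  by move=> u v; rewrite (is_derive_unique _ _ _ (is_derive_bell_defect_integrand u v)).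
have idu : continuity_2d_pt (fun u _ => u) t x by exact: continuity_2d_pt_id1.
have idv : continuity_2d_pt (fun _ v => v) t x by exact: continuity_2d_pt_id2.
apply: continuity_2d_pt_mult; first exact: continuity_2d_pt_opp.
apply: (continuity_1d_2d_pt_comp exp).
  by apply: derivable_continuous_pt; exact: derivable_pt_exp.
apply: continuity_2d_pt_mult; last exact: continuity_2d_pt_const.
apply: continuity_2d_pt_mult.
  by apply: continuity_2d_pt_opp; exact: continuity_2d_pt_mult.
apply: continuity_2d_pt_plus; first exact: continuity_2d_pt_const.
exact: continuity_2d_pt_mult.
Qed.

Lemma RInt_Derive_bell_defect_integrand t :
  RInt (fun x => Derive (bell_defect_integrand^~ x) t) 0 1 = - bell t * bell_primitive t.
Proof.
rewrite (RInt_ext _ (fun x => scal (- bell t) (scal t (bell (t * x + 0))))); last first.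
  move=> x _; rewrite (is_derive_unique _ _ _ (is_derive_bell_defect_integrand t x)).
  rewrite /scal /= /mult /= /bell Rplus_0_r.
  have -> : - (t * t) * (1 + x * x) / 2 = - (t * t) / 2 + - (t * x * (t * x)) / 2 by field.
  by rewrite exp_plus; ring.
rewrite RInt_scal; last first.
  apply: (ex_RInt_continuous (V := R_CompleteNormedModule)) => z _.
  apply: (ex_derive_continuous (fun x => t * bell (t * x + 0))).
  by rewrite /bell; auto_derive.
rewrite RInt_comp_lin; last exact: ex_RInt_bell.
by rewrite /bell_primitive /scal /= /mult /= Rmult_0_r Rmult_1_r !Rplus_0_r.
Qed.

Lemma is_derive_bell_defect t : is_derive bell_defect t (- bell t * bell_primitive t).
Proof.
rewrite -RInt_Derive_bell_defect_integrand.
apply: (is_derive_RInt_param bell_defect_integrand).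
- by apply: filter_forall => u x _; eexists; exact: is_derive_bell_defect_integrand.
- by move=> x _; exact: continuity_2d_Derive_bell_defect_integrand.
- by apply: filter_forall => u; exact: ex_RInt_bell_defect_integrand.
Qed.

Lemma bell_defect0 : bell_defect 0 = PI / 4.
Proof.
rewrite /bell_defect (RInt_ext _ (fun x => / (1 + x ^ 2))); last first.
  move=> x _; rewrite /bell_defect_integrand Rmult_0_r Ropp_0 Rmult_0_l.
  by rewrite /Rdiv Rmult_0_l exp_0 Rmult_1_l /= Rmult_1_r.
have atan_RInt : is_RInt (fun x => / (1 + x ^ 2)) 0 1 (minus (atan 1) (atan 0)).
  apply: (is_RInt_derive atan) => x _.
    by have := is_derive_atan x; rewrite Rsqr_pow2.
  apply: (ex_derive_continuous (fun x => / (1 + x ^ 2))); auto_derive.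
  by have := one_plus_sqr_gt0 x; lra.
by rewrite (is_RInt_unique _ _ _ _ atan_RInt) atan_1 atan_0 /minus /plus /opp /=; ring.
Qed.

Lemma bell_primitive_sqr t : 0 < t -> bell_primitive t ^ 2 = PI / 2 - 2 * bell_defect t.
Proof.
move=> t_gt0; pose f u := bell_primitive u ^ 2 + 2 * bell_defect u.
have df0 u : is_derive f u 0.
  have dp := is_derive_bell_primitive u; have dd := is_derive_bell_defect u.
  rewrite /f; auto_derive.
    by split; [eexists; exact: dp | split; [eexists; exact: dd|]].
  by rewrite (is_derive_unique _ _ _ dp) (is_derive_unique _ _ _ dd); ring.
have f0t : f 0 = f t by apply: eq_is_derive => // u _; exact: df0.
have f0 : f 0 = PI / 2.
  by rewrite /f bell_defect0 /bell_primitive RInt_point /zero /=; field.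
by move: f0t; rewrite f0 /f; lra.
Qed.

Lemma bell_defect_bounds t : 0 <= bell_defect t <= bell t.
Proof.
have integrand_bounds x : 0 <= bell_defect_integrand t x <= bell t.
  have x1 := one_plus_sqr_gt0 x; have e0 := exp_pos (- (t * t) * (1 + x * x) / 2).
  split; first by left; exact: Rdiv_lt_0_compat.
  apply/Rle_div_l => //; apply: (Rle_trans _ (bell t)); first by apply: exp_le_mono; nra.
  by have := bell_gt0 t; nra.
have int_cst (c : R) : RInt (fun=> c) 0 1 = c by rewrite RInt_const /scal /= /mult /=; ring.
have int_ex := @ex_RInt_bell_defect_integrand t 0 1.
split; [rewrite -(int_cst 0) | rewrite -(int_cst (bell t))];
  (apply: RInt_le; [lra | | | by move=> x _; case: (integrand_bounds x)]) => //;
  exact: ex_RInt_const.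
Qed.

End GaussianIntegral.

Definition normal_cdf (z : R) : R := / 2 + bell_primitive z / sqrt (2 * PI).

Lemma sqrt_2PI_ge1 : 1 <= sqrt (2 * PI).
Proof. by rewrite -{1}sqrt_1; apply: sqrt_le_1_alt; have := PI2_1; lra. Qed.

Lemma gauss_density_gt0 x : 0 < gauss_density x.
Proof. by apply: Rdiv_lt_0_compat; [exact: exp_pos | have := sqrt_2PI_ge1; lra]. Qed.

Lemma is_derive_gauss_density x : is_derive gauss_density x (- x * gauss_density x).
Proof.
have s1 := sqrt_2PI_ge1; rewrite /gauss_density; auto_derive => //.
by rewrite /Rdiv; field; lra.
Qed.

Lemma is_derive_normal_cdf z : is_derive normal_cdf z (gauss_density z).
Proof.
have dp := is_derive_bell_primitive z; rewrite /normal_cdf; auto_derive.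
  by eexists; exact: dp.
by rewrite (is_derive_unique _ _ _ dp) Rmult_1_l.
Qed.

Lemma continuous_normal_cdf z : continuous normal_cdf z.
Proof.
by apply: (ex_derive_continuous normal_cdf); eexists; exact: is_derive_normal_cdf.
Qed.

Lemma normal_cdf_le x y : x <= y -> normal_cdf x <= normal_cdf y.
Proof.
move=> xy; have dcdf z := is_derive_normal_cdf z.
have := @mean_value_ge normal_cdf gauss_density x y 0 xy (fun z _ => dcdf z)
  (fun z _ => Rlt_le _ _ (gauss_density_gt0 z)).
lra.
Qed.

Lemma normal_cdf_opp z : normal_cdf (- z) = 1 - normal_cdf z.
Proof.
by rewrite /normal_cdf bell_primitive_opp; field; have := sqrt_2PI_ge1; lra.
Qed.

Lemma bell_le_inv_sqr z : 0 < z -> bell z <= 2 / (z * z).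
Proof.
move=> z_gt0; have zz : 0 < z * z by nra.
rewrite /bell (_ : - (z * z) / 2 = - (z * z / 2)); last field.
rewrite exp_Ropp (_ : 2 / (z * z) = / (z * z / 2)); last by field; lra.
by apply: Rinv_le_contravar; [lra | have := exp_ineq1_le (z * z / 2); lra].
Qed.

Lemma normal_cdf_tail z : 0 < z -> 0 <= 1 - normal_cdf z <= 8 / (z * z).
Proof.
move=> z_gt0; have z_sqr := bell_primitive_sqr z_gt0.
have [d_ge0 d_le] := bell_defect_bounds z; have bz := bell_le_inv_sqr z_gt0.
have b0 : 0 <= bell_primitive z by apply: bell_primitive_ge0; lra.
have s1 := sqrt_2PI_ge1.
have ss : sqrt (2 * PI) * sqrt (2 * PI) = 2 * PI by apply: sqrt_sqrt; have := PI2_1; lra.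
rewrite /normal_cdf; set s := sqrt (2 * PI) in s1 ss *; set b := bell_primitive z in z_sqr b0 *.
have b_sqr : b ^ 2 = (s / 2) ^ 2 - 2 * bell_defect z by rewrite z_sqr; nra.
have b_le : b <= s / 2 by nra.
have -> : 1 - (/ 2 + b / s) = (s / 2 - b) / s by field; lra.
split; first by apply: Rmult_le_pos; [lra | left; apply: Rinv_0_lt_compat; lra].
apply/Rle_div_l; first lra.
have : s / 2 - b <= 4 * bell z by nra.
have : 0 <= 8 / (z * z) by left; apply: Rdiv_lt_0_compat; nra.
rewrite (_ : 8 / (z * z) = 4 * (2 / (z * z))); last by field; lra.
nra.
Qed.

Lemma normal_cdf_bounds z : 0 <= normal_cdf z <= 1.
Proof.
have le1 x : normal_cdf x <= 1.
  have x1 : 0 < Rmax x 1 by apply: Rlt_le_trans (Rmax_r _ _); lra.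
  have := normal_cdf_le (Rmax_l x 1); have := normal_cdf_tail x1; lra.
by have := le1 z; have := le1 (- z); rewrite normal_cdf_opp; lra.
Qed.

Lemma is_lim_normal_cdf_p : is_lim normal_cdf p_infty 1.
Proof.
apply: (is_lim_le_le_loc (fun z => 1 - 8 / (z * z)) (fun=> 1)).
- by exists 0 => z /normal_cdf_tail; lra.
- have -> : Rbar.Finite 1 = Rbar.Finite (1 - 0) by congr Rbar.Finite; ring.
  apply: is_lim_minus'; first exact: is_lim_const.
  have -> : Rbar.Finite 0 = Rbar_div 8 p_infty by rewrite /= Rmult_0_r.
  apply: is_lim_div => //; first exact: is_lim_const.
  by apply: (is_lim_mult _ _ _ p_infty p_infty) => //; exact: is_lim_id.
- exact: is_lim_const.
Qed.

Lemma is_lim_normal_cdf_m : is_lim normal_cdf m_infty 0.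
Proof.
apply: (is_lim_ext (fun z => 1 - normal_cdf (- z))).
  by move=> z; rewrite normal_cdf_opp; ring.
have -> : Rbar.Finite 0 = Rbar.Finite (1 - 1) by congr Rbar.Finite; ring.
apply: is_lim_minus'; first exact: is_lim_const.
apply: (is_lim_comp normal_cdf Ropp m_infty 1 p_infty is_lim_normal_cdf_p).
  exact: (is_lim_opp (fun z => z) m_infty m_infty (is_lim_id _)).
by exists 0.
Qed.

Lemma gauss_int_normal_cdf a b : gauss_int a b = normal_cdf b - normal_cdf a.
Proof.
have int_ab : is_RInt gauss_density a b (minus (normal_cdf b) (normal_cdf a)).
  apply: is_RInt_derive => x _; first exact: is_derive_normal_cdf.
  by apply: (ex_derive_continuous gauss_density); eexists; exact: is_derive_gauss_density.
have ex_ab : ex_RInt gauss_density a b by eexists; exact: int_ab.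
pose pr := ex_RInt_Reals_0 _ _ _ ex_ab.
have ex_v : exists v, gauss_int_is a b v by exists (RiemannInt pr), pr.
rewrite /gauss_int; have [pr' <-] := epsilon_spec (inhabits 0) (gauss_int_is a b) ex_v.
by rewrite -RInt_Reals (is_RInt_unique _ _ _ _ int_ab).
Qed.

Lemma Q_normal_cdf t : Q t = 1 - normal_cdf t.
Proof.
have tail_cvg : Un_cv (fun n => gauss_int t (t + INR n)) (1 - normal_cdf t).
  apply/is_lim_seq_Reals.
  apply: (is_lim_seq_ext (fun n => normal_cdf (t + INR n) - normal_cdf t)).
    by move=> n; rewrite gauss_int_normal_cdf.
  apply: is_lim_seq_minus'; last exact: is_lim_seq_const.
  apply: (is_lim_seq_comp_infty is_lim_normal_cdf_p).
  apply: (is_lim_seq_plus _ _ (Rbar.Finite t) p_infty) => //.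
    exact: is_lim_seq_const.
  exact: is_lim_seq_INR.
have ex_q : exists q, Un_cv (fun n => gauss_int t (t + INR n)) q by eexists; exact: tail_cvg.
exact: UL_sequence (epsilon_spec (inhabits 0) _ ex_q) tail_cvg.
Qed.

Lemma normal_cdf_Qinv r : 0 < r < 1 -> normal_cdf (Qinv (1 - r)) = r.
Proof.
move=> r01.
have cont z : continuity_pt normal_cdf z.
  by apply/continuity_pt_filterlim; exact: continuous_normal_cdf.
have [t [_ [_ cdf_t]]] := IVT_Rbar_incr normal_cdf m_infty p_infty 0 1 r
  is_lim_normal_cdf_m is_lim_normal_cdf_p (fun z _ _ => cont z) I r01.
have ex_t : exists t, Q t = 1 - r by exists t; rewrite Q_normal_cdf cdf_t.
have := epsilon_spec (inhabits 0) (fun t => Q t = 1 - r) ex_t.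
by rewrite Q_normal_cdf -/(Qinv _); lra.
Qed.

(** * The De Moivre-Laplace theorem through the heat equation *)

Section HeatEquation.

Definition heat (t y : R) : R := normal_cdf (y / sqrt t).
Definition heat_kernel (t z : R) : R := gauss_density (z / sqrt t) / sqrt t.
(* Minus the space derivative of [heat_kernel]. *)
Definition heat_flux (t z : R) : R := z / sqrt t * gauss_density (z / sqrt t) / t.
Definition heat_step_rate (t : R) : R := 2 / (t * sqrt t) + 4 / (t * t).

Lemma sqrt_gt0_sqr t : 0 < t -> 0 < sqrt t /\ sqrt t * sqrt t = t.
Proof. by move=> t_gt0; split; [exact: sqrt_lt_R0 | apply: sqrt_sqrt; lra]. Qed.

Lemma is_derive_heat_space t z : 0 < t -> is_derive (heat t) z (heat_kernel t z).
Proof.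
move=> /sqrt_gt0_sqr[s0 _]; have dcdf := is_derive_normal_cdf (z / sqrt t).
rewrite /heat /heat_kernel; auto_derive; first by eexists; exact: dcdf.
by rewrite (is_derive_unique _ _ _ dcdf); field; lra.
Qed.

Lemma is_derive_heat_time t y : 0 < t ->
  is_derive (heat^~ y) t (- heat_flux t y / 2).
Proof.
move=> t_gt0; have [s0 ss] := sqrt_gt0_sqr t_gt0.
have dcdf := is_derive_normal_cdf (y / sqrt t).
rewrite /heat /heat_flux; auto_derive; first by split; [eexists; exact: dcdf | lra].
rewrite (is_derive_unique _ _ _ dcdf); move: (gauss_density _) => g.
by move: (sqrt t) s0 ss => s s0 <-; field; lra.
Qed.

Lemma is_derive_heat_kernel t z : 0 < t ->
  is_derive (heat_kernel t) z (- heat_flux t z).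
Proof.
move=> t_gt0; have [s0 ss] := sqrt_gt0_sqr t_gt0.
have dg := is_derive_gauss_density (z / sqrt t).
rewrite /heat_kernel /heat_flux; auto_derive; first by eexists; exact: dg.
rewrite (is_derive_unique _ _ _ dg); move: (gauss_density _) => g.
by move: (sqrt t) s0 ss => s s0 <-; field; lra.
Qed.

Lemma is_derive_heat_flux_space t z : 0 < t -> let x := z / sqrt t in
  is_derive (heat_flux t) z ((1 - x * x) * gauss_density x / (t * sqrt t)).
Proof.
move=> t_gt0 x; have [s0 ss] := sqrt_gt0_sqr t_gt0.
have dg := is_derive_gauss_density x.
rewrite /heat_flux; auto_derive; first by eexists; exact: dg.
by rewrite (is_derive_unique _ _ _ dg) -/x /x /Rdiv; field; lra.
Qed.

Lemma is_derive_heat_flux_time t z : 0 < t -> let x := z / sqrt t in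
  is_derive (heat_flux^~ z) t (x * (x * x - 3) / 2 * gauss_density x / (t * t)).
Proof.
move=> t_gt0 x; have [s0 ss] := sqrt_gt0_sqr t_gt0.
have dg := is_derive_gauss_density x.
rewrite /heat_flux; auto_derive; first by repeat split; try (eexists; exact: dg); lra.
rewrite (is_derive_unique _ _ _ dg) /x; move: (gauss_density _) => g.
by move: (sqrt t) s0 ss => s s0 <-; field; lra.
Qed.

Lemma gauss_density_decay x : gauss_density x * (1 + x * x / 4) ^ 2 <= 1.
Proof.
have s1 := sqrt_2PI_ge1; have e1 := exp_ineq1_le (x * x / 4).
have e0 := exp_pos (- (x * x / 4)).
have -> : gauss_density x = exp (- (x * x / 4)) ^ 2 / sqrt (2 * PI).
  by rewrite /gauss_density /= Rmult_1_r -exp_plus; congr (exp _ / _); field.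
have exp_decay : 0 <= exp (- (x * x / 4)) * (1 + x * x / 4) <= 1.
  split; first nra.
  by rewrite exp_Ropp Rmult_comm; apply/Rle_div_l; [exact: exp_pos | lra].
rewrite (_ : _ / _ * _ = (exp (- (x * x / 4)) * (1 + x * x / 4)) ^ 2 / sqrt (2 * PI)).
  by apply/Rle_div_l; [lra | rewrite Rmult_1_l; nra].
by field; lra.
Qed.

Lemma gauss_density_space_bound x : Rabs ((1 - x * x) * gauss_density x) <= 2.
Proof.
have g0 := gauss_density_gt0 x; have decay := gauss_density_decay x.
rewrite Rabs_mult (Rabs_pos_eq (gauss_density x)); last lra.
have : Rabs (1 - x * x) <= 2 * (1 + x * x / 4) ^ 2 by apply: Rabs_le; split; nra.
nra.
Qed.

Lemma gauss_density_time_bound x : Rabs (x * (x * x - 3) / 2 * gauss_density x) <= 4.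
Proof.
have g0 := gauss_density_gt0 x; have decay := gauss_density_decay x.
rewrite Rabs_mult (Rabs_pos_eq (gauss_density x)); last lra.
have : Rabs (x * (x * x - 3) / 2) <= 4 * (1 + x * x / 4) ^ 2.
  have xx : 0 <= x * x := Rle_0_sqr x.
  have x1 : Rabs x <= (1 + x * x) / 2.
    have := Rle_0_sqr (x + 1); have := Rle_0_sqr (x - 1); rewrite /Rsqr.
    by split_Rabs; lra.
  have x2 : Rabs ((x * x - 3) / 2) <= (x * x + 3) / 2 by split_Rabs; lra.
  rewrite /Rdiv Rmult_assoc Rabs_mult.
  apply: Rle_trans (Rmult_le_compat _ _ _ _ (Rabs_pos _) (Rabs_pos _) x1 x2) _.
  nra.
nra.
Qed.

Lemma heat_flux_lipschitz_space sg t y x : 0 < sg <= t ->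
  Rabs (heat_flux t y - heat_flux t x) <= 2 / (sg * sqrt sg) * Rabs (y - x).
Proof.
move=> [sg0 sgt]; have t0 : 0 < t by lra.
have [s0 _] := sqrt_gt0_sqr t0; have [r0 _] := sqrt_gt0_sqr sg0.
have rs : sqrt sg <= sqrt t by exact: sqrt_le_1_alt.
pose df u := let w := u / sqrt t in (1 - w * w) * gauss_density w / (t * sqrt t).
apply: (mean_value_abs_le (df := df)) => u _; first exact: is_derive_heat_flux_space.
have ts0 : 0 < t * sqrt t by nra.
rewrite /df /Rdiv Rabs_mult (Rabs_pos_eq (/ _)); last first.
  by left; exact: Rinv_0_lt_compat.
apply: Rmult_le_compat; [exact: Rabs_pos | by left; exact: Rinv_0_lt_compat | | ].
  exact: gauss_density_space_bound.
by apply: Rinv_le_contravar; nra.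
Qed.

Lemma heat_flux_lipschitz_time sg t t' y : 0 < sg <= t -> t <= t' ->
  Rabs (heat_flux t' y - heat_flux t y) <= 4 / (sg * sg) * (t' - t).
Proof.
move=> [sg0 sgt] tt'.
rewrite -[t' - t]Rabs_pos_eq; last lra.
pose df u := let w := y / sqrt u in w * (w * w - 3) / 2 * gauss_density w / (u * u).
have mM : Rmin t t' = t /\ Rmax t t' = t' by split; [exact: Rmin_left | exact: Rmax_right].
apply: (mean_value_abs_le (f := heat_flux^~ y) (df := df)) => u; case: mM => -> -> ut.
  by apply: is_derive_heat_flux_time; lra.
rewrite /df /Rdiv [Rabs (_ * / _)]Rabs_mult (Rabs_pos_eq (/ _)); last first.
  by left; apply: Rinv_0_lt_compat; nra.
apply: Rmult_le_compat; [exact: Rabs_pos | by left; apply: Rinv_0_lt_compat; nra | | ].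
  exact: gauss_density_time_bound.
by apply: Rinv_le_contravar; nra.
Qed.

Lemma heat_kernel_central_difference t y s : 0 < t -> 0 <= s ->
  exists2 x, Rabs (y - x) <= s &
    heat_kernel t (y + s) - heat_kernel t (y - s) = - heat_flux t x * (2 * s).
Proof.
move=> t0 s0; have dk x := is_derive_heat_kernel x t0.
have [||x [x_range ->]] := MVT_gen (heat_kernel t) (y - s) (y + s) (fun x => - heat_flux t x).
- by move=> x _; exact: dk.
- move=> x _; apply/continuity_pt_filterlim.
  by apply: (ex_derive_continuous (heat_kernel t)); eexists; exact: dk.
exists x; last ring.
by move: x_range; rewrite Rmin_left ?Rmax_right; try lra; split_Rabs; lra.
Qed.

Lemma is_derive_heat_step t y s : 0 < t ->
  is_derive (fun s => (heat t (y + s) + heat t (y - s)) / 2 - heat (t + s * s) y) s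
    ((heat_kernel t (y + s) - heat_kernel t (y - s)) / 2 + s * heat_flux (t + s * s) y).
Proof.
move=> t0; have ts0 : 0 < t + s * s by nra.
have d1 := is_derive_heat_space (y + s) t0; have d2 := is_derive_heat_space (y - s) t0.
have d3 := is_derive_heat_time y ts0.
auto_derive.
  by split; [eexists; exact: d1 | split; [eexists; exact: d2 | split => //; eexists; exact: d3]].
by rewrite (is_derive_unique _ _ _ d1) (is_derive_unique _ _ _ d2)
  (is_derive_unique _ _ _ d3); field.
Qed.

Lemma heat_step sg t y h : 0 < sg <= t -> 0 <= h <= 1 ->
  Rabs ((heat t (y + h) + heat t (y - h)) / 2 - heat (t + h * h) y)
    <= heat_step_rate sg * h ^ 3.
Proof.
move=> [sg0 sgt] [h0 h1]; have t0 : 0 < t by lra.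
have [r0 _] := sqrt_gt0_sqr sg0.
have c1 : 0 < 2 / (sg * sqrt sg) by apply: Rdiv_lt_0_compat; nra.
have c2 : 0 < 4 / (sg * sg) by apply: Rdiv_lt_0_compat; nra.
pose w s := (heat t (y + s) + heat t (y - s)) / 2 - heat (t + s * s) y.
pose dw s := (heat_kernel t (y + s) - heat_kernel t (y - s)) / 2 + s * heat_flux (t + s * s) y.
have dw_le s : 0 <= s <= h -> Rabs (dw s) <= heat_step_rate sg * h ^ 2.
  move=> [s0 sh]; have [x yx kernel_eq] := heat_kernel_central_difference y t0 s0.
  have -> : dw s = s * ((heat_flux (t + s * s) y - heat_flux t y)
      + (heat_flux t y - heat_flux t x)) by rewrite /dw kernel_eq; field.
  have time_le := @heat_flux_lipschitz_time sg t (t + s * s) y (conj sg0 sgt) ltac:(nra).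
  have space_le := heat_flux_lipschitz_space y x (conj sg0 sgt).
  rewrite Rabs_mult (Rabs_pos_eq s) // (_ : _ * h ^ 2 = h * (heat_step_rate sg * h)); last ring.
  apply: Rmult_le_compat => //; first exact: Rabs_pos.
  apply: Rle_trans (Rabs_triang _ _) _; rewrite /heat_step_rate.
  have ss : s * s <= h by nra.
  nra.
have w0 : w 0 = 0 by rewrite /w Rplus_0_r Rminus_0_r Rmult_0_r Rplus_0_r; field.
have := @mean_value_abs_le w dw 0 h (heat_step_rate sg * h ^ 2).
rewrite w0 !Rminus_0_r Rmin_left // Rmax_right // (Rabs_pos_eq h) // => /(_ _ dw_le)/Rle_trans.
by apply; [move=> s _; exact: is_derive_heat_step | right; ring].
Qed.

End HeatEquation.

Section RandomWalk.
Variable h : R.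

Fixpoint walk (j : nat) (g : R -> R) (y : R) : R :=
  if j is i.+1 then (walk i g (y + h) + walk i g (y - h)) / 2 else g y.

Lemma walk_heat sg j y : 0 < sg -> 0 <= h <= 1 ->
  Rabs (walk j (heat sg) y - heat (sg + INR j * (h * h)) y) <=
  INR j * (heat_step_rate sg * h ^ 3).
Proof.
move=> sg0 h01; set C := _ * h ^ 3; elim: j y => [|j IHj] y.
  by rewrite /= !Rmult_0_l Rplus_0_r Rminus_diag Rabs_R0; lra.
rewrite S_INR [walk _ _ _]/=.
have up := IHj (y + h); have down := IHj (y - h).
have t_ge : 0 < sg <= sg + INR j * (h * h) by have := pos_INR j; nra.
have step := heat_step y t_ge h01; rewrite -/C in step.
rewrite (_ : sg + (INR j + 1) * (h * h) = sg + INR j * (h * h) + h * h); last ring.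
move: up down step => /Rabs_le_between up /Rabs_le_between down /Rabs_le_between step.
by apply/Rabs_le_between; lra.
Qed.

Lemma walk_le j f g y : (forall z, f z <= g z) -> walk j f y <= walk j g y.
Proof.
move=> fg; elim: j y => [|j IHj] y /=; first exact: fg.
have := IHj (y + h); have := IHj (y - h); lra.
Qed.

Lemma walkD j g c y : walk j (fun z => g z + c) y = walk j g y + c.
Proof. by elim: j y => [//|j IHj] y /=; rewrite !IHj; field. Qed.

Lemma walk_reflect j g c y : walk j (fun z => g (c - z)) y = walk j g (c - y).
Proof.
elim: j y => [//|j IHj] y /=; rewrite !IHj.
have -> : c - (y + h) = c - y - h by ring.
have -> : c - (y - h) = c - y + h by ring.
by field.
Qed.

Lemma sum_pascal (m : nat) (g : nat -> R) :
  \big[Rplus/0]_(0 <= k < m.+2) (INR 'C(m.+1, k) * g k) =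
  \big[Rplus/0]_(0 <= k < m.+1) (INR 'C(m, k) * (g k.+1 + g k)).
Proof.
rewrite big_nat_recl // bin0.
under eq_bigr do rewrite binS plus_INR Rmult_plus_distr_r.
under [RHS]eq_bigr do rewrite Rmult_plus_distr_l Rplus_comm.
rewrite !big_split /= -Rplus_assoc; congr (_ + _).
have := @big_nat_recl R 0 Rplus m.+1 0 (fun k => INR 'C(m, k) * g k) isT.
by rewrite bin0 => <-; rewrite big_nat_recr //= bin_small // Rmult_0_l Rplus_0_r.
Qed.

Lemma walk_binomial m g y : walk m g y =
  / 2 ^ m * \big[Rplus/0]_(0 <= k < m.+1) (INR 'C(m, k) * g (y + (2 * INR k - INR m) * h)).
Proof.
elim: m y => [|m IHm] y.
  by rewrite big_nat1 /= (_ : y + _ = y); [field | ring].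
rewrite [walk _ _ _]/= !IHm (sum_pascal m (fun k => g (y + (2 * INR k - INR m.+1) * h))).
set up := \big[Rplus/0]_(0 <= k < m.+1) (_ * g (y + h + _)).
set down := \big[Rplus/0]_(0 <= k < m.+1) (_ * g (y - h + _)).
rewrite (_ : \big[Rplus/0]_(0 <= k < m.+1) _ = up + down).
  by rewrite -tech_pow_Rmult; field; apply: pow_nonzero; lra.
rewrite -big_split /=; apply: eq_bigr => k _; rewrite Rmult_plus_distr_l.
by congr (_ * g _ + _ * g _); rewrite -/(INR m.+1) -/(INR k.+1) !S_INR; ring.
Qed.

Definition halfline (x y : R) : R :=
  match Rle_dec y x with left _ => 1 | right _ => 0 end.

Lemma RM_rate_walk (m v : nat) (x : R) :
  (forall k : nat, (k <= v)%N <-> (2 * INR k - INR m) * h <= x) ->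
  RM_rate v m = walk m (halfline x) 0.
Proof.
move=> vx; rewrite walk_binomial /RM_rate /Rdiv Rmult_comm; congr (_ * _).
rewrite (big_morph INR plus_INR (erefl _)).
rewrite (@big_nat_widen _ _ _ 0 v.+1 (v.+1 + m.+1)) ?leq_addr //.
rewrite [RHS](@big_nat_widen _ _ _ 0 m.+1 (v.+1 + m.+1)) ?leq_addl //.
rewrite [LHS]big_mkcond [RHS]big_mkcond /=; apply: eq_bigr => k _.
rewrite Rplus_0_l /halfline !ltnS; case: Rle_dec => kx.
  rewrite (proj2 (vx k) kx); case: leqP => // km; first by rewrite Rmult_1_r.
  by rewrite bin_small.
have -> : (k <= v)%N = false by apply/negP => /(proj1 (vx k)).
by case: ifP => // _; rewrite Rmult_0_r.
Qed.

End RandomWalk.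

Lemma halfline_smoothing u x y : 0 < u ->
  heat (u ^ 4) (x - u - y) - 8 * u ^ 2 <= halfline x y
    <= heat (u ^ 4) (x + u - y) + 8 * u ^ 2.
Proof.
move=> u0; have u2 : 0 < u ^ 2 by exact: pow_lt.
have sqrt_u4 : sqrt (u ^ 4) = u ^ 2.
  by rewrite (_ : u ^ 4 = u ^ 2 * u ^ 2); [apply: sqrt_square; lra | ring].
have iu : 0 < / u by exact: Rinv_0_lt_compat.
have [_] := normal_cdf_tail iu.
rewrite (_ : 8 / (/ u * / u) = 8 * u ^ 2); last by field; lra.
move=> tail; rewrite /halfline /heat sqrt_u4.
have lo_bounds := normal_cdf_bounds ((x - u - y) / u ^ 2).
have hi_bounds := normal_cdf_bounds ((x + u - y) / u ^ 2).
case: Rle_dec => xy; split; try lra.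
  suff : normal_cdf (/ u) <= normal_cdf ((x + u - y) / u ^ 2) by lra.
  apply: normal_cdf_le; apply/Rle_div_r => //.
  by rewrite (_ : / u * u ^ 2 = u); [lra | field; lra].
suff : normal_cdf ((x - u - y) / u ^ 2) <= normal_cdf (- / u).
  by rewrite normal_cdf_opp; lra.
apply: normal_cdf_le; apply/Rle_div_l => //.
by rewrite (_ : - / u * u ^ 2 = - u); [lra | field; lra].
Qed.

Lemma walk_halfline_bounds (m : nat) u x : (0 < m)%N -> 0 < u ->
  let err := 8 * u ^ 2 + heat_step_rate (u ^ 4) / sqrt (INR m) in
  heat (1 + u ^ 4) (x - u) - err <= walk (/ sqrt (INR m)) m (halfline x) 0
    <= heat (1 + u ^ 4) (x + u) + err.
Proof.
move=> m_gt0 u0 err; set h := / _.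
have m1 : 1 <= INR m by have /leP/le_INR := m_gt0.
have [s0 ss] : 0 < sqrt (INR m) /\ sqrt (INR m) * sqrt (INR m) = INR m.
  by apply: sqrt_gt0_sqr; lra.
have s1 : 1 <= sqrt (INR m) by rewrite -{1}sqrt_1; exact: sqrt_le_1_alt.
have h01 : 0 <= h <= 1.
  split; first by left; exact: Rinv_0_lt_compat.
  by rewrite /h -Rinv_1; apply: Rinv_le_contravar; lra.
have u4 : 0 < u ^ 4 by exact: pow_lt.
have mhh : INR m * (h * h) = 1 by rewrite -ss /h; field; lra.
have mh3 : INR m * (heat_step_rate (u ^ 4) * h ^ 3) = heat_step_rate (u ^ 4) / sqrt (INR m).
  rewrite (_ : _ * _ = heat_step_rate (u ^ 4) * h * (INR m * (h * h))); last ring.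
  by rewrite mhh Rmult_1_r.
have near z : Rabs (walk h m (fun y => heat (u ^ 4) (z - y)) 0 - heat (1 + u ^ 4) z)
    <= heat_step_rate (u ^ 4) / sqrt (INR m).
  have := walk_heat m z u4 h01; rewrite mhh mh3 (Rplus_comm (u ^ 4)).
  by rewrite walk_reflect Rminus_0_r.
move: (near (x - u)) (near (x + u)) => /Rabs_le_between lo /Rabs_le_between hi.
have := @walk_le h m _ _ 0 (fun y => proj1 (halfline_smoothing x y u0)).
have := @walk_le h m _ _ 0 (fun y => proj2 (halfline_smoothing x y u0)).
by rewrite !walkD /err; lra.
Qed.

Lemma RM_rate_heat_bounds (m v : nat) u : (0 < m)%N -> 0 < u ->
  let x := (2 * INR v - INR m) / sqrt (INR m) in
  let err := 8 * u ^ 2 + heat_step_rate (u ^ 4) / sqrt (INR m) in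
  heat (1 + u ^ 4) (x - u) - err <= RM_rate v m <= heat (1 + u ^ 4) (x + u) + err.
Proof.
move=> m_gt0 u0 x err.
have s0 : 0 < sqrt (INR m) by apply: sqrt_lt_R0; apply: lt_0_INR; exact/leP.
rewrite (@RM_rate_walk (/ sqrt (INR m)) m v x) => [|k]; first exact: walk_halfline_bounds.
have i0 : 0 < / sqrt (INR m) by exact: Rinv_0_lt_compat.
split => [/leP/le_INR kv|]; first by apply: Rmult_le_compat_r; lra.
by move/(Rmult_le_reg_r _ _ _ i0) => kv; apply/leP/INR_le; lra.
Qed.

Lemma heat_le t y z : 0 < t -> y <= z -> heat t y <= heat t z.
Proof.
move=> t0 yz; apply: normal_cdf_le; apply: Rmult_le_compat_r => //.
by left; apply: Rinv_0_lt_compat; exact: sqrt_lt_R0.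
Qed.

Lemma heat_cvg_normal_cdf x c eps : 0 < eps ->
  locally 0 (fun u => Rabs (heat (1 + u ^ 4) (x + c * u) - normal_cdf x) < eps).
Proof.
move=> eps0; pose f u := heat (1 + u ^ 4) (x + c * u).
have cont : continuous f 0.
  apply: (ex_derive_continuous f); rewrite /f /heat; auto_derive; repeat split.
  - by eexists; exact: is_derive_normal_cdf.
  - by rewrite /=; lra.
  - by rewrite /= !Rmult_0_l Rplus_0_r sqrt_1; lra.
have f0 : f 0 = normal_cdf x.
  by rewrite /f /heat /= !Rmult_0_r !Rmult_0_l !Rplus_0_r sqrt_1 Rdiv_1_r.
by have := cont _ (locally_ball (f 0) (mkposreal _ eps0)); rewrite f0.
Qed.

Lemma RM_rate_cvg_normal (v n : nat -> nat) (x : R) :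
  is_lim_seq (fun j => INR (n j)) p_infty ->
  is_lim_seq (fun j => (2 * INR (v j) - INR (n j)) / sqrt (INR (n j))) x ->
  is_lim_seq (fun j => RM_rate (v j) (n j)) (normal_cdf x).
Proof.
move=> n_lim x_lim; apply/is_lim_seq_spec => eps; have eps3 : 0 < eps / 3.
  by have := cond_pos eps; lra.
have [d d_near] : locally 0 (fun u =>
    (Rabs (heat (1 + u ^ 4) (x + 2 * u) - normal_cdf x) < eps / 3 /\
     Rabs (heat (1 + u ^ 4) (x + -2 * u) - normal_cdf x) < eps / 3) /\
    Rabs (8 * u ^ 2 - 8 * 0 ^ 2) < eps / 3).
  apply: filter_and; first by apply: filter_and; exact: heat_cvg_normal_cdf.
  have sqr_cont : continuous (fun u => 8 * u ^ 2) 0.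
    by apply: (ex_derive_continuous (fun u => 8 * u ^ 2)); auto_derive.
  exact: sqr_cont _ (locally_ball _ (mkposreal _ eps3)).
pose u := d / 2; have u0 : 0 < u by rewrite /u; have := cond_pos d; lra.
have [|[hi lo] sqr_u] := d_near u.
  rewrite /ball /= /AbsRing_ball /= /abs /minus /plus /opp /= Ropp_0 Rplus_0_r.
  by rewrite Rabs_pos_eq /u; have := cond_pos d; lra.
pose C := heat_step_rate (u ^ 4).
have err_lim : is_lim_seq (fun j => C / sqrt (INR (n j))) 0.
  apply: (@is_lim_seq_div_infty _ _ C); first exact: is_lim_seq_const.
  exact: is_lim_seq_sqrt.
have [N1 n_pos] := proj2 (is_lim_seq_spec _ _) n_lim 0.
have [N2 x_near] := proj2 (is_lim_seq_spec _ _) x_lim (mkposreal _ u0).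
have [N3 err_small] := proj2 (is_lim_seq_spec _ _) err_lim (mkposreal _ eps3).
exists (N1 + N2 + N3)%N => j jN.
have nj : (0 < n j)%N by apply/leP; apply: INR_lt; apply: n_pos; lia.
have := x_near j ltac:(lia); have := err_small j ltac:(lia); rewrite /=.
have := RM_rate_heat_bounds (v j) nj u0; rewrite -/C /=; set xj := _ / sqrt _.
rewrite Rminus_0_r => rate_bounds /Rabs_lt_between err_j /Rabs_lt_between x_j.
have u4 : 0 < 1 + u ^ 4 by have := pow_lt u 4 u0; lra.
have rate_hi := @heat_le _ (xj + u) (x + 2 * u) u4 ltac:(lra).
have rate_lo := @heat_le _ (x + -2 * u) (xj - u) u4 ltac:(lra).
move: hi lo sqr_u => /Rabs_lt_between hi /Rabs_lt_between lo /Rabs_lt_between sqr_u.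
by apply/Rabs_lt_between; move: rate_bounds rate_hi rate_lo hi lo sqr_u; rewrite /=; lra.
Qed.

Lemma v_seq_floor r m : let w := INR m / 2 + sqrt (INR m) / 2 * Qinv (1 - r) in
  0 <= w -> w - 1 < INR (v_seq r m) <= w.
Proof.
move=> w w0; rewrite /v_seq -/w; have [int_le int_gt] := base_Int_part w.
have int0 : (0 <= Int_part w)%Z.
  by have : (-1 < Int_part w)%Z; [apply: lt_IZR; lra | lia].
by rewrite Z.max_l // INR_IZR_INZ Z2Nat.id //; lra.
Qed.

Lemma v_seq_cvg r :
  is_lim_seq (fun m => (2 * INR (v_seq r m) - INR m) / sqrt (INR m)) (Qinv (1 - r)).
Proof.
set x := Qinv (1 - r); have sqrt_oo := is_lim_seq_sqrt is_lim_seq_INR.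
apply: (is_lim_seq_le_le_loc (fun m => x - 2 / sqrt (INR m)) _ (fun=> x)).
- apply: filter_imp (filter_and _ _ (is_lim_seq_gt 0 sqrt_oo) (is_lim_seq_gt (- x) sqrt_oo)).
  move=> m [s0 s_x]; have ss := sqrt_sqrt _ (pos_INR m).
  have [] := @v_seq_floor r m; rewrite -/x; first nra.
  move=> v_gt v_le; split.
    rewrite (_ : x - _ = (x * sqrt (INR m) - 2) / sqrt (INR m)); last by field; lra.
    by apply: Rmult_le_compat_r; [left; exact: Rinv_0_lt_compat | lra].
  by apply/Rle_div_l; lra.
- rewrite (_ : Rbar.Finite x = x - 0); last by congr Rbar.Finite; ring.
  apply: is_lim_seq_minus'; first exact: is_lim_seq_const.
  by apply: (@is_lim_seq_div_infty _ _ 2) => //; exact: is_lim_seq_const.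
- exact: is_lim_seq_const.
Qed.

Module ErasureAnalysis.
Import all_order all_algebra.
Import mathcomp.algebra_tactics.ring mathcomp.algebra_tactics.lra.
Import Order.TTheory GRing.Theory Num.Theory.
Local Open Scope ring_scope.

(** * Fourier analysis of random subsets *)

Lemma big_subset_split (R : Type) (idx : R) (op : Monoid.com_law idx) (T : finType)
    (i : T) (A : {set T}) (F : {set T} -> R) : i \in A ->
  \big[op/idx]_(S : {set T} | S \subset A) F S =
  \big[op/idx]_(S : {set T} | S \subset A :\ i) op (F S) (F (i |: S)).
Proof.
move=> iA; rewrite big_split /= [LHS](bigID (fun S : {set T} => i \notin S)) /=.
congr (op _ _); first by apply: eq_bigl => S; rewrite subsetD1.
rewrite (reindex_onto (fun S => i |: S) (fun S => S :\ i)) /=; last first.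
  by move=> S /andP[_]; rewrite negbK => iS; rewrite setD1K.
apply: eq_bigl => S; rewrite setU11 /= andbT subUset sub1set iA /= subsetD1.
congr (_ && _); apply/eqP/idP => [<-|]; first by rewrite !inE eqxx.
by move=> iS; rewrite setU1K.
Qed.

Lemma big_set_split (R : Type) (idx : R) (op : Monoid.com_law idx) (T : finType)
    (i : T) (F : {set T} -> R) :
  \big[op/idx]_(S : {set T}) F S =
  \big[op/idx]_(S : {set T} | i \notin S) op (F S) (F (i |: S)).
Proof.
rewrite (eq_bigl (fun S : {set T} => S \subset setT)); last by move=> S; rewrite subsetT.
rewrite (big_subset_split op _ (in_setT i)); apply: eq_bigl => S.
by rewrite subsetD1 subsetT.
Qed.

Section Expectation.
Variables (R : realFieldType) (T : finType).
Implicit Types (p : R) (E S A : {set T}) (f g : {set T} -> R).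

Definition bernoulli_weight p E : R := \prod_i (if i \in E then p else 1 - p).
Definition expect p f : R := \sum_(E : {set T}) bernoulli_weight p E * f E.
Definition prob p (A : pred {set T}) : R := expect p (fun E => (A E)%:R).
Definition bernoulli_mean p (w : bool -> R) : R := p * w true + (1 - p) * w false.
Definition independent_of (i : T) f := forall E, f (i |: E) = f (E :\ i).

Lemma bernoulli_weight_ge0 p E : 0 <= p <= 1 -> 0 <= bernoulli_weight p E.
Proof.
move=> /andP[p0 p1]; apply: prodr_ge0 => i _.
by case: ifP => _ //; rewrite subr_ge0.
Qed.

Lemma bernoulli_weight0 E : bernoulli_weight 0 E = (E == set0)%:R.
Proof.
rewrite /bernoulli_weight; have [->|/set0Pn[i iE]] := eqVneq E set0.
  by rewrite big1 // => i _; rewrite inE subr0.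
by rewrite (bigD1 i) //= iE mul0r.
Qed.

Lemma bernoulli_weight1 E : bernoulli_weight 1 E = (E == setT)%:R.
Proof.
rewrite /bernoulli_weight; have [->|] := eqVneq E setT.
  by rewrite big1 // => i _; rewrite inE.
rewrite -subTset => /subsetPn[i _ iE].
by rewrite (bigD1 i) //= (negPf iE) subrr mul0r.
Qed.

Lemma bernoulli_weight_card p E : bernoulli_weight p E = p ^+ #|E| * (1 - p) ^+ (#|T| - #|E|).
Proof.
rewrite /bernoulli_weight (bigID (fun i => i \in E)) /=; congr (_ * _).
  rewrite (eq_bigr (fun=> p)); first by rewrite prodr_const.
  by move=> i ->.
rewrite (eq_bigr (fun=> 1 - p)) => [|i /negPf->//]; rewrite prodr_const.
by rewrite -(cardC (mem E)) addKn; congr (_ ^+ _); apply: eq_card => i; rewrite !inE.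
Qed.

Lemma eq_expect p f g : f =1 g -> expect p f = expect p g.
Proof. by move=> fg; apply: eq_bigr => E _; rewrite fg. Qed.

Lemma expect0 f : expect 0 f = f set0.
Proof.
rewrite /expect (bigD1 set0) //= bernoulli_weight0 eqxx mul1r big1 ?addr0 // => E E0.
by rewrite bernoulli_weight0 (negPf E0) mul0r.
Qed.

Lemma expect1 f : expect 1 f = f setT.
Proof.
rewrite /expect (bigD1 setT) //= bernoulli_weight1 eqxx mul1r big1 ?addr0 // => E ET.
by rewrite bernoulli_weight1 (negPf ET) mul0r.
Qed.

Lemma expect_prod p (w : T -> bool -> R) :
  expect p (fun E => \prod_i w i (i \in E)) = \prod_i bernoulli_mean p (w i).
Proof.
rewrite /bernoulli_mean bigA_distr /=; apply: eq_bigr => E _.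
by rewrite -big_split /=; apply: eq_bigr => i _; case: ifP.
Qed.

Lemma expect_cst p c : expect p (fun=> c) = c.
Proof.
rewrite /expect -mulr_suml; set s := \sum_E _.
suff -> : s = 1 by rewrite mul1r.
transitivity (expect p (fun E => \prod_i (fun=> 1 : R) (i \in E))).
  by apply: eq_bigr => E _; rewrite big1 ?mulr1.
by rewrite (expect_prod p (fun _ _ => 1)) big1 // => i _; rewrite /bernoulli_mean; ring.
Qed.

Lemma expectD p f g : expect p (fun E => f E + g E) = expect p f + expect p g.
Proof. by rewrite /expect -big_split; apply: eq_bigr => E _; rewrite mulrDr. Qed.

Lemma expectZ p c f : expect p (fun E => c * f E) = c * expect p f.
Proof. by rewrite /expect mulr_sumr; apply: eq_bigr => E _; rewrite mulrCA. Qed.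

Lemma expectB p f g : expect p (fun E => f E - g E) = expect p f - expect p g.
Proof. by rewrite -mulN1r -expectZ -expectD; apply: eq_expect => E; rewrite mulN1r. Qed.

Lemma expect_sum p (I : Type) (r : seq I) (P : pred I) (F : I -> {set T} -> R) :
  expect p (fun E => \sum_(i <- r | P i) F i E) = \sum_(i <- r | P i) expect p (F i).
Proof. by rewrite /expect exchange_big; apply: eq_bigr => E _; exact: mulr_sumr. Qed.

Definition bernoulli_weight_except p (i : T) E : R :=
  \prod_(j | j != i) (if j \in E then p else 1 - p).

Lemma bernoulli_weightD1 p i E :
  bernoulli_weight p E = (if i \in E then p else 1 - p) * bernoulli_weight_except p i E.
Proof. by rewrite /bernoulli_weight (bigD1 i). Qed.

Lemma bernoulli_weight_exceptU1 p i E :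
  bernoulli_weight_except p i (i |: E) = bernoulli_weight_except p i E.
Proof. by apply: eq_bigr => j ji; rewrite in_setU1 (negPf ji). Qed.

Lemma expect_bernoulli_mean p i f :
  expect p f = \sum_(E : {set T} | i \notin E) bernoulli_weight_except p i E *
    bernoulli_mean p (fun b => f (if b then i |: E else E)).
Proof.
rewrite /expect (big_set_split _ i); apply: eq_bigr => E iE.
rewrite (bernoulli_weightD1 p i E) (bernoulli_weightD1 p i (i |: E)) (negPf iE) setU11.
by rewrite bernoulli_weight_exceptU1 /bernoulli_mean /=; ring.
Qed.

Lemma setD1_notin (i : T) E : i \notin E -> E :\ i = E.
Proof. by move=> iE; apply/setDidPl; rewrite disjoint_sym disjoints1. Qed.

Lemma expect_independent p i (w : bool -> R) f : independent_of i f ->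
  expect p (fun E => w (i \in E) * f E) = bernoulli_mean p w * expect p f.
Proof.
move=> fi; rewrite !(expect_bernoulli_mean p i) mulr_sumr; apply: eq_bigr => E iE.
have fiE : f (i |: E) = f E by rewrite fi setD1_notin.
by rewrite /bernoulli_mean fiE setU11 (negPf iE); ring.
Qed.

Section Positivity.
Variable p : R.
Hypothesis p01 : 0 <= p <= 1.

Lemma expect_ge0 f : (forall E, 0 <= f E) -> 0 <= expect p f.
Proof. by move=> f_ge0; apply: sumr_ge0 => E _; rewrite mulr_ge0 ?bernoulli_weight_ge0. Qed.

Lemma ler_expect f g : (forall E, f E <= g E) -> expect p f <= expect p g.
Proof. by move=> fg; rewrite -subr_ge0 -expectB; apply: expect_ge0 => E; rewrite subr_ge0. Qed.

Lemma prob_bounds (A : pred {set T}) : 0 <= prob p A <= 1.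
Proof.
apply/andP; split; first by apply: expect_ge0 => E; exact: ler0n.
by rewrite -[leRHS](expect_cst p); apply: ler_expect => E; rewrite lern1 leq_b1.
Qed.

Lemma expect_Cauchy_Schwarz f g :
  expect p (fun E => f E * g E) ^+ 2 <=
  expect p (fun E => f E ^+ 2) * expect p (fun E => g E ^+ 2).
Proof.
set a := expect p (fun E => f E ^+ 2); set b := expect p (fun E => f E * g E).
set c := expect p (fun E => g E ^+ 2).
have lagrange : expect p (fun E => expect p (fun D => (f E * g D - f D * g E) ^+ 2)) =
    2 * (a * c - b ^+ 2).
  have inner E : expect p (fun D => (f E * g D - f D * g E) ^+ 2) =
      c * f E ^+ 2 + (- 2 * b) * (f E * g E) + a * g E ^+ 2.
    rewrite (@eq_expect p _ (fun D => f E ^+ 2 * g D ^+ 2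
      + (- 2 * (f E * g E)) * (f D * g D) + g E ^+ 2 * f D ^+ 2)); last by move=> D; ring.
    by rewrite !expectD !expectZ -/a -/b -/c; ring.
  by under eq_expect do rewrite inner; rewrite !expectD !expectZ -/a -/b -/c; ring.
have : 0 <= expect p (fun E => expect p (fun D => (f E * g D - f D * g E) ^+ 2)).
  by apply: expect_ge0 => E; apply: expect_ge0 => D; exact: sqr_ge0.
by rewrite lagrange; lra.
Qed.

(* Twice Cauchy-Schwarz, using that an indicator equals its square. *)
Lemma expect_indicator_fourth (A : pred {set T}) g :
  expect p (fun E => (A E)%:R * g E) ^+ 4 <=
  prob p A ^+ 3 * expect p (fun E => g E ^+ 4).
Proof.
have AA E : (A E)%:R ^+ 2 = (A E)%:R :> R by case: (A E); rewrite ?expr1n ?expr0n.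
have prob_sqr : expect p (fun E => (A E)%:R ^+ 2) = prob p A by exact: eq_expect.
have [prob_ge0 _] := andP (prob_bounds A).
have Ag2_le : expect p (fun E => (A E)%:R * g E ^+ 2) ^+ 2 <=
    prob p A * expect p (fun E => g E ^+ 4).
  have g4 : expect p (fun E => (g E ^+ 2) ^+ 2) = expect p (fun E => g E ^+ 4).
    by apply: eq_expect => E; rewrite -exprM.
  by rewrite -g4 -prob_sqr; exact: expect_Cauchy_Schwarz.
have Ag_le : expect p (fun E => (A E)%:R * g E) ^+ 2 <=
    prob p A * expect p (fun E => (A E)%:R * g E ^+ 2).
  have Ag : expect p (fun E => (A E)%:R * ((A E)%:R * g E)) = expect p (fun E => (A E)%:R * g E).
    by apply: eq_expect => E; rewrite mulrA -expr2 AA.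
  have Ag2 : expect p (fun E => ((A E)%:R * g E) ^+ 2) = expect p (fun E => (A E)%:R * g E ^+ 2).
    by apply: eq_expect => E; rewrite exprMn AA.
  by rewrite -Ag2 -prob_sqr -{1}Ag; exact: expect_Cauchy_Schwarz.
apply: (@le_trans _ _ ((prob p A * expect p (fun E => (A E)%:R * g E ^+ 2)) ^+ 2)).
  rewrite (exprM _ 2 2) ler_pXn2r ?nnegrE ?sqr_ge0 //.
  by apply: le_trans Ag_le; exact: sqr_ge0.
by rewrite exprMn (exprSr _ 2) -mulrA ler_wpM2l ?sqr_ge0.
Qed.

End Positivity.

End Expectation.
Arguments eq_expect {R T p f g}.

Lemma expect_preimset (R : realFieldType) (T U : finType) (p : R) (h : T -> U)
    (f : {set T} -> R) : bijective h ->
  expect p (fun E => f (h @^-1: E)) = expect p f.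
Proof.
move=> bij_h; have [k hK kH] := bij_h; rewrite /expect [RHS](reindex_onto
  (fun E : {set U} => h @^-1: E) (fun E : {set T} => k @^-1: E)) /=; last first.
  by move=> E _; apply/setP => x; rewrite !inE hK.
apply: eq_big => [E|E _]; last first.
  congr (_ * _); rewrite /bernoulli_weight (reindex h) /=; last exact: onW_bij.
  by apply: eq_bigr => i _; rewrite inE.
by apply/esym/eqP/setP => x; rewrite !inE kH.
Qed.

Section WalshBasis.
Variables (R : rcfType) (p : R).
Hypothesis p01 : 0 < p < 1.

Let p_bounds : 0 <= p <= 1.
Proof. by case/andP: p01 => p0 p1; rewrite !ltW. Qed.

Definition std_bernoulli (b : bool) : R :=
  if b then Num.sqrt (1 - p) / Num.sqrt p else - (Num.sqrt p / Num.sqrt (1 - p)).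
Definition skewness : R := bernoulli_mean p (fun b => std_bernoulli b ^+ 3).
Definition kurtosis : R := bernoulli_mean p (fun b => std_bernoulli b ^+ 4).
Definition hyper_const : R := 3 + `|skewness| + `|kurtosis|.

Let sqrt_pq : [/\ Num.sqrt p != 0, Num.sqrt (1 - p) != 0,
  Num.sqrt p ^+ 2 = p & Num.sqrt (1 - p) ^+ 2 = 1 - p].
Proof.
have [p0 p1] := andP p01; have q0 : 0 < 1 - p by rewrite subr_gt0.
by rewrite !sqrtr_eq0 -!ltNge !sqr_sqrtr ?p0 ?q0 ?ltW.
Qed.

Lemma std_bernoulli_mean : bernoulli_mean p std_bernoulli = 0.
Proof.
have [s0 t0 ss tt] := sqrt_pq; rewrite /bernoulli_mean /std_bernoulli -{1}ss -{2}tt.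
by field; rewrite s0 t0.
Qed.

Lemma std_bernoulli_var : bernoulli_mean p (fun b => std_bernoulli b ^+ 2) = 1.
Proof.
have [p0 p1] := andP p01; have [s0 t0 ss tt] := sqrt_pq.
rewrite /bernoulli_mean /std_bernoulli sqrrN !expr_div_n ss tt.
by field; rewrite subr_eq0 gt_eqF // gt_eqF.
Qed.

Lemma std_bernoulli_mul : std_bernoulli true * std_bernoulli false = -1.
Proof. by have [s0 t0 _ _] := sqrt_pq; rewrite /std_bernoulli; field; rewrite s0 t0. Qed.

Lemma hyper_const_ge1 : 1 <= hyper_const.
Proof. by rewrite /hyper_const; have := normr_ge0 skewness; have := normr_ge0 kurtosis; lra. Qed.

Variable T : finType.
Implicit Types (E S A : {set T}) (f g h : {set T} -> R).

Definition walsh S E : R := \prod_(i in S) std_bernoulli (i \in E).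
Definition fourier f S : R := expect p (fun E => f E * walsh S E).

Lemma walsh_set0 E : walsh set0 E = 1.
Proof. exact: big_set0. Qed.

Lemma walshU1 i S E : i \notin S -> walsh (i |: S) E = std_bernoulli (i \in E) * walsh S E.
Proof. by move=> iS; rewrite /walsh big_setU1. Qed.

Lemma walsh_independent i S : i \notin S -> independent_of i (walsh S).
Proof.
move=> iS E; apply: eq_bigr => j jS; rewrite !inE.
by case: eqP jS => // ->; rewrite (negPf iS).
Qed.

Lemma walsh_orthonormal S S' : expect p (fun E => walsh S E * walsh S' E) = (S == S')%:R.
Proof.
pose w i b : R := (if i \in S then std_bernoulli b else 1) *
  (if i \in S' then std_bernoulli b else 1).
transitivity (expect p (fun E => \prod_i w i (i \in E))).
  apply: eq_expect => E; rewrite /walsh [X in X * _]big_mkcond [X in _ * X]big_mkcond.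
  by rewrite -big_split.
rewrite expect_prod.
have wE i : bernoulli_mean p (w i) = ((i \in S) == (i \in S'))%:R.
  rewrite /w; case: (i \in S); case: (i \in S') => /=; rewrite /bernoulli_mean.
  - by rewrite -!expr2; exact: std_bernoulli_var.
  - by rewrite !mulr1; exact: std_bernoulli_mean.
  - by rewrite !mul1r; exact: std_bernoulli_mean.
  - by ring.
have [SS'|] := eqVneq S S'; first by rewrite big1 // => i _; rewrite wE SS' eqxx.
case: (pickP (fun i => (i \in S) != (i \in S'))) => [i /negPf neq_i _|eqS /eqP[]].
  by rewrite (bigD1 i) //= wE neq_i mul0r.
by apply/setP => i; have /negbFE/eqP := eqS i.
Qed.

Lemma walsh_complete E E' :
  bernoulli_weight p E * \sum_S walsh S E * walsh S E' = (E == E')%:R.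
Proof.
have -> : \sum_S walsh S E * walsh S E' =
    \prod_i (std_bernoulli (i \in E) * std_bernoulli (i \in E') + 1).
  by rewrite bigA_distr; apply: eq_bigr => S _; rewrite /walsh -big_split /= big_mkcond.
have [<-|] := eqVneq E E'; last first.
  case: (pickP (fun i => (i \in E) != (i \in E'))) => [i neq_i _|eqE /eqP[]]; last first.
    by apply/setP => i; have /negbFE/eqP := eqE i.
  rewrite [X in _ * X](bigD1 i) //= (_ : _ + 1 = 0) ?mul0r ?mulr0 //.
  by move: neq_i; case: (i \in E); case: (i \in E') => // _;
    rewrite 1?[std_bernoulli false * _]mulrC std_bernoulli_mul addNr.
rewrite /bernoulli_weight -big_split /= big1 // => i _.
have [p0 p1] := andP p01; have [s0 t0 ss tt] := sqrt_pq.
rewrite /std_bernoulli -expr2; case: (i \in E); rewrite ?sqrrN expr_div_n ss tt;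
  by field; rewrite ?subr_eq0 gt_eqF.
Qed.

Lemma fourier_inversion f E : f E = \sum_S fourier f S * walsh S E.
Proof.
rewrite /fourier /expect; under eq_bigr do rewrite mulr_suml.
rewrite exchange_big /=; transitivity (\sum_E' f E' * (E' == E)%:R).
  by rewrite (bigD1 E) //= eqxx mulr1 big1 ?addr0 // => E' /negPf->; rewrite mulr0.
apply: eq_bigr => E' _; rewrite -walsh_complete mulrCA mulr_sumr mulr_sumr.
by apply: eq_bigr => S _; ring.
Qed.

Lemma parseval f : expect p (fun E => f E ^+ 2) = \sum_S fourier f S ^+ 2.
Proof.
transitivity (expect p (fun E => \sum_S fourier f S * (f E * walsh S E))).
  apply: eq_expect => E; rewrite expr2 {1}(fourier_inversion f) mulr_suml.
  by apply: eq_bigr => S _; ring.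
by rewrite expect_sum; apply: eq_bigr => S _; rewrite expectZ expr2.
Qed.

(** * Hypercontractivity *)

Lemma fourth_moment_split i g h : independent_of i g -> independent_of i h ->
  expect p (fun E => (g E + std_bernoulli (i \in E) * h E) ^+ 4) =
  expect p (fun E => g E ^+ 4) + 6 * expect p (fun E => g E ^+ 2 * h E ^+ 2) +
  4 * skewness * expect p (fun E => g E * h E ^+ 3) + kurtosis * expect p (fun E => h E ^+ 4).
Proof.
move=> gi hi.
have std_indep k u : independent_of i u ->
    expect p (fun E => std_bernoulli (i \in E) ^+ k * u E) =
    bernoulli_mean p (fun b => std_bernoulli b ^+ k) * expect p u.
  exact: (expect_independent _ (fun b => std_bernoulli b ^+ k)).
transitivity (expect p (fun E => g E ^+ 4)
  + 4 * expect p (fun E => std_bernoulli (i \in E) * (g E ^+ 3 * h E))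
  + 6 * expect p (fun E => std_bernoulli (i \in E) ^+ 2 * (g E ^+ 2 * h E ^+ 2))
  + 4 * expect p (fun E => std_bernoulli (i \in E) ^+ 3 * (g E * h E ^+ 3))
  + expect p (fun E => std_bernoulli (i \in E) ^+ 4 * h E ^+ 4)).
  by rewrite -!expectZ -!expectD; apply: eq_expect => E; ring.
rewrite !std_indep ?(expect_independent _ std_bernoulli);
  try by move=> E; rewrite !(gi, hi).
by rewrite std_bernoulli_mean std_bernoulli_var -/skewness -/kurtosis; ring.
Qed.

Lemma mixed_fourth_moment_le g h :
  2 * `|expect p (fun E => g E * h E ^+ 3)| <=
  expect p (fun E => g E ^+ 2 * h E ^+ 2) + expect p (fun E => h E ^+ 4).
Proof.
have signed (s : R) : s ^+ 2 = 1 -> s * (2 * expect p (fun E => g E * h E ^+ 3)) <=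
    expect p (fun E => g E ^+ 2 * h E ^+ 2) + expect p (fun E => h E ^+ 4).
  move=> s2; rewrite -!expectZ -expectD; apply: ler_expect => // E; rewrite -subr_ge0.
  rewrite (_ : _ - _ = (g E * h E - s * h E ^+ 2) ^+ 2 + (1 - s ^+ 2) * h E ^+ 4); last by ring.
  by rewrite s2 subrr mul0r addr0 sqr_ge0.
have := signed 1 (expr1n _ _); have := signed (-1) (sqrr_sign _ 1).
by case: (ger0P (expect p (fun E => g E * h E ^+ 3))) => _; lra.
Qed.

Lemma fourth_moment_step i g h a b :
  independent_of i g -> independent_of i h -> 0 <= a -> 0 <= b ->
  expect p (fun E => g E ^+ 4) <= a ^+ 2 -> expect p (fun E => h E ^+ 4) <= b ^+ 2 ->
  expect p (fun E => (g E + std_bernoulli (i \in E) * h E) ^+ 4) <= (a + hyper_const * b) ^+ 2.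
Proof.
move=> gi hi a0 b0 g4 h4; rewrite fourth_moment_split //.
have mixed := mixed_fourth_moment_le g h.
set G := expect p (fun E => g E ^+ 4) in g4 *; set H := expect p (fun E => h E ^+ 4) in h4 mixed *.
set X := expect p (fun E => g E ^+ 2 * h E ^+ 2) in mixed *.
set Y := expect p (fun E => g E * h E ^+ 3) in mixed *.
have X_le : X <= a * b.
  have G0 : 0 <= G by apply: expect_ge0 => // E; rewrite (exprM _ 2 2) sqr_ge0.
  have H0 : 0 <= H by apply: expect_ge0 => // E; rewrite (exprM _ 2 2) sqr_ge0.
  have X0 : 0 <= X by apply: expect_ge0 => // E; rewrite mulr_ge0 ?sqr_ge0.
  rewrite -(@ler_pXn2r _ 2) ?nnegrE ?mulr_ge0 // exprMn.
  apply: le_trans (_ : X ^+ 2 <= G * H) (ler_pM _ _ g4 h4) => //.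
  have := expect_Cauchy_Schwarz p_bounds (fun E => g E ^+ 2) (fun E => h E ^+ 2).
  by rewrite -/X; under eq_expect do rewrite -exprM;
    under [X in _ <= _ * X]eq_expect do rewrite -exprM.
have skewY : 4 * skewness * Y <= 2 * `|skewness| * (X + H).
  have := ler_norm (skewness * Y); rewrite normrM.
  by have := ler_wpM2l (normr_ge0 skewness) mixed; lra.
have s0 := normr_ge0 skewness; have k0 := normr_ge0 kurtosis; have k_le := ler_norm kurtosis.
have ab0 : 0 <= a * b by exact: mulr_ge0.
have X_coef : (6 + 2 * `|skewness|) * X <= 2 * hyper_const * (a * b).
  by apply: (@le_trans _ _ ((6 + 2 * `|skewness|) * (a * b)));
    [apply: ler_wpM2l | apply: ler_wpM2r]; rewrite ?/hyper_const //; lra.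
have H_coef : (kurtosis + 2 * `|skewness|) * H <= hyper_const ^+ 2 * b ^+ 2.
  apply: (@le_trans _ _ (hyper_const ^+ 2 * H)); last by apply: ler_wpM2l; rewrite ?sqr_ge0.
  apply: ler_wpM2r; first by apply: expect_ge0 => // E; rewrite (exprM _ 2 2) sqr_ge0.
  rewrite /hyper_const; have := sqr_ge0 (`|skewness| + `|kurtosis|); lra.
have -> : (a + hyper_const * b) ^+ 2 =
    a ^+ 2 + 2 * hyper_const * (a * b) + hyper_const ^+ 2 * b ^+ 2 by ring.
lra.
Qed.

Lemma hypercontractivity (c : {set T} -> R) A :
  expect p (fun E => (\sum_(S : {set T} | S \subset A) c S * walsh S E) ^+ 4) <=
  (\sum_(S : {set T} | S \subset A) hyper_const ^+ #|S| * c S ^+ 2) ^+ 2.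
Proof.
have K0 : 0 <= hyper_const := le_trans ler01 hyper_const_ge1.
elim: {A}_.+1 {-2}A (ltnSn #|A|) c => // n IHn A; rewrite ltnS => A_le c.
have [->|[i iA]] := set_0Vmem A.
  under eq_expect => E do under eq_bigl => S do rewrite subset0.
  under [X in _ <= X ^+ 2]eq_bigl => S do rewrite subset0.
  rewrite big_pred1_eq; under eq_expect => E do rewrite big_pred1_eq walsh_set0 mulr1.
  by rewrite expect_cst cards0 expr0 mul1r -exprM.
have Ai_lt : (#|A :\ i| < n)%N by move: A_le; rewrite (cardsD1 i) iA.
pose part d E := \sum_(S : {set T} | S \subset A :\ i) d S * walsh S E.
pose norm d := \sum_(S : {set T} | S \subset A :\ i) hyper_const ^+ #|S| * d S ^+ 2.
have norm_ge0 d : 0 <= norm d.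
  by apply: sumr_ge0 => S _; rewrite mulr_ge0 ?sqr_ge0 ?exprn_ge0.
have part_indep d : independent_of i (part d).
  move=> E; apply: eq_bigr => S; rewrite subsetD1 => /andP[_ iS].
  by rewrite walsh_independent.
have sumE E : \sum_(S : {set T} | S \subset A) c S * walsh S E =
    part c E + std_bernoulli (i \in E) * part (fun S => c (i |: S)) E.
  rewrite (big_subset_split _ _ iA) big_split /= mulr_sumr; congr (_ + _).
  by apply: eq_bigr => S; rewrite subsetD1 => /andP[_ iS]; rewrite walshU1 //; ring.
have normE : \sum_(S : {set T} | S \subset A) hyper_const ^+ #|S| * c S ^+ 2 =
    norm c + hyper_const * norm (fun S => c (i |: S)).
  rewrite (big_subset_split _ _ iA) big_split /= mulr_sumr; congr (_ + _).
  apply: eq_bigr => S; rewrite subsetD1 => /andP[_ iS].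
  by rewrite cardsU1 iS add1n exprS mulrA.
under eq_expect do rewrite sumE.
rewrite normE; apply: fourth_moment_step => //; exact: IHn.
Qed.

Definition low_weight f k : R := \sum_(S : {set T} | (#|S| <= k)%N) fourier f S ^+ 2.
Definition low_part f k E : R := \sum_(S : {set T} | (#|S| <= k)%N) fourier f S * walsh S E.

Lemma low_weight_ge0 f k : 0 <= low_weight f k.
Proof. by apply: sumr_ge0 => S _; exact: sqr_ge0. Qed.

Lemma low_weight0 f : low_weight f 0 = expect p f ^+ 2.
Proof.
rewrite /low_weight; under eq_bigl do rewrite leqn0 cards_eq0.
rewrite big_pred1_eq /fourier; congr (_ ^+ 2).
by apply: eq_expect => E; rewrite walsh_set0 mulr1.
Qed.

Lemma expect_mul_low_part f k : expect p (fun E => f E * low_part f k E) = low_weight f k.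
Proof.
transitivity (expect p (fun E => \sum_(S : {set T} | (#|S| <= k)%N)
  fourier f S * (f E * walsh S E))).
  by apply: eq_expect => E; rewrite mulr_sumr; apply: eq_bigr => S _; ring.
by rewrite expect_sum; apply: eq_bigr => S _; rewrite expectZ expr2.
Qed.

Lemma low_part_fourth_moment f k :
  expect p (fun E => low_part f k E ^+ 4) <= (hyper_const ^+ k * low_weight f k) ^+ 2.
Proof.
have K1 := hyper_const_ge1; have K0 : 0 <= hyper_const := le_trans ler01 K1.
pose c S := if (#|S| <= k)%N then fourier f S else 0.
have lowE E : low_part f k E = \sum_(S : {set T} | S \subset [set: T]) c S * walsh S E.
  rewrite /low_part big_mkcond; apply: eq_big => [S|S _]; first by rewrite subsetT.
  by rewrite /c; case: ifP => _; rewrite ?mul0r.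
under eq_expect do rewrite lowE.
apply: le_trans (hypercontractivity c [set: T]) _.
rewrite ler_pXn2r ?nnegrE ?mulr_ge0 ?exprn_ge0 ?low_weight_ge0 //; last first.
  by apply: sumr_ge0 => S _; rewrite mulr_ge0 ?sqr_ge0 ?exprn_ge0.
rewrite mulr_sumr [leRHS]big_mkcond [leLHS]big_mkcond /=; apply: ler_sum => S _.
rewrite subsetT /c; case: ifP => Sk; last by rewrite expr0n mulr0.
by rewrite ler_wpM2r ?sqr_ge0 // ler_weXn2l.
Qed.

Lemma level_inequality (A : pred {set T}) k :
  low_weight (fun E => (A E)%:R) k <= prob p A * Num.sqrt (prob p A) * hyper_const ^+ k.
Proof.
set W := low_weight _ k; set e := prob p A.
have K0 : 0 <= hyper_const := le_trans ler01 hyper_const_ge1.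
have W0 : 0 <= W := low_weight_ge0 _ _.
have e0 : 0 <= e by case/andP: (prob_bounds p_bounds A).
have [->|W_neq0] := eqVneq W 0; first by rewrite !mulr_ge0 ?sqrtr_ge0 ?exprn_ge0.
have W2 : 0 < W ^+ 2 by rewrite exprn_gt0 // lt_def W_neq0.
rewrite -(@ler_pXn2r _ 2) ?nnegrE ?mulr_ge0 ?sqrtr_ge0 ?exprn_ge0 //.
rewrite -(ler_pM2r W2) -exprD !exprMn sqr_sqrtr // -exprSr -mulrA -exprMn.
apply: le_trans (_ : _ <= e ^+ 3 * expect p (fun E => low_part (fun E => (A E)%:R) k E ^+ 4)) _.
  by rewrite /W -expect_mul_low_part; exact: expect_indicator_fourth.
by rewrite ler_wpM2l ?exprn_ge0 //; exact: low_part_fourth_moment.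
Qed.

End WalshBasis.

(** * Degree of a boolean function *)

Section Degree.
Implicit Types V W : finZmodType.

Definition difference V (h : V) (f : V -> bool) (x : V) : bool := f (x + h) (+) f x.

(* Degree less than [k], as the vanishing of all [k]-fold differences: in this form it is
   stable under composition with affine maps. *)
Fixpoint deg_lt V (k : nat) (f : V -> bool) : bool :=
  if k is l.+1 then [forall h, deg_lt l (difference h f)] else [forall x, ~~ f x].

Lemma deg_ltSP V k (f : V -> bool) :
  reflect (forall h, deg_lt k (difference h f)) (deg_lt k.+1 f).
Proof. exact: forallP. Qed.

Lemma eq_deg_lt V k (f g : V -> bool) : f =1 g -> deg_lt k f = deg_lt k g.
Proof.
elim: k f g => [|k IHk] f g fg /=; first by apply: eq_forallb => x; rewrite fg.
by apply: eq_forallb => h; apply: IHk => x; rewrite /difference !fg.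
Qed.

Lemma deg_lt_false V k : deg_lt k (fun _ : V => false).
Proof. by elim: k => [|k IHk] /=; apply/forallP. Qed.

Lemma deg_lt_addb V k (f g : V -> bool) :
  deg_lt k f -> deg_lt k g -> deg_lt k (fun x => f x (+) g x).
Proof.
elim: k f g => [|k IHk] f g /= /forallP hf /forallP hg; apply/forallP => h.
  by rewrite (negPf (hf h)) (negPf (hg h)).
rewrite -(eq_deg_lt _ (f := fun x => difference h f x (+) difference h g x)); first exact: IHk.
by move=> x; rewrite /difference addbACA.
Qed.

Lemma deg_lt_big_addb V k (I : Type) (r : seq I) (P : pred I) (F : I -> V -> bool) :
  (forall i, P i -> deg_lt k (F i)) ->
  deg_lt k (fun x => \big[addb/false]_(i <- r | P i) F i x).
Proof.
move=> degF; elim: r => [|i r IHr].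
  by rewrite (eq_deg_lt _ (g := fun=> false)) ?deg_lt_false // => x; rewrite big_nil.
pose s x := \big[addb/false]_(j <- r | P j) F j x.
rewrite (eq_deg_lt _ (g := fun x => if P i then F i x (+) s x else s x)).
  by case Pi: (P i); [apply: deg_lt_addb => //; exact: degF | exact: IHr].
by move=> x; rewrite big_cons.
Qed.

Lemma deg_lt_comp V W k (phi : V -> W) (f : W -> bool) :
  {morph phi : x y / x + y} -> deg_lt k f -> deg_lt k (f \o phi).
Proof.
move=> phiD; elim: k f => [|k IHk] f /= /forallP hf; apply/forallP => h //=.
rewrite (eq_deg_lt _ (g := difference (phi h) f \o phi)); first exact: IHk.
by move=> x; rewrite /difference /= phiD.
Qed.

Lemma deg_lt_shift V k (a : V) (f : V -> bool) :
  deg_lt k f -> deg_lt k (fun x => f (x + a)).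
Proof.
elim: k f => [|k IHk] f /= /forallP hf; apply/forallP => h //.
rewrite (eq_deg_lt _ (g := fun x => difference h f (x + a))); first exact: IHk.
by move=> x; rewrite /difference addrAC.
Qed.

Lemma deg_ltS V k (f : V -> bool) : deg_lt k f -> deg_lt k.+1 f.
Proof.
elim: k f => [|k IHk] f /forallP hf; apply/forallP => h; last exact: IHk.
by apply/forallP => x; rewrite /difference !(negPf (hf _)).
Qed.

Lemma deg_lt_leq V k l (f : V -> bool) : (k <= l)%N -> deg_lt k f -> deg_lt l f.
Proof. by move=> /subnK <-; elim: (_ - _)%N => // d IHd /IHd; exact: deg_ltS. Qed.

(* By linearity the bit at the origin is lost when some codeword vanishing at all the other
   received positions does not vanish there; whether [0] lies in [E] is irrelevant. *)
Definition origin_lost V (k : nat) (E : {set V}) : bool :=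
  [exists c : {ffun V -> bool}, [&& deg_lt k c, c 0 & [forall x, c x ==> (x \in 0 |: E)]]].

Lemma origin_lostP V k (E : {set V}) :
  reflect (exists c : V -> bool, [/\ deg_lt k c, c 0 & forall x, c x -> x \in 0 |: E])
    (origin_lost k E).
Proof.
apply: (iffP existsP) => [[c /and3P[degc c0 /forallP csub]]|[c [degc c0 csub]]].
  by exists c; split => // x; apply/implyP.
exists [ffun x => c x]; apply/and3P; split.
- by rewrite (eq_deg_lt _ (g := c)) // => x; rewrite ffunE.
- by rewrite ffunE.
- by apply/forallP => x; rewrite ffunE; apply/implyP/csub.
Qed.

Lemma origin_lostS V k (E E' : {set V}) : E \subset E' -> origin_lost k E -> origin_lost k E'.
Proof.
move=> sE /origin_lostP[c [degc c0 csub]]; apply/origin_lostP; exists c; split => // x /csub.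
by apply/subsetP/setUS.
Qed.

Lemma origin_lost_setU1 V k (E : {set V}) : origin_lost k (0 |: E) = origin_lost k (E :\ 0).
Proof.
by apply/origin_lostP/origin_lostP => -[c [degc c0 csub]]; exists c; split => // x /csub;
  rewrite !inE; case: eqP.
Qed.

Lemma origin_lost_preim V W k (phi : V -> W) (E : {set W}) :
  {morph phi : x y / x + y} -> injective phi ->
  origin_lost k E -> origin_lost k (phi @^-1: E).
Proof.
move=> phiD phi_inj /origin_lostP[c [degc c0 csub]].
have phi0 : phi 0 = 0 by apply: (@addrI _ (phi 0)); rewrite -phiD !addr0.
apply/origin_lostP; exists (c \o phi); split; first exact: deg_lt_comp.
  by rewrite /= phi0.
by move=> x /= /csub; rewrite !inE -{1}phi0 (inj_eq phi_inj).
Qed.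

End Degree.

(** * The two-look inequality *)

Lemma card_annihilator (F : finFieldType) n a (S : {set 'rV[F]_n}) :
  (#|[set M : 'M[F]_(n, a) | [forall x in S, x *m M == 0%R]]| * #|S| ^ a
    <= #|{: 'M[F]_(n, a)}|)%N.
Proof.
pose A := \matrix_(i < #|S|) enum_val i; pose K := mxabelem.rowg (kermx A^T).
have cardS : (#|S| <= #|F| ^ \rank A)%N.
  rewrite -mxabelem.card_rowg; apply/subset_leq_card/subsetP => x xS.
  rewrite mxabelem.mem_rowg -(enum_rankK_in xS xS) -(rowK (fun i : 'I_#|S| => enum_val i)).
  exact: row_sub.
have cardK : #|K| = (#|F| ^ (n - \rank A))%N.
  by rewrite mxabelem.card_rowg mxrank_ker mxrank_tr.
pose rows (M : 'M[F]_(n, a)) := [ffun j => row j M^T].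
have rows_inj : injective rows.
  move=> M N /ffunP MN; apply: trmx_inj; apply/row_matrixP => j.
  by have := MN j; rewrite !ffunE.
have card_ann : (#|[set M : 'M[F]_(n, a) | [forall x in S, x *m M == 0%R]]| <= #|K| ^ a)%N.
  rewrite -[a in leqRHS]card_ord -card_ffun_on -(card_imset _ rows_inj).
  apply/subset_leq_card/subsetP => _ /imsetP[M /[!inE] /forall_inP annM ->].
  apply/ffun_onP => j; rewrite ffunE mxabelem.mem_rowg; apply: (submx_trans (row_sub _ _)).
  apply/sub_kermxP; rewrite -trmx_mul; apply/eqP; rewrite trmx_eq0; apply/eqP/row_matrixP => i.
  by rewrite row_mul rowK row0; apply/eqP/annM; exact: enum_valP.
have cardSa : (#|S| ^ a <= (#|F| ^ \rank A) ^ a)%N by case: (a) => // b; rewrite leq_exp2r.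
rewrite card_mx expnM; apply: leq_trans (leq_mul card_ann cardSa) _.
by rewrite cardK -expnMn -expnD subnK ?rank_leq_col.
Qed.

Lemma walsh_preimset (R : rcfType) (p : R) (T U : finType) (phi : T -> U) S (E : {set U}) :
  injective phi -> walsh p S (phi @^-1: E) = walsh p (phi @: S) E.
Proof.
move=> phi_inj; rewrite /walsh big_imset /=; last by move=> x y _ _; exact: phi_inj.
by apply: eq_bigr => i _; rewrite inE.
Qed.

Lemma expect_preimset_mul (R : rcfType) (p : R) (T U : finType) (phi psi : T -> U) f :
  0 < p < 1 -> injective phi -> injective psi ->
  expect p (fun E : {set U} => f (phi @^-1: E) * f (psi @^-1: E)) =
  \sum_S \sum_S' fourier p f S * fourier p f S' * (phi @: S == psi @: S')%:R.
Proof.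
move=> p01 phi_inj psi_inj.
transitivity (expect p (fun E => \sum_S \sum_S' fourier p f S * fourier p f S' *
    (walsh p (phi @: S) E * walsh p (psi @: S') E))).
  apply: eq_expect => E; rewrite (fourier_inversion p01 f (phi @^-1: E)).
  rewrite (fourier_inversion p01 f (psi @^-1: E)) mulr_suml.
  apply: eq_bigr => S _; rewrite mulr_sumr; apply: eq_bigr => S' _.
  by rewrite !walsh_preimset // mulrACA.
rewrite expect_sum; apply: eq_bigr => S _; rewrite expect_sum; apply: eq_bigr => S' _.
by rewrite expectZ walsh_orthonormal.
Qed.

Section ExitProbability.

Definition exit_prob (R : realFieldType) (n k : nat) (p : R) : R :=
  prob p (@origin_lost 'rV[bool]_n k).

Variables (R : rcfType) (p : R).
Hypothesis p01 : 0 < p < 1.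
Variables (n a k : nat).

Let p_bounds : 0 <= p <= 1.
Proof. by case/andP: p01 => p0 p1; rewrite !ltW. Qed.

Let lost (E : {set 'rV[bool]_n}) : R := (origin_lost k E)%:R.

Lemma fourier_origin_lost (S : {set 'rV[bool]_n}) : 0 \in S -> fourier p lost S = 0.
Proof.
move=> S0; rewrite /fourier -(setD1K S0); have S0' : 0 \notin S :\ 0 by rewrite !inE eqxx.
transitivity (expect p (fun E => std_bernoulli p (0 \in E) * (lost E * walsh p (S :\ 0) E))).
  by apply: eq_expect => E; rewrite walshU1 // mulrCA.
rewrite (expect_independent _ (std_bernoulli p)) ?std_bernoulli_mean ?mul0r // => E.
by rewrite /lost origin_lost_setU1 walsh_independent.
Qed.

(* Two n-dimensional subspaces of an (n+a)-dimensional one, the graphs of [0] and of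
   [M], meet exactly in the kernel of [M]; the bit at the origin is lost in the large
   code only if it is lost in both restrictions. *)
Lemma exit_prob_two_looks (M : 'M[bool]_(n, a)) :
  exit_prob (n + a) k p <=
  \sum_(S : {set 'rV[bool]_n} | [forall x in S, x *m M == 0]) fourier p lost S ^+ 2.
Proof.
pose graph (N : 'M[bool]_(n, a)) (x : 'rV[bool]_n) := row_mx x (x *m N).
have graphD N : {morph graph N : x y / x + y}.
  by move=> x y; rewrite /graph add_row_mx mulmxDl.
have graph_inj N : injective (graph N) by move=> x y /eq_row_mx[].
have graph_eq (S S' : {set 'rV[bool]_n}) : graph 0 @: S = graph M @: S' ->
    S' = S /\ [forall x in S, x *m M == 0].
  move=> eqS; have S_sub x : x \in S -> x \in S' /\ x *m M = 0.
    move=> /(imset_f (graph 0)); rewrite eqS => /imsetP[y yS' /eq_row_mx[-> <-]].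
    by rewrite mulmx0.
  split; last by apply/forall_inP => x /S_sub[_ ->].
  apply/setP => x; apply/idP/idP => [|/S_sub[]//].
  by move=> /(imset_f (graph M)); rewrite -eqS => /imsetP[y yS /eq_row_mx[->]].
apply: (@le_trans _ _ (expect p (fun E => lost (graph 0 @^-1: E) * lost (graph M @^-1: E)))).
  apply: ler_expect => // E; rewrite /lost -natrM ler_nat.
  by have [lostE|//] := boolP (origin_lost k E); rewrite !(origin_lost_preim _ _ lostE).
rewrite expect_preimset_mul // [leRHS]big_mkcond; apply: ler_sum => S _.
rewrite (bigD1 S) //= big1 ?addr0 => [|S' SS'].
  case: eqP => [/graph_eq[_ ->]|_]; first by rewrite mulr1 -expr2.
  by rewrite mulr0; case: ifP; rewrite ?sqr_ge0.
by case: eqP => [/graph_eq[eqS _]|]; [rewrite eqS eqxx in SS' | rewrite mulr0].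
Qed.

Lemma exit_prob_average :
  exit_prob (n + a) k p <=
  \sum_(S : {set 'rV[bool]_n}) fourier p lost S ^+ 2 / (#|S|.+1)%:R ^+ a.
Proof.
set N := #|{: 'M[bool]_(n, a)}|.
have N0 : 0 < N%:R :> R by rewrite ltr0n; apply/card_gt0P; exists 0.
rewrite -(ler_pM2l N0) mulr_natl -sumr_const.
apply: le_trans (ler_sum _ (fun M _ => exit_prob_two_looks M)) _.
rewrite (exchange_big_dep predT) //= mulr_sumr; apply: ler_sum => S _.
rewrite sumr_const; have [S0|S0] := boolP (0 \in S).
  by rewrite fourier_origin_lost // expr0n mul0rn mul0r mulr0.
rewrite -[leLHS]mulr_natr mulrCA; apply: ler_wpM2l; first exact: sqr_ge0.
rewrite ler_pdivlMr ?exprn_gt0 ?ltr0n // -natrX -natrM ler_nat.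
have := card_annihilator a (0 |: S); rewrite cardsU1 S0 add1n; apply: leq_trans.
rewrite leq_mul2r; apply/orP; right; apply/subset_leq_card/subsetP => M.
rewrite !inE => /forall_inP annM; apply/forall_inP => x.
by rewrite in_setU1 => /orP[/eqP->|/annM//]; rewrite mul0mx.
Qed.

Lemma sum_sqr_fourier_lost : \sum_S fourier p lost S ^+ 2 = exit_prob n k p.
Proof.
rewrite -parseval //; apply: eq_expect => E.
by rewrite /lost; case: origin_lost; rewrite ?expr1n ?expr0n.
Qed.

Lemma exit_prob_extend_le : exit_prob (n + a) k p <= exit_prob n k p.
Proof.
apply: le_trans exit_prob_average _; rewrite -sum_sqr_fourier_lost.
apply: ler_sum => S _; rewrite ler_piMr ?sqr_ge0 // invf_le1 ?exprn_gt0 ?ltr0n //.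
by rewrite -natrX ler1n expn_gt0.
Qed.

Lemma exit_prob_low_weight l :
  exit_prob (n + a) k p <= low_weight p lost l + exit_prob n k p / l.+2%:R ^+ a.
Proof.
apply: le_trans exit_prob_average _.
rewrite -sum_sqr_fourier_lost mulr_suml /low_weight [X in X + _]big_mkcond -big_split.
apply: ler_sum => S _ /=; have sqr0 : 0 <= fourier p lost S ^+ 2 by exact: sqr_ge0.
have inv0 i : 0 <= (i%:R ^+ a)^-1 :> R by rewrite invr_ge0 exprn_ge0 ?ler0n.
case: leqP => Sl.
  apply: ler_wpDr; first by rewrite mulr_ge0.
  rewrite ler_piMr // invf_le1 ?exprn_gt0 ?ltr0n //.
  by rewrite -natrX ler1n expn_gt0.
rewrite add0r; apply: ler_wpM2l => //.
rewrite lef_pV2 ?posrE ?exprn_gt0 ?ltr0n //.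
by apply: lerXn2r; rewrite ?nnegrE ?ler0n // ler_nat.
Qed.

Lemma exit_prob_sqr : exit_prob (n + a) k p <= exit_prob n k p ^+ 2 + exit_prob n k p / 2 ^+ a.
Proof. by have := exit_prob_low_weight 0; rewrite low_weight0. Qed.

Lemma exit_prob_boost l :
  exit_prob (n + a) k p <=
  exit_prob n k p * (Num.sqrt (exit_prob n k p) * hyper_const p ^+ l + (l.+2%:R ^+ a)^-1).
Proof.
apply: le_trans (exit_prob_low_weight l) _.
by rewrite mulrDr lerD2r mulrA; exact: (level_inequality p01 (@origin_lost 'rV[bool]_n k) l).
Qed.

End ExitProbability.

(** * Algebraic normal form *)

HB.instance Definition _ (m : nat) := GRing.Zmodule.copy (point m) {ffun 'I_m -> bool}.
HB.instance Definition _ (m : nat) := Finite.copy (point m) {ffun 'I_m -> bool}.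

Section AlgebraicNormalForm.
Variable m : nat.
Implicit Types (A B X : {set 'I_m}) (x : point m).

Definition indicator_point A : point m := [ffun i => i \in A].
Definition anf_word (S : {set {set 'I_m}}) : word m :=
  [ffun x => \big[addb/false]_(A in S) monomial_eval A x].
Definition anf_coef (w : word m) : {set {set 'I_m}} :=
  [set A : {set 'I_m} | \big[addb/false]_(B : {set 'I_m} | B \subset A) w (indicator_point B)].

Lemma addb_moebius (F : {set 'I_m} -> bool) X :
  \big[addb/false]_(A : {set 'I_m} | A \subset X)
    \big[addb/false]_(B : {set 'I_m} | B \subset A) F B = F X.
Proof.
elim: {X}_.+1 {-2}X (ltnSn #|X|) F => // n IHn X; rewrite ltnS => X_le F.
have [->|[i iX]] := set_0Vmem X.
  under eq_bigl do rewrite subset0; rewrite big_pred1_eq.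
  by under eq_bigl do rewrite subset0; rewrite big_pred1_eq.
have Xi_lt : (#|X :\ i| < n)%N by move: X_le; rewrite (cardsD1 i) iX.
rewrite (big_subset_split _ _ iX).
rewrite (eq_bigr (fun A => \big[addb/false]_(B : {set 'I_m} | B \subset A) F (i |: B))).
  by rewrite IHn // setD1K.
move=> A; rewrite subsetD1 => /andP[_ iA].
rewrite (@big_subset_split _ _ _ _ i (i |: A)) ?setU11 // setU1K // big_split /=.
by rewrite addbA addbb.
Qed.

Lemma monomial_eval_indicator A B : monomial_eval A (indicator_point B) = (A \subset B).
Proof. by apply/forall_inP/subsetP => AB i /AB; rewrite ffunE. Qed.

Lemma anf_word_indicator S X :
  anf_word S (indicator_point X) = \big[addb/false]_(A : {set 'I_m} | A \subset X) (A \in S).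
Proof.
rewrite ffunE [LHS]big_mkcond [RHS]big_mkcond; apply: eq_bigr => A _.
by rewrite monomial_eval_indicator; case: ifP; case: ifP.
Qed.

Lemma indicator_pointK x : indicator_point [set i | x i] = x.
Proof. by apply/ffunP => i; rewrite ffunE inE. Qed.

Lemma anf_word_inj : injective anf_word.
Proof.
move=> S S' SS'; apply/setP => X.
rewrite -(addb_moebius (fun A => A \in S)) -(addb_moebius (fun A => A \in S')).
by apply: eq_bigr => A _; rewrite -!anf_word_indicator SS'.
Qed.

Lemma anf_coefK w : anf_word (anf_coef w) = w.
Proof.
apply/ffunP => x; rewrite -(indicator_pointK x) anf_word_indicator.
rewrite -(addb_moebius (fun B => w (indicator_point B))).
by apply: eq_bigr => A _; rewrite inE.
Qed.

Lemma RM_anf_word v : RM v m = anf_word @: powerset [set A : {set 'I_m} | (#|A| <= v)%N].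
Proof.
apply/setP => w; apply/idP/imsetP.
  rewrite inE => /existsP[S /andP[S_sub /forallP wS]]; exists S; first by rewrite inE.
  by apply/ffunP => x; rewrite ffunE; apply/eqP.
case=> S; rewrite !inE => S_sub ->; apply/existsP; exists S; rewrite S_sub /=.
by apply/forallP => x; rewrite ffunE.
Qed.

Lemma card_RM v : #|RM v m| = (2 ^ \sum_(0 <= k < v.+1) 'C(m, k))%N.
Proof.
rewrite RM_anf_word card_imset; last exact: anf_word_inj.
rewrite card_powerset -sum1_card; congr (_ ^ _)%N.
rewrite (partition_big (fun A : {set 'I_m} => inord #|A| : 'I_v.+1) xpredT) //=.
rewrite big_mkord; apply: eq_bigr => k _; rewrite sum1_card.
have := card_draws 'I_m k; rewrite card_ord => <-; apply: eq_card => A.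
rewrite !inE unfold_in /= inE; apply/andP/eqP => [[A_le /eqP <-]|A_k].
  by rewrite inordK.
by rewrite A_k -ltnS ltn_ord; split => //; apply/eqP/val_inj; rewrite /= inordK.
Qed.

Lemma deg_lt_mul_coord k i (f : point m -> bool) :
  deg_lt k f -> deg_lt k.+1 (fun x => x i && f x).
Proof.
elim: k f => [|k IHk] f deg_f.
  rewrite (eq_deg_lt _ (g := fun=> false)) ?deg_lt_false // => x.
  by rewrite (negPf (forallP deg_f x)) andbF.
apply/deg_ltSP => h.
have deg_diff : deg_lt k.+1 (fun x => x i && difference h f x).
  by apply: IHk; exact: (deg_ltSP _ _ deg_f).
have deg_h : deg_lt k.+1 (fun x => h i && f (x + h)).
  by case: (h i); [exact: (deg_lt_shift h deg_f) | exact: deg_lt_false].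
rewrite (eq_deg_lt _ (g := fun x => (x i && difference h f x) (+) (h i && f (x + h)))).
  exact: deg_lt_addb.
move=> x; rewrite /difference ffunE.
by case: (x i); case: (h i); case: (f _); case: (f _).
Qed.

Lemma deg_lt_monomial A : deg_lt #|A|.+1 (monomial_eval A).
Proof.
elim: {A}_.+1 {-2}A (ltnSn #|A|) => // n IHn A; rewrite ltnS => A_le.
have [->|[i iA]] := set_0Vmem A.
  rewrite cards0 (eq_deg_lt _ (g := fun=> true)); first by apply/forallP => h; apply/forallP.
  by move=> x; apply/forall_inP => i; rewrite inE.
have Ai_lt : (#|A :\ i| < n)%N by move: A_le; rewrite (cardsD1 i) iA.
rewrite (cardsD1 i) iA add1n.
rewrite (eq_deg_lt _ (g := fun x => x i && monomial_eval (A :\ i) x)).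
  by apply: deg_lt_mul_coord; exact: IHn.
move=> x; apply/forall_inP/andP => [xA|[xi /forall_inP xA] j jA].
  by split; [exact: xA | apply/forall_inP => j; rewrite inE => /andP[_ /xA]].
by have [->//|ji] := eqVneq j i; apply: xA; rewrite !inE ji.
Qed.

Lemma addb_subcube_deg_lt k A (f : point m -> bool) x : (k <= #|A|)%N -> deg_lt k f ->
  \big[addb/false]_(B : {set 'I_m} | B \subset A) f (x + indicator_point B) = false.
Proof.
elim: k A f x => [|k IHk] A f x kA /forallP deg_f.
  by rewrite big1 // => B _; exact/negbTE.
have [i iA] : exists i, i \in A by apply/card_gt0P; exact: leq_trans kA.
rewrite (big_subset_split _ _ iA) -[RHS](IHk (A :\ i) _ x _ (deg_f (indicator_point [set i]))).
  apply: eq_bigr => B; rewrite subsetD1 => /andP[_ iB].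
  rewrite /difference addbC -addrA /=; congr (_ (+) f (x + _)).
  apply/ffunP => j; rewrite !ffunE !inE.
  by case: eqP => [->|]; [rewrite (negPf iB) | case: (j \in B)].
by move: kA; rewrite (cardsD1 i) iA.
Qed.

Lemma mem_RM v (w : word m) : (w \in RM v m) = deg_lt v.+1 (fun x : point m => w x).
Proof.
rewrite RM_anf_word; apply/imsetP/idP => [[S]|deg_w]; last first.
  exists (anf_coef w); last by rewrite anf_coefK.
  rewrite inE; apply/subsetP => A; rewrite !inE; apply: contraTT; rewrite -ltnNge => vA.
  have := addb_subcube_deg_lt 0 vA deg_w; under eq_bigr do rewrite add0r.
  by move=> ->.
rewrite inE => /subsetP S_sub ->.
rewrite (eq_deg_lt _ (g := fun x => \big[addb/false]_(A in S) monomial_eval A x)); last first.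
  by move=> x; rewrite ffunE.
apply: deg_lt_big_addb => A /S_sub; rewrite inE => Av.
by apply: deg_lt_leq (deg_lt_monomial A); rewrite ltnS.
Qed.

End AlgebraicNormalForm.

(** * Supports of subcodes *)

Notation codeword V := {ffun V -> bool^o}.

Lemma mem_span_closed (K : fieldType) (vT : vectType K) (s : seq vT) (v : vT) :
  0 \in s -> (forall a, {in s &, forall x y, a *: x + y \in s}) -> (v \in <<s>>%VS) = (v \in s).
Proof.
move=> s0 s_lin; apply/idP/idP; last exact: memv_span.
move=> /(@coord_span _ _ _ (in_tuple s)) ->; apply: (big_ind (fun x => x \in s)) => //.
  by move=> x y xs ys; rewrite -[x]scale1r s_lin.
by move=> i _; rewrite -[_ *: _]addr0 s_lin ?mem_nth.
Qed.

Section LinearMaps.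
Variables (V W : finType).

Definition eval_at (i : V) (c : codeword V) : bool^o := c i.

Fact eval_at_linear i : linear (eval_at i).
Proof. by move=> a c d; rewrite /eval_at !ffunE. Qed.

HB.instance Definition _ i :=
  GRing.isLinear.Build bool (codeword V) bool^o _ (eval_at i) (eval_at_linear i).

Definition pullback (phi : V -> W) (c : codeword W) : codeword V := [ffun x => c (phi x)].

Fact pullback_linear phi : linear (pullback phi).
Proof. by move=> a c d; apply/ffunP => x; rewrite !ffunE. Qed.

HB.instance Definition _ phi :=
  GRing.isLinear.Build bool (codeword W) (codeword V) _ (pullback phi) (pullback_linear phi).

End LinearMaps.

Section Support.
Variable V : finType.
Implicit Types (C : {vspace codeword V}) (c : codeword V).

Definition support C : {set V} := [set x | [exists c : codeword V, (c \in C) && c x]].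

Lemma supportP C x : reflect (exists2 c : codeword V, c \in C & c x) (x \in support C).
Proof.
by rewrite inE; apply: (iffP existsP) => [[c /andP[]]|[c cC cx]]; exists c => //; apply/andP.
Qed.

Lemma support_eq0 C : support C = set0 -> C = 0%VS.
Proof.
move=> /setP supp0; apply/eqP; rewrite -subv0; apply/subvP => c cC.
rewrite memv0; apply/eqP/ffunP => x; rewrite ffunE; apply/negbTE/negP => cx.
by have := supp0 x; rewrite in_set0 => /supportP[]; exists c.
Qed.

Lemma supportS C C' : (C <= C')%VS -> support C \subset support C'.
Proof.
move=> /subvP CC'; apply/subsetP => x /supportP[c cC cx].
by apply/supportP; exists c => //; exact: CC'.
Qed.

End Support.

Lemma deg_lt0_code_eq0 (V : finZmodType) (C : {vspace codeword V}) :
  (forall c : codeword V, c \in C -> deg_lt 0 c) -> C = 0%VS.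
Proof.
move=> deg_C; apply: support_eq0; apply/setP => x; rewrite in_set0; apply/negP.
by case/supportP => c /deg_C/forallP/(_ x)/negP.
Qed.

Section RowSplit.
Variable m : nat.
Implicit Types (b : bool) (x : 'rV[bool]_m) (C : {vspace codeword 'rV[bool]_(1 + m)}).

Definition row_cons b x : 'rV[bool]_(1 + m) := row_mx (b%:M : 'rV[bool]_1) x.

Definition hyperplane_code b C := (linfun (pullback (row_cons b)) @: C)%VS.
Definition vanishing_code b C := (C :&: lker (linfun (pullback (row_cons b))))%VS.

Lemma row_cons_inj b b' x x' : row_cons b x = row_cons b' x' -> b = b' /\ x = x'.
Proof. by move=> /eq_row_mx[/matrixP/(_ 0 0)]; rewrite !mxE eqxx !mulr1n. Qed.

Lemma row_consD b b' x x' : row_cons b x + row_cons b' x' = row_cons (b (+) b') (x + x').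
Proof.
rewrite /row_cons add_row_mx; congr row_mx.
by apply/matrixP => i j; rewrite !ord1 !mxE eqxx.
Qed.

Lemma row_consP (y : 'rV[bool]_(1 + m)) : exists b x, y = row_cons b x.
Proof.
exists (y 0 (lshift m 0)), (rsubmx y); rewrite -[LHS]hsubmxK; congr row_mx.
by apply/matrixP => i j; rewrite !ord1 !mxE eqxx mulr1n.
Qed.

Lemma vanishing_codeP b C (c : codeword 'rV[bool]_(1 + m)) :
  reflect (c \in C /\ forall x, c (row_cons b x) = false) (c \in vanishing_code b C).
Proof.
rewrite memv_cap memv_ker lfunE /=; apply: (iffP andP) => -[cC].
  by move=> /eqP/ffunP c0; split => // x; have := c0 x; rewrite !ffunE.
by move=> c0; split => //; apply/eqP/ffunP => x; rewrite !ffunE c0.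
Qed.

Lemma deg_lt_row_cons b k (c : codeword 'rV[bool]_(1 + m)) :
  deg_lt k c -> deg_lt k (pullback (row_cons b) c).
Proof.
move=> deg_c; pose f := (fun y => c (y + row_cons b 0)) \o row_cons false.
rewrite (eq_deg_lt _ (g := f)); last by move=> x; rewrite ffunE /f /= row_consD addr0.
by apply: deg_lt_comp; [move=> x y; rewrite row_consD | exact: deg_lt_shift].
Qed.

(* On the other hyperplane such a function is its difference along the first coordinate. *)
Lemma deg_lt_vanishing b k (c : codeword 'rV[bool]_(1 + m)) :
  deg_lt k.+1 c -> (forall x, c (row_cons b x) = false) ->
  deg_lt k (pullback (row_cons (~~ b)) c).
Proof.
move=> /deg_ltSP/(_ (row_cons true 0)) deg_c c0.
pose f := (fun y => difference (row_cons true 0) c (y + row_cons b 0)) \o row_cons false.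
rewrite (eq_deg_lt _ (g := f)).
  by apply: deg_lt_comp; [move=> x y; rewrite row_consD | exact: deg_lt_shift].
by move=> x; rewrite ffunE /f /= /difference !row_consD !addr0 addbT /= c0 addbF.
Qed.

Lemma dim_hyperplane_split b C :
  \dim C = (\dim (hyperplane_code b C) + \dim (hyperplane_code (~~ b) (vanishing_code b C)))%N.
Proof.
rewrite -(limg_ker_dim (linfun (pullback (row_cons b))) C) addnC; congr (_ + _)%N.
rewrite [RHS]limg_dim_eq //; apply/eqP; rewrite -subv0; apply/subvP => c.
rewrite memv_cap memv_ker lfunE /= => /andP[/vanishing_codeP[_ c0] /eqP/ffunP c0'].
rewrite memv0; apply/eqP/ffunP => y; rewrite ffunE; have [b' [x ->]] := row_consP y.
case: (eqVneq b b') => [<-//|]; have := c0' x; rewrite !ffunE => + bb'.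
by case: b b' bb' {c0 c0'} => -[].
Qed.

Lemma card_support_hyperplanes b C :
  (#|support (hyperplane_code b C)| + #|support (hyperplane_code (~~ b) C)| <= #|support C|)%N.
Proof.
have inj b' : injective (row_cons b') by move=> x y /row_cons_inj[].
have supp_sub b' : row_cons b' @: support (hyperplane_code b' C) \subset support C.
  apply/subsetP => _ /imsetP[x /supportP[_ /memv_imgP[c cC ->]] + ->].
  by rewrite lfunE ffunE => cx; apply/supportP; exists c.
rewrite -(card_imset _ (inj b)) -[X in (_ + X <= _)%N](card_imset _ (inj (~~ b))).
rewrite -cardsUI [X in (_ + X <= _)%N](_ : _ = 0)%N ?addn0.
  by apply: subset_leq_card; rewrite subUset !supp_sub.
apply/eqP; rewrite cards_eq0 -subset0; apply/subsetP => y /setIP[/imsetP[x _ ->]].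
by case/imsetP => x' _ /row_cons_inj[]; case: (b).
Qed.

End RowSplit.

Section SubcodeDimension.
Variables (R : realFieldType) (phi : nat -> R) (th : R).
Hypothesis th1 : 1 <= th.
Hypothesis phi_ge0 : forall u, 0 <= phi u.
Hypothesis phi1 : 1 <= phi 1.
Hypothesis phi_superadditive : forall u u', (u <= u')%N ->
  th * phi u + phi u' <= phi (u + u')%N.

Let th0 : 0 <= th := le_trans ler01 th1.

Lemma superadditive_mono u u' : (u <= u')%N -> phi u <= phi u'.
Proof.
move=> /subnKC <-; move: (u' - u)%N => d; case/orP: (leq_total u d) => ud.
  apply: le_trans (phi_superadditive ud); have := ler_peMl (phi_ge0 u) th1.
  by have := phi_ge0 d; lra.
rewrite addnC; apply: le_trans (phi_superadditive ud); rewrite lerDr.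
by rewrite mulr_ge0.
Qed.

Lemma dim_le_support_row0 k (C : {vspace codeword 'rV[bool]_0}) :
  th * (\dim C)%:R <= th ^+ k.+1 * phi #|support C|.
Proof.
have [supp0|[x x_supp]] := set_0Vmem (support C).
  by rewrite (support_eq0 supp0) dimv0 mulr0 mulr_ge0 ?exprn_ge0.
have dim_le1 : (\dim C <= 1)%N.
  by rewrite (leq_trans (dimvS (subvf C))) // dimvf /dim /= card_mx card_bool mul1n.
have phi_supp : 1 <= phi #|support C|.
  by apply: le_trans phi1 (superadditive_mono _); apply/card_gt0P; exists x.
apply: (@le_trans _ _ th); first by rewrite ler_piMr // lern1.
by rewrite exprS -mulrA ler_peMr // mulr_ege1 // exprn_ege1.
Qed.

Lemma dim_le_support m k (C : {vspace codeword 'rV[bool]_m}) :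
  (forall c : codeword 'rV[bool]_m, c \in C -> deg_lt k c) ->
  th ^+ m.+1 * (\dim C)%:R <= th ^+ k * phi #|support C|.
Proof.
elim: m k C => [|m IHm] [|k] C deg_C;
  try by rewrite (deg_lt0_code_eq0 deg_C) dimv0 mulr0 mulr_ge0 ?exprn_ge0.
  by rewrite expr1; exact: dim_le_support_row0.
have [b supp_b] : exists b, (#|support (hyperplane_code b C)| <=
    #|support (hyperplane_code (~~ b) C)|)%N.
  by case: (leqP #|support (hyperplane_code false C)| #|support (hyperplane_code true C)|)
    => [|/ltnW]; [exists false | exists true].
have deg_b (c : codeword 'rV[bool]_m) : c \in hyperplane_code b C -> deg_lt k.+1 c.
  by case/memv_imgP => d /deg_C deg_d ->; rewrite lfunE; exact: deg_lt_row_cons.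
have deg_nb (c : codeword 'rV[bool]_m) :
    c \in hyperplane_code (~~ b) (vanishing_code b C) -> deg_lt k c.
  case/memv_imgP => d /vanishing_codeP[/deg_C deg_d d0] ->; rewrite lfunE.
  exact: deg_lt_vanishing.
have supp_nb : (#|support (hyperplane_code (~~ b) (vanishing_code b C))|
    <= #|support (hyperplane_code (~~ b) C)|)%N.
  by apply/subset_leq_card/supportS/limgS; exact: capvSl.
have dim_b := IHm _ _ deg_b.
have dim_nb := le_trans (IHm _ _ deg_nb)
  (ler_wpM2l (exprn_ge0 k th0) (superadditive_mono supp_nb)).
have phi_le := le_trans (phi_superadditive supp_b)
  (superadditive_mono (card_support_hyperplanes b C)).
apply: le_trans (ler_wpM2l (exprn_ge0 k.+1 th0) phi_le).
rewrite (dim_hyperplane_split b) natrD; have := lerD (ler_wpM2l th0 dim_b) (ler_wpM2l th0 dim_nb).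
by rewrite !exprS; lra.
Qed.

End SubcodeDimension.

(** * Ambiguity after erasures *)

Section Ambiguity.
Variable k : nat.

Section OneSpace.
Variable V : finZmodType.
Implicit Types (E : {set V}) (c d : codeword V).

Definition supported_in E : pred (codeword V) :=
  fun c => deg_lt k c && [forall x, c x ==> (x \in E)].
Definition subcode E : {vspace codeword V} := <<enum (supported_in E)>>%VS.
Definition ambiguity_dim E : nat := \dim (subcode E).
Definition lost_bits E : {set V} := support (subcode E).

Lemma subcodeP E c : reflect (deg_lt k c /\ forall x, c x -> x \in E) (c \in subcode E).
Proof.
have supportedP d : reflect (deg_lt k d /\ forall x, d x -> x \in E) (d \in enum (supported_in E)).
  rewrite mem_enum; apply: (iffP andP) => -[deg_d sub_d]; split => //.
    by move=> x; apply/implyP/(forallP sub_d).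
  by apply/forallP => x; apply/implyP/sub_d.
rewrite mem_span_closed; first exact: supportedP.
  apply/supportedP; split => [|x]; last by rewrite ffunE.
  by rewrite (eq_deg_lt _ (g := fun=> false)) ?deg_lt_false // => x; rewrite ffunE.
move=> a d e /supportedP[deg_d sub_d] /supportedP[deg_e sub_e]; apply/supportedP; split.
  rewrite (eq_deg_lt _ (g := fun x => (a && d x) (+) e x)); last by move=> x; rewrite !ffunE.
  by apply: deg_lt_addb => //; case: a; rewrite ?deg_lt_false.
move=> x; rewrite !ffunE => adex; have := sub_d x; have := sub_e x.
by move: adex; case: a; case: (d x); case: (e x) => // _; auto.
Qed.

Lemma lost_bitsP E x :
  reflect (exists c : codeword V, [/\ deg_lt k c, c x & forall y, c y -> y \in E])
    (x \in lost_bits E).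
Proof.
apply: (iffP (supportP _ _)) => [[c /subcodeP[deg_c sub_c] cx]|[c [deg_c cx sub_c]]].
  by exists c.
by exists c => //; apply/subcodeP.
Qed.

Lemma lost_bits_sub E : lost_bits E \subset E.
Proof. by apply/subsetP => x /lost_bitsP[c [_ cx /(_ x cx)]]. Qed.

Lemma lost_bitsS E E' : E \subset E' -> lost_bits E \subset lost_bits E'.
Proof.
move=> /subsetP EE'; apply/subsetP => x /lost_bitsP[c [deg_c cx sub_c]].
by apply/lost_bitsP; exists c; split => // y /sub_c/EE'.
Qed.

Lemma ambiguity_dim0 : ambiguity_dim set0 = 0%N.
Proof.
apply/eqP; rewrite dimv_eq0; apply/eqP/support_eq0/setP => x; rewrite in_set0.
by apply/negP => /(subsetP (lost_bits_sub _)); rewrite in_set0.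
Qed.

Lemma ambiguity_dimS E E' : E \subset E' -> (ambiguity_dim E <= ambiguity_dim E')%N.
Proof.
move=> /subsetP EE'; apply/dimvS/subvP => c /subcodeP[deg_c sub_c].
by apply/subcodeP; split => // x /sub_c/EE'.
Qed.

Lemma ambiguity_dimD1 E i : ambiguity_dim E = (ambiguity_dim (E :\ i) + (i \in lost_bits E))%N.
Proof.
rewrite /ambiguity_dim -(limg_ker_dim (linfun (eval_at i)) (subcode E)); congr (\dim _ + _)%N.
  apply/vspaceP => c; rewrite memv_cap memv_ker lfunE /=.
  apply/andP/subcodeP => [[/subcodeP[deg_c sub_c] /eqP ci]|[deg_c sub_c]].
    split => // x cx; rewrite !inE sub_c // andbT.
    by apply: contraTneq cx => ->; rewrite [c i]ci.
  split; first by apply/subcodeP; split => // x /sub_c/setD1P[].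
  by apply/eqP/negbTE/negP => /sub_c; rewrite !inE eqxx.
have dim_le1 : (\dim (linfun (eval_at i) @: subcode E) <= 1)%N.
  by rewrite (leq_trans (dimvS (subvf _))) // dimvf.
case: supportP => [[c cE ci]|i_nsupp].
  apply/eqP; rewrite eqn_leq dim_le1 lt0n dimv_eq0; apply: contraTneq ci => im0.
  have := memv_img (linfun (eval_at i)) cE.
  by rewrite im0 memv0 lfunE => /eqP c0; rewrite [c i]c0.
apply/eqP; rewrite dimv_eq0 -subv0; apply/subvP => _ /memv_imgP[c cE ->].
rewrite lfunE memv0; apply/eqP/negbTE/negP => ci.
by case: i_nsupp; exists c.
Qed.

Lemma lost_bits_shift i E : (i \in lost_bits (i |: E)) = origin_lost k [set x | x + i \in E].
Proof.
apply/lost_bitsP/origin_lostP => -[c [deg_c ci sub_c]].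
  exists (fun x => c (x + i)); split; [exact: deg_lt_shift | by rewrite add0r |].
  by move=> x /sub_c; rewrite !inE -[x + i == i]subr_eq0 addrK.
pose d : codeword V := [ffun x => c (x - i)]; exists d; split.
- rewrite (eq_deg_lt _ (g := fun x => c (x - i))); first exact: deg_lt_shift.
  by move=> x; rewrite ffunE.
- by rewrite ffunE subrr.
- by move=> x; rewrite ffunE => /sub_c; rewrite !inE subr_eq0 subrK.
Qed.

End OneSpace.

Lemma ambiguity_dim_preim (V W : finZmodType) (phi : V -> W) (E : {set W}) :
  {morph phi : x y / x + y} -> bijective phi ->
  ambiguity_dim (phi @^-1: E) = ambiguity_dim E.
Proof.
move=> phiD [psi phiK psiK].
have psiD : {morph psi : x y / x + y}.
  by move=> x y; apply: (can_inj phiK); rewrite phiD !psiK.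
have subcode_pullback : subcode (phi @^-1: E) = (linfun (pullback phi) @: subcode E)%VS.
  apply/vspaceP => c; apply/subcodeP/memv_imgP => [[deg_c sub_c]|[d /subcodeP[deg_d sub_d] ->]].
    exists (pullback psi c); last by rewrite lfunE; apply/ffunP => x; rewrite !ffunE phiK.
    apply/subcodeP; split; last by move=> x; rewrite ffunE => /sub_c; rewrite inE psiK.
    rewrite (eq_deg_lt _ (g := c \o psi)); first exact: deg_lt_comp.
    by move=> x; rewrite ffunE.
  rewrite lfunE; split; last by move=> x; rewrite ffunE inE => /sub_d.
  rewrite (eq_deg_lt _ (g := d \o phi)); first exact: deg_lt_comp.
  by move=> x; rewrite ffunE.
rewrite /ambiguity_dim subcode_pullback limg_dim_eq //.
apply/eqP; rewrite -subv0; apply/subvP => c; rewrite memv_cap memv_ker lfunE.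
move=> /andP[_ /eqP/ffunP c0]; rewrite memv0; apply/eqP/ffunP => x.
by have := c0 (psi x); rewrite !ffunE psiK.
Qed.

End Ambiguity.

Arguments ambiguity_dim k {V} E.

(** * Random erasures *)

Definition pivots (T : finType) (D : {set T} -> nat) (E : {set T}) : {set T} :=
  [set i | (D (E :\ i) < D E)%N].

Lemma pivots_ambiguity_dim k (V : finZmodType) (E : {set V}) :
  pivots (ambiguity_dim k) E = lost_bits k E.
Proof.
apply/setP => i; rewrite inE (ambiguity_dimD1 k E i).
by rewrite -[X in (X < _)%N]addn0 ltn_add2l lt0b.
Qed.

Section PureDeath.
Variables (R : realFieldType) (T : finType) (D : {set T} -> nat).
Hypothesis D_mono : forall E E' : {set T}, E \subset E' -> (D E <= D E')%N.
Implicit Types E : {set T}.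

Lemma expect_pivots_level (p : R) j : 0 <= p <= 1 -> (0 < j)%N ->
  expect p (fun E => #|pivots D E|%:R * (D E == j)%:R) <=
  \sum_i expect p (fun E => (j <= D (i |: E))%N%:R - (j <= D (E :\ i))%N%:R).
Proof.
move=> p01 j0; rewrite -expect_sum; apply: ler_expect => // E.
have diff_ge0 i : 0 <= (j <= D (i |: E))%N%:R - (j <= D (E :\ i))%N%:R :> R.
  rewrite subr_ge0 ler_nat; case: (leqP j (D (E :\ i))) => // jD.
  rewrite (leq_trans jD) // D_mono //.
  by apply: (subset_trans (subD1set _ _)); exact: subsetUr.
have [DE|_] := eqVneq (D E) j; last by rewrite mulr0 sumr_ge0.
rewrite mulr1 -sum1_card natr_sum big_mkcond /=; apply: ler_sum => i _.
case: ifP => //; rewrite inE => piv_i.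
have iE : i \in E by apply: contraLR piv_i => iE; rewrite setD1_notin // ltnn.
rewrite (setUidPr _) ?sub1set // DE leqnn.
by move: piv_i; rewrite DE ltnNge => /negPf ->; rewrite subr0.
Qed.

Lemma prob_survival_le_death_rate (p lam : R) (J : nat) : 0 <= p <= 1 -> 0 < lam ->
  (forall E, (0 < D E <= J)%N -> lam * (D E)%:R <= #|pivots D E|%:R) ->
  prob p (fun E => 0 < D E)%N - prob p (fun E => J < D E)%N <=
  \sum_(1 <= j < J.+1) (lam * j%:R)^-1 *
    \sum_i expect p (fun E => (j <= D (i |: E))%N%:R - (j <= D (E :\ i))%N%:R).
Proof.
move=> p01 lam0 lam_le; have inv_ge0 j : 0 <= (lam * j%:R)^-1.
  by rewrite invr_ge0 mulr_ge0 ?ler0n // ltW.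
apply: (@le_trans _ _ (\sum_(1 <= j < J.+1) (lam * j%:R)^-1 *
    expect p (fun E => #|pivots D E|%:R * (D E == j)%:R))); last first.
  rewrite big_nat [leRHS]big_nat; apply: ler_sum => j /andP[j0 _].
  by apply: ler_wpM2l => //; exact: expect_pivots_level.
under [leRHS]eq_bigr do rewrite -expectZ.
rewrite -expect_sum -expectB; apply: ler_expect => // E.
have term_ge0 (P : pred nat) : 0 <= \sum_(1 <= j < J.+1 | P j)
    (lam * j%:R)^-1 * (#|pivots D E|%:R * (D E == j)%:R).
  by apply: sumr_ge0 => j _; rewrite !mulr_ge0 ?ler0n.
have [DE|D0] := posnP (D E).
  by rewrite {1}DE ltn0 subrr; exact: (term_ge0 xpredT).
have [JD|DJ] := ltnP J (D E); first by rewrite subrr; exact: (term_ge0 xpredT).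
rewrite subr0 (bigD1_seq (D E)) ?mem_index_iota ?D0 ?DJ ?iota_uniq //= eqxx mulr1.
apply: ler_wpDr; first exact: term_ge0.
have lamD : 0 < lam * (D E)%:R by rewrite mulr_gt0 ?ltr0n.
by rewrite ler_pdivlMl // mulr1 lam_le // D0.
Qed.

End PureDeath.

Section ErasureExpectation.
Variables (R : realFieldType) (p : R) (m k : nat).
Implicit Types E : {set 'rV[bool]_m}.

Lemma prob_lost_bit i : prob p (fun E => i \in lost_bits k (i |: E)) = exit_prob m k p.
Proof.
pose shift (x : 'rV[bool]_m) := x + i.
have shift_bij : bijective shift by exists (fun x => x - i) => x; rewrite /shift ?addrK ?subrK.
rewrite /exit_prob /prob -(expect_preimset p (fun E => (origin_lost k E)%:R) shift_bij).
by apply: eq_expect => E; rewrite lost_bits_shift.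
Qed.

Lemma sum_cst_row (c : R) : \sum_(i : 'rV[bool]_m) c = 2 ^+ m * c.
Proof. by rewrite sumr_const card_mx card_bool mul1n -natrX mulr_natl. Qed.

Lemma sum_expect_ambiguity_diff :
  \sum_i expect p (fun E => (ambiguity_dim k (i |: E))%:R - (ambiguity_dim k (E :\ i))%:R) =
  2 ^+ m * exit_prob m k p :> R.
Proof.
rewrite -sum_cst_row; apply: eq_bigr => i _; rewrite -(prob_lost_bit i); apply: eq_expect => E.
have setE : (i |: E) :\ i = E :\ i by apply/setP => x; rewrite !inE; case: eqP.
have := ambiguity_dimD1 k (i |: E) i; rewrite setE => ->.
by rewrite natrD addrAC subrr add0r.
Qed.

Lemma expect_card_lost_bits : 0 <= p <= 1 ->
  expect p (fun E => #|lost_bits k E|%:R) <= 2 ^+ m * exit_prob m k p :> R.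
Proof.
move=> p01; rewrite -sum_cst_row.
under eq_expect => E do rewrite -sum1_card big_mkcond natr_sum.
rewrite expect_sum; apply: ler_sum => i _; rewrite -(prob_lost_bit i).
apply: ler_expect => // E; rewrite ler_nat; case: ifP => // iE.
by rewrite (subsetP (lost_bitsS _ (subsetUr _ _)) _ iE).
Qed.

End ErasureExpectation.

(** * The Russo-Margulis formula *)

Lemma is_derive_big_sum (I : Type) (r : seq I) (P : pred I) (F : I -> R -> R) (dF : I -> R)
    (x : R) :
  (forall i, P i -> is_derive (F i) x (dF i)) ->
  is_derive (fun y => \sum_(i <- r | P i) F i y) x (\sum_(i <- r | P i) dF i).
Proof.
move=> dFx; elim: r => [|i r IHr].
  rewrite big_nil; apply: (is_derive_ext (fun=> 0 : R)); last exact: is_derive_const.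
  by move=> y; rewrite big_nil.
rewrite big_cons; case: ifPn => Pi; last first.
  by apply: is_derive_ext IHr => y; rewrite big_cons (negPf Pi).
apply: (is_derive_ext (fun y => F i y + \sum_(j <- r | P j) F j y : R)).
  by move=> y; rewrite big_cons Pi.
by apply: is_derive_plus => //; exact: dFx.
Qed.

Lemma is_derive_big_prod (I : eqType) (r : seq I) (F : I -> R -> R) (dF : I -> R) (x : R) :
  uniq r -> (forall i, is_derive (F i) x (dF i)) ->
  is_derive (fun y => \prod_(i <- r) F i y) x
    (\sum_(i <- r) dF i * \prod_(j <- r | j != i) F j x).
Proof.
move=> + dFx; elim: r => [|i r IHr] /=.
  move=> _; rewrite big_nil; apply: (is_derive_ext (fun=> 1 : R)); last exact: is_derive_const.
  by move=> y; rewrite big_nil.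
move=> /andP[ir r_uniq]; apply: (is_derive_ext (fun y => F i y * \prod_(j <- r) F j y : R)).
  by move=> y; rewrite big_cons.
have -> : \sum_(a <- i :: r) dF a * \prod_(j <- i :: r | j != a) F j x =
    dF i * \prod_(j <- r) F j x + F i x * \sum_(a <- r) dF a * \prod_(j <- r | j != a) F j x.
  rewrite !big_cons eqxx /=; congr (_ * _ + _).
    rewrite [LHS]big_seq_cond [RHS]big_seq; apply: eq_bigl => j.
    by case: (boolP (j \in r)) => //= jr; apply: contraNneq ir => <-.
  rewrite mulr_sumr [LHS]big_seq [RHS]big_seq; apply: eq_bigr => a ar.
  by rewrite big_cons ifT; [ring | apply: contraNneq ir => ->].
by apply: is_derive_mult => //; [exact: IHr | move=> ? ?; exact: Rmult_comm].
Qed.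

Section Russo.
Variable T : finType.
Implicit Types (E : {set T}) (f : {set T} -> R).

Lemma is_derive_bernoulli_weight E (p : R) :
  is_derive (fun q : R => bernoulli_weight q E) p
    (\sum_i (if i \in E then 1 else -1) * bernoulli_weight_except p i E).
Proof.
apply: is_derive_big_prod => [|i]; first exact: index_enum_uniq.
case: ifP => _; first exact: is_derive_id.
rewrite -[X in is_derive _ _ X]add0r.
by apply: is_derive_minus; [exact: is_derive_const | exact: is_derive_id].
Qed.

Lemma is_derive_expect f (p : R) :
  is_derive (fun q : R => expect q f) p (\sum_i expect p (fun E => f (i |: E) - f (E :\ i))).
Proof.
have -> : \sum_i expect p (fun E => f (i |: E) - f (E :\ i)) =
    \sum_(E : {set T}) f E * \sum_i (if i \in E then 1 else -1) * bernoulli_weight_except p i E.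
  under [RHS]eq_bigr do rewrite mulr_sumr.
  rewrite [RHS]exchange_big; apply: eq_bigr => i _.
  rewrite (expect_bernoulli_mean _ i) [RHS](big_set_split _ i); apply: eq_bigr => E iE /=.
  rewrite /bernoulli_mean (negPf iE) setU11 bernoulli_weight_exceptU1.
  by rewrite setU1K // setUA setUid setD1_notin //; ring.
apply: is_derive_big_sum => E _; apply: (is_derive_ext (fun q : R => f E * bernoulli_weight q E)).
  by move=> q; rewrite mulrC.
by apply: is_derive_scal; exact: is_derive_bernoulli_weight.
Qed.
End Russo.

Lemma unit_interval_RleP (p : R) : (0 <= p <= 1)%coqR -> 0 <= p <= 1.
Proof. by case=> /RleP p0 /RleP p1; apply/andP. Qed.

Lemma expect_nondecreasing (T : finType) (f : {set T} -> R) (p q : R) :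
  (0 <= p)%coqR -> (p <= q)%coqR -> (q <= 1)%coqR ->
  (forall E E' : {set T}, E \subset E' -> f E <= f E') -> (expect p f <= expect q f)%coqR.
Proof.
move=> p0 pq q1 f_mono.
have := mean_value_ge (c := 0%coqR) pq (fun x _ => is_derive_expect f x).
rewrite Rmult_0_l => expect_incr; suff : (0 <= expect q f - expect p f)%coqR by Lra.lra.
apply: expect_incr => x x_pq; apply/RleP; apply: sumr_ge0 => i _; apply: expect_ge0.
  by apply: unit_interval_RleP; Lra.lra.
move=> E; rewrite subr_ge0; apply: f_mono.
by apply: (subset_trans (subD1set _ _)); exact: subsetUr.
Qed.

Lemma Rprob_bounds (T : finType) (A : pred {set T}) (p : R) :
  (0 <= p <= 1)%coqR -> (0 <= prob p A <= 1)%coqR.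
Proof.
by move=> /unit_interval_RleP/prob_bounds/(_ A)/andP[/RleP ? /RleP ?].
Qed.

Lemma prob_nondecreasing (T : finType) (A : pred {set T}) (p q : R) :
  (0 <= p)%coqR -> (p <= q)%coqR -> (q <= 1)%coqR ->
  (forall E E' : {set T}, E \subset E' -> A E -> A E') -> (prob p A <= prob q A)%coqR.
Proof.
move=> p0 pq q1 A_mono; apply: expect_nondecreasing => // E E' sE.
by rewrite ler_nat; case AE: (A E); rewrite ?(A_mono _ _ sE AE).
Qed.

(* Along decreasing [p] the value of [D] decreases from [j] at rate at least [lam * j]: the
   potential [\sum_j (lam * j)^-1 * prob p (j <= D)] bounds its expected extinction time. *)
Lemma pure_death_survival_le (T : finType) (D : {set T} -> nat) (J : nat) (lam p0 p1 : R) :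
  (forall E E' : {set T}, E \subset E' -> (D E <= D E')%N) ->
  (0 < lam)%coqR -> (0 <= p0)%coqR -> (p0 <= p1)%coqR -> (p1 <= 1)%coqR ->
  (forall E, (0 < D E <= J)%N -> (lam * INR (D E) <= INR #|pivots D E|)%coqR) ->
  ((prob p0 (fun E => 0 < D E)%N - prob p1 (fun E => J < D E)%N) * (p1 - p0)
    <= / lam * \sum_(1 <= j < J.+1) / INR j)%coqR.
Proof.
move=> D_mono lam0 p0_ge0 p01 p1_le1 lam_le.
pose coef (j : nat) : R := (lam * j%:R)^-1.
pose potential (p : R) : R := \sum_(1 <= j < J.+1) coef j * prob p (fun E => j <= D E)%N.
pose slope (p : R) : R := \sum_(1 <= j < J.+1) coef j *
  \sum_i expect p (fun E => (j <= D (i |: E))%N%:R - (j <= D (E :\ i))%N%:R).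
have dpot p : is_derive potential p (slope p).
  by apply: is_derive_big_sum => j _; apply: is_derive_scal; exact: is_derive_expect.
have coef_ge0 j : 0 <= coef j by rewrite invr_ge0 mulr_ge0 ?ler0n //; apply/RleP/Rlt_le.
have prob_ge j p : (0 <= p <= 1)%coqR -> 0 <= prob p (fun E => j <= D E)%N <= 1.
  by move=> p_in; apply: unit_interval_RleP; exact: Rprob_bounds.
have slope_ge p : (p0 < p < p1)%coqR ->
    (prob p0 (fun E => 0 < D E)%N - prob p1 (fun E => J < D E)%N <= slope p)%coqR.
  move=> p_in.
  have D_up j : forall E E' : {set T}, E \subset E' -> (j < D E)%N -> (j < D E')%N.
    by move=> E E' /D_mono D_le /leq_trans; apply.
  have := @prob_nondecreasing T (fun E => 0 < D E)%N p0 p p0_ge0 ltac:(Lra.lra)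
    ltac:(Lra.lra) (D_up 0%N).
  have := @prob_nondecreasing T (fun E => J < D E)%N p p1 ltac:(Lra.lra) ltac:(Lra.lra)
    p1_le1 (D_up J).
  suff : (prob p (fun E => 0 < D E)%N - prob p (fun E => J < D E)%N <= slope p)%coqR by Lra.lra.
  apply/RleP; apply: prob_survival_le_death_rate => //.
  - by apply: unit_interval_RleP; Lra.lra.
  - exact/RltP.
  - by move=> E /lam_le; rewrite !INRE => /RleP.
apply: Rle_trans (mean_value_ge p01 (fun p _ => dpot p) slope_ge) _.
have pot0 : (0 <= potential p0)%coqR.
  apply/RleP; apply: sumr_ge0 => j _; rewrite mulr_ge0 //.
  by case/andP: (@prob_ge j p0 ltac:(Lra.lra)).
suff pot1 : (potential p1 <= / lam * \sum_(1 <= j < J.+1) / INR j)%coqR by Lra.lra.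
apply/RleP; rewrite RmultE mulr_sumr; apply: ler_sum => j _.
rewrite INRE !RinvE -invfM; apply: ler_piMr => //.
by case/andP: (@prob_ge j p1 ltac:(Lra.lra)).
Qed.

Section RealExitProbability.
Variables (n k : nat).

Lemma Rexit_prob_bounds (p : R) : (0 <= p <= 1)%coqR -> (0 <= exit_prob n k p <= 1)%coqR.
Proof. exact: Rprob_bounds. Qed.

Lemma Rexit_prob_nondecreasing (p q : R) : (0 <= p)%coqR -> (p <= q)%coqR -> (q <= 1)%coqR ->
  (exit_prob n k p <= exit_prob n k q)%coqR.
Proof. by move=> p0 pq q1; apply: prob_nondecreasing => // E E'; exact: origin_lostS. Qed.

Variables (p : R) (a : nat).
Hypothesis p01 : (0 < p < 1)%coqR.

Let ring_p01 : 0 < p < 1.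
Proof. by case: p01 => /RltP p0 /RltP p1; apply/andP. Qed.

Lemma Rexit_prob_extend_le : (exit_prob (n + a) k p <= exit_prob n k p)%coqR.
Proof. by apply/RleP; exact: exit_prob_extend_le. Qed.

Lemma Rexit_prob_sqr :
  (exit_prob (n + a) k p <= exit_prob n k p ^ 2 + exit_prob n k p / 2 ^ a)%coqR.
Proof. by apply/RleP; rewrite RplusE RdivE !RpowE; exact: exit_prob_sqr. Qed.

Lemma Rexit_prob_boost l :
  (exit_prob (n + a) k p <= exit_prob n k p *
    (sqrt (exit_prob n k p) * hyper_const p ^ l + / INR l.+2 ^ a))%coqR.
Proof.
by apply/RleP; rewrite !(RmultE, RplusE, RinvE, RpowE, RsqrtE, INRE); exact: exit_prob_boost.
Qed.

Lemma Rhyper_const_ge1 : (1 <= hyper_const p)%coqR.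
Proof. by apply/RleP; exact: hyper_const_ge1. Qed.

End RealExitProbability.

Definition mean_ambiguity (n k : nat) (p : R) : R :=
  (expect p (fun E : {set 'rV[bool]_n} => (ambiguity_dim k E)%:R) / 2 ^ n)%coqR.

Lemma area_theorem n k (p : R) : is_derive (mean_ambiguity n k) p (exit_prob n k p).
Proof.
have pow_neq0 : (2 ^ n <> 0)%coqR by apply: pow_nonzero; Lra.lra.
have -> : exit_prob n k p = (/ 2 ^ n * (2 ^ n * exit_prob n k p))%coqR :> R.
  by rewrite -Rmult_assoc Rinv_l // Rmult_1_l.
apply: (is_derive_ext (fun q : R => (/ 2 ^ n *
    expect q (fun E : {set 'rV[bool]_n} => (ambiguity_dim k E)%:R))%coqR)).
  by move=> q; rewrite Rmult_comm.
apply: is_derive_scal; rewrite RmultE RpowE -sum_expect_ambiguity_diff; exact: is_derive_expect.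
Qed.

Lemma mean_ambiguity0 n k : mean_ambiguity n k (IZR 0) = IZR 0.
Proof. by rewrite /mean_ambiguity R0E expect0 ambiguity_dim0 RdivE mul0r. Qed.

Section ReedMullerErasures.
Variable n : nat.

Definition point_of_row (x : 'rV[bool]_n) : point n := [ffun i => x 0 i].

Lemma point_of_row_bij : bijective point_of_row.
Proof.
exists (fun x : point n => \row_i x i) => x; first by apply/rowP => i; rewrite mxE ffunE.
by apply/ffunP => i; rewrite ffunE mxE.
Qed.

Lemma point_of_rowD : {morph point_of_row : x y / x + y}.
Proof. by move=> x y; apply/ffunP => i; rewrite !ffunE mxE. Qed.

Lemma ambiguity_dim_setT v :
  ambiguity_dim v.+1 [set: 'rV[bool]_n] = (\sum_(0 <= k < v.+1) 'C(n, k))%N.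
Proof.
rewrite -(preimsetT point_of_row) (ambiguity_dim_preim _ _ point_of_rowD point_of_row_bij).
have : #|subcode v.+1 [set: point n]| = #|RM v n|.
  apply: eq_card => c; rewrite mem_RM; apply/subcodeP/idP => [[]//|deg_c].
  by split => // x _; rewrite in_setT.
by rewrite finfield.card_vspace card_RM card_bool => /eqP; rewrite eqn_exp2l // => /eqP.
Qed.

Lemma RM_rate_mean_ambiguity v : RM_rate v n = mean_ambiguity n v.+1 (IZR 1).
Proof. by rewrite /mean_ambiguity R1E expect1 ambiguity_dim_setT /RM_rate INRE. Qed.

Lemma ambiguousE v (w : word n) (E : {set point n}) : w \in RM v n ->
  ambiguous (RM v n) w E = (0 < ambiguity_dim v.+1 E)%N.
Proof.
rewrite mem_RM => deg_w; rewrite lt0n dimv_eq0.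
apply/exists_inP/idP => [[w']|sub_neq0].
  rewrite mem_RM => deg_w' /andP[w'w /forall_inP eq_w].
  pose c : codeword (point n) := [ffun x => w' x (+) w x].
  have c_sub : c \in subcode v.+1 E.
    apply/subcodeP; split.
      rewrite (eq_deg_lt _ (g := fun x : point n => w' x (+) w x)) ?deg_lt_addb // => x.
      by rewrite ffunE.
    move=> x; rewrite ffunE; apply: contraLR => xE.
    by rewrite (eqP (eq_w x _)) ?inE // addbb.
  apply: contra w'w => /eqP sub0; move: c_sub; rewrite sub0 memv0 => /eqP/ffunP c0.
  by apply/eqP/ffunP => x; have := c0 x; rewrite !ffunE => /addbP; case: (w' x); case: (w x).
have /subcodeP[deg_c sub_c] := memv_pick (subcode v.+1 E).
set c := vpick _ in deg_c sub_c; have c_neq0 : c != 0 by rewrite vpick0.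
exists [ffun x => w x (+) c x].
  rewrite mem_RM (eq_deg_lt _ (g := fun x : point n => w x (+) c x)) ?deg_lt_addb // => x.
  by rewrite ffunE.
apply/andP; split.
  apply: contra c_neq0 => /eqP/ffunP c0; apply/eqP/ffunP => x.
  by have := c0 x; rewrite !ffunE; case: (w x); case: (c x).
apply/forall_inP => x; rewrite inE ffunE => xE.
by case cx: (c x); [rewrite (sub_c _ cx) in xE | rewrite addbF].
Qed.

Lemma PB_RM v (p : R) :
  PB (RM v n) p = prob p (fun E : {set 'rV[bool]_n} => 0 < ambiguity_dim v.+1 E)%N.
Proof.
have prob_points : prob p (fun E : {set 'rV[bool]_n} => 0 < ambiguity_dim v.+1 E)%N =
    prob p (fun E : {set point n} => 0 < ambiguity_dim v.+1 E)%N.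
  rewrite /prob -(expect_preimset p _ point_of_row_bij); apply: eq_expect => E.
  by rewrite (ambiguity_dim_preim _ _ point_of_rowD point_of_row_bij).
rewrite prob_points /PB; set b := prob _ _.
rewrite (eq_bigr (fun=> / INR #|RM v n| * b)%coqR) => [|w w_RM]; last first.
  congr (_ * _)%coqR; apply: eq_bigr => E _; rewrite ambiguousE //.
  by rewrite bernoulli_weight_card !RealsE; case: ifP.
have card_neq0 : INR #|RM v n| <> 0%coqR.
  by apply: not_0_INR; rewrite card_RM; apply/eqP; rewrite expn_eq0.
transitivity ((/ INR #|RM v n| * b)%coqR *+ #|RM v n|); first exact: sumr_const.
by rewrite -mulr_natl -INRE -RmultE -Rmult_assoc Rinv_r // Rmult_1_l.
Qed.

Lemma prob_ambiguity_markov k J (u p : R) : (0 <= p <= 1)%coqR -> (0 < u)%coqR ->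
  (forall E : {set 'rV[bool]_n}, (J < ambiguity_dim k E)%N -> (u <= INR #|lost_bits k E|)%coqR) ->
  (prob p (fun E : {set 'rV[bool]_n} => J < ambiguity_dim k E)%N
    <= 2 ^ n * exit_prob n k p / u)%coqR.
Proof.
move=> /unit_interval_RleP p01 u0 u_le; apply/Rle_div_r => //; rewrite Rmult_comm.
apply/RleP; rewrite !RmultE RpowE; apply: le_trans (expect_card_lost_bits n k p01).
rewrite -expectZ; apply: ler_expect => // E; case: leqP => JE; rewrite ?mulr0 ?ler0n //.
by rewrite mulr1 -INRE; apply/RleP/u_le.
Qed.

Lemma Rambiguity_dim_le (k : nat) (phi : nat -> R) (th : R) (E : {set 'rV[bool]_n}) :
  (1 <= th)%coqR -> (forall u, (0 <= phi u)%coqR) -> (1 <= phi 1%N)%coqR ->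
  (forall u u', (u <= u')%N -> (th * phi u + phi u' <= phi (u + u')%N)%coqR) ->
  (th ^ n.+1 * INR (ambiguity_dim k E) <= th ^ k * phi #|lost_bits k E|)%coqR.
Proof.
move=> th1 phi0 phi1 phi_super; apply/RleP; rewrite !RmultE !RpowE INRE.
apply: dim_le_support; [exact/RleP | by move=> u; apply/RleP | exact/RleP | | ].
  by move=> u u' uu'; apply/RleP; exact: phi_super.
by move=> c /subcodeP[].
Qed.

End ReedMullerErasures.

End ErasureAnalysis.

Import all_algebra ErasureAnalysis.
Open Scope R_scope.

(** * From bits to blocks *)

Lemma INR_gt0 n : (0 < n)%N -> 0 < INR n.
Proof. by move=> /leP/lt_0_INR. Qed.

Lemma INR_leq n m : (n <= m)%N -> INR n <= INR m.
Proof. by move=> /leP/le_INR. Qed.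

Lemma ln2_bounds : 0 < ln 2 <= 1.
Proof.
have := ln_lt_2; split; first lra.
by rewrite -[X in _ <= X]ln_exp; apply: ln_le; have := exp_ineq1_le 1; lra.
Qed.

Lemma harmonic_le (J : nat) : (0 < J)%N ->
  (\sum_(1 <= j < J.+1) (/ INR j)%coqR)%R <= 1 + ln (INR J).
Proof.
elim: J => // -[|J] IHJ _; first by rewrite big_nat1 /= ln_1 Rinv_1 Rplus_0_r; lra.
rewrite big_nat_recr //= -/(INR J.+2).
apply: Rle_trans (Rplus_le_compat_r _ _ _ (IHJ isT)) _.
have j1 := INR_gt0 (ltn0Sn J); have j2 : INR J.+2 = INR J.+1 + 1 by rewrite S_INR.
suff : ln (INR J.+1 / INR J.+2) <= - / INR J.+2 by rewrite ln_div; lra.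
rewrite -[X in _ <= X]ln_exp; apply: ln_le; first by apply: Rdiv_lt_0_compat; lra.
apply: Rle_trans (exp_ineq1_le _); right; rewrite j2; field; lra.
Qed.

Section PowerSuperadditivity.
Variable s : R.
Hypothesis s_ge1 : 1 <= s.

(* [Rpower 0 s] is [1]. *)
Definition npower (u : nat) : R := if u is 0%N then 0 else Rpower (INR u) s.

Lemma Rpower_increment_le (a b : R) : 0 < a -> a <= b ->
  Rpower (2 * a) s - Rpower a s <= Rpower (b + a) s - Rpower b s.
Proof.
move=> a0 ab; pose f t := Rpower (t + a) s - Rpower t s.
pose df t := s * Rpower (t + a) (s - 1) - s * Rpower t (s - 1).
have RpowerB1 t : 0 < t -> Rpower t (s - 1) = Rpower t s / t.
  by move=> t0; rewrite /Rminus Rpower_plus Rpower_Ropp Rpower_1.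
suff : 0 * (b - a) <= f b - f a by rewrite /f (_ : a + a = 2 * a); lra.
apply: (mean_value_ge (df := df)) => // x x_ab.
  rewrite /f /df !RpowerB1; try lra.
  by rewrite /Rpower; auto_derive; [lra | field; lra].
have : Rpower x (s - 1) <= Rpower (x + a) (s - 1) by apply: Rle_Rpower_l; lra.
by rewrite /df; nra.
Qed.

Lemma npower_ge0 u : 0 <= npower u.
Proof. by case: u => [|u]; [rewrite /npower; lra | left; exact: exp_pos]. Qed.

Lemma npower_superadditive u u' : (u <= u')%N ->
  (Rpower 2 s - 1) * npower u + npower u' <= npower (u + u')%N.
Proof.
case: u => [|u]; first by rewrite add0n /=; lra.
case: u' => // u' uu'; rewrite addSn /npower -addSn plus_INR.
have u0 := INR_gt0 (ltn0Sn u); have := Rpower_increment_le u0 (INR_leq uu').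
by rewrite -Rpower_mult_distr ?(Rplus_comm (INR u.+1)); lra.
Qed.

Lemma ambiguity_dim_npower n k (E : {set 'rV[bool]_n}) :
  (Rpower 2 s - 1) ^ n.+1 * INR (ambiguity_dim k E) <=
  (Rpower 2 s - 1) ^ k * npower #|lost_bits k E|.
Proof.
apply: Rambiguity_dim_le; [|exact: npower_ge0| |exact: npower_superadditive].
  have : Rpower 2 1 <= Rpower 2 s by apply: Rle_Rpower; lra.
  by rewrite Rpower_1; lra.
by rewrite /npower /= /Rpower ln_1 Rmult_0_r exp_0; lra.
Qed.

End PowerSuperadditivity.

Lemma ln_two_exp_minus1_ge y : 0 <= y -> 2 * y - y ^ 2 <= ln (2 * exp y - 1).
Proof.
move=> y0; pose f t := ln (2 * exp t - 1) - 2 * t + t ^ 2.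
pose df t := 2 * exp t / (2 * exp t - 1) - 2 + 2 * t.
have exp_ge1 t : 0 <= t -> 1 <= exp t by move=> t0; rewrite -exp_0; exact: exp_le_mono.
suff : 0 * (y - 0) <= f y - f 0.
  by rewrite /f exp_0 (_ : 2 * 1 - 1 = 1) ?ln_1; lra.
apply: (mean_value_ge (df := df)) => // x x_0y; have ex := exp_ge1 x ltac:(lra).
  by rewrite /f /df; auto_derive; [lra | field; lra].
have exB1 : exp x - 1 <= x * exp x.
  have : (1 - x) * exp x <= exp (- x) * exp x.
    by apply: Rmult_le_compat_r; have := exp_ineq1_le (- x); lra.
  by rewrite -exp_plus Rplus_opp_l exp_0; lra.
rewrite /df; apply: (Rmult_le_reg_r (2 * exp x - 1)); first lra.
rewrite Rmult_0_l (_ : _ * _ = 2 * (x * (2 * exp x - 1) - (exp x - 1))); last by field; lra.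
by nra.
Qed.

(* The power bound with exponent [1 + y / ln 2], for which [2 ^ s] is [2 * exp y]. *)
Lemma ambiguity_dim_exp_le n v y (E : {set 'rV[bool]_n}) :
  0 < y <= 1 -> (v <= n)%N -> (0 < #|lost_bits v.+1 E|)%N ->
  exp ((INR n - INR v) * (2 * y - y ^ 2)) * INR (ambiguity_dim v.+1 E) <=
  INR #|lost_bits v.+1 E| * exp (y * (ln (INR #|lost_bits v.+1 E|) / ln 2)).
Proof.
move=> [y0 y1] vn lost0; have [l2 _] := ln2_bounds.
pose s := 1 + y / ln 2.
have s_ge1 : 1 <= s by rewrite /s; have := Rdiv_lt_0_compat _ _ y0 l2; lra.
have pow2s : Rpower 2 s = 2 * exp y.
  rewrite /Rpower /s (_ : (1 + y / ln 2) * ln 2 = ln 2 + y); last by field; lra.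
  by rewrite exp_plus exp_ln; lra.
have := ambiguity_dim_npower s_ge1 v.+1 E; rewrite pow2s; set th := 2 * exp y - 1.
case: #|_| lost0 => // u _; rewrite /npower; have u0 := INR_gt0 (ltn0Sn u).
have th1 : 1 < th by rewrite /th; have := exp_ineq1 y; lra.
have -> : th ^ n.+1 = th ^ v.+1 * th ^ (n - v)%N.
  by rewrite -pow_add; congr (_ ^ _); rewrite -[RHS]/(v.+1 + (n - v))%N addSn subnKC.
rewrite Rmult_assoc => /(Rmult_le_reg_l _ _ _ (pow_lt th v.+1 ltac:(lra))) dim_le.
have -> : INR u.+1 * exp (y * (ln (INR u.+1) / ln 2)) = Rpower (INR u.+1) s.
  by rewrite /s Rpower_plus Rpower_1 // /Rpower; congr (_ * exp _); field; lra.
apply: Rle_trans dim_le; apply: Rmult_le_compat_r; first exact: pos_INR.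
rewrite -[th ^ _]Rpower_pow; last lra.
rewrite /Rpower minus_INR; last exact/leP.
apply: exp_le_mono; apply: Rmult_le_compat_l; first by have := INR_leq vn; lra.
by apply: ln_two_exp_minus1_ge; lra.
Qed.

Section BlockError.
Variables (n v : nat) (c L : R).
Hypothesis n_gt0 : (0 < n)%N.
Hypothesis v_le : (v <= n)%N.
Hypothesis c_ge0 : 0 <= c.
Hypothesis L_range : 8 * c <= L <= sqrt (INR n).
Hypothesis L_gt0 : 0 < L.
Hypothesis v_near : INR v <= INR n / 2 + c * sqrt (INR n).

Let sqrt_n : 0 < sqrt (INR n) /\ sqrt (INR n) * sqrt (INR n) = INR n.
Proof. by apply: sqrt_gt0_sqr; exact: INR_gt0. Qed.

Lemma exponent_gain y : y * sqrt (INR n) = L -> 0 < y <= 1 ->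
  L ^ 2 / 4 + y * (INR n - L * sqrt (INR n)) <= (INR n - INR v) * (2 * y - y ^ 2).
Proof.
move=> yL [y0 y1]; have [_ ss] := sqrt_n.
move: v_near yL ss; move: (sqrt (INR n)) => x vx yL xx; rewrite -xx in vx *.
have gain : (x * x / 2 - c * x) * (2 * y - y ^ 2) <= (x * x - INR v) * (2 * y - y ^ 2).
  by apply: Rmult_le_compat_r; [nra | lra].
have gainE : (x * x / 2 - c * x) * (2 * y - y ^ 2) =
    y * (x * x) - (y * x) * (y * x) / 2 - 2 * c * (y * x) + c * (y * x) * y by field.
have lossE : y * (x * x - L * x) = y * (x * x) - L * (y * x) by ring.
rewrite lossE; rewrite gainE yL in gain.
have : 0 <= c * L * y by apply: Rmult_le_pos; [apply: Rmult_le_pos|]; lra.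
nra.
Qed.

Lemma ambiguity_dim_le_lost (E : {set 'rV[bool]_n}) :
  INR #|lost_bits v.+1 E| <= 2 ^ n * exp (- (L * sqrt (INR n) * ln 2)) ->
  exp (L ^ 2 / 4) * INR (ambiguity_dim v.+1 E) <= INR #|lost_bits v.+1 E|.
Proof.
move=> lost_le; have [l2 _] := ln2_bounds; have [s0 ss] := sqrt_n.
have [lost_eq0|lost_gt0] := posnP #|lost_bits v.+1 E|.
  suff -> : ambiguity_dim v.+1 E = 0%N by rewrite /= Rmult_0_r; exact: pos_INR.
  move/cards0_eq/support_eq0: lost_eq0 => sub0; apply/eqP.
  by rewrite /ambiguity_dim vector.dimv_eq0 sub0.
pose y := L / sqrt (INR n); have y0 : 0 < y by exact: Rdiv_lt_0_compat.
have yL : y * sqrt (INR n) = L by rewrite /y; field; lra.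
have y1 : y <= 1 by apply: (Rmult_le_reg_r (sqrt (INR n))); lra.
have := ambiguity_dim_exp_le (conj y0 y1) v_le lost_gt0.
set u := INR _ in lost_le *; have u0 : 0 < u by exact: INR_gt0.
have ln_u : ln u / ln 2 <= INR n - L * sqrt (INR n).
  apply/Rle_div_l => //; apply: Rle_trans (ln_le _ _ u0 lost_le) _.
  rewrite ln_mult ?ln_exp ?ln_pow; try lra; [exact: pow_lt 2 n ltac:(lra) | exact: exp_pos].
move=> dim_le; have gain := exponent_gain yL (conj y0 y1).
have exp_le : exp (y * (ln u / ln 2)) <= exp (y * (INR n - L * sqrt (INR n))).
  by apply: exp_le_mono; apply: Rmult_le_compat_l; lra.
set loss := y * (INR n - _) in gain exp_le; have e0 := exp_pos loss.
have {gain} gain : exp (L ^ 2 / 4) * exp loss <= exp ((INR n - INR v) * (2 * y - y ^ 2)).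
  by rewrite -exp_plus; exact: exp_le_mono.
have d0 := pos_INR (ambiguity_dim v.+1 E).
apply: (Rmult_le_reg_r _ _ _ e0).
apply: Rle_trans (Rmult_le_compat_l _ _ _ (Rlt_le _ _ u0) exp_le).
apply: Rle_trans dim_le; rewrite Rmult_assoc (Rmult_comm (INR _)) -Rmult_assoc.
exact: Rmult_le_compat_r.
Qed.

Let tail_size := 2 ^ n * exp (- (L * sqrt (INR n) * ln 2)).

Lemma harmonic_ambiguity_le (J : nat) : INR J <= 2 ^ n ->
  (\sum_(1 <= j < J.+1) (/ INR j)%coqR)%R <= INR n + 1.
Proof.
have [_ l2] := ln2_bounds; have n0 := pos_INR n.
have [->|J_gt0] := posnP J; first by rewrite big_nil -[0%R]/0%coqR; lra.
move=> J_le; apply: Rle_trans (harmonic_le J_gt0) _.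
have : ln (INR J) <= ln (2 ^ n) by apply: ln_le => //; exact: INR_gt0.
by rewrite ln_pow; nra.
Qed.

Lemma PB_RM_le p0 p1 : 0 <= p0 -> p0 < p1 -> p1 <= 1 ->
  PB (RM v n) p0 <= exp (L * sqrt (INR n) * ln 2) * exit_prob n v.+1 p1 +
    (INR n + 1) * exp (- (L ^ 2 / 4)) / (p1 - p0).
Proof.
move=> p0_ge0 p01 p1_le1; have [s0 _] := sqrt_n; have [l2 _] := ln2_bounds.
pose lam := exp (L ^ 2 / 4); have lam0 : 0 < lam by exact: exp_pos.
have lam1 : 1 <= lam by rewrite /lam -exp_0; apply: exp_le_mono; nra.
have pow2 : 0 < 2 ^ n by apply: pow_lt; lra.
have size0 : 0 < tail_size by apply: Rmult_lt_0_compat => //; exact: exp_pos.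
have size_le : tail_size <= 2 ^ n.
  rewrite -[X in _ <= X]Rmult_1_r; apply: Rmult_le_compat_l; first lra.
  rewrite -exp_0; apply: exp_le_mono.
  by have := Rmult_lt_0_compat _ _ (Rmult_lt_0_compat _ _ L_gt0 s0) l2; lra.
have [J [J_le lt_J]] := nfloor_ex (tail_size / lam) (Rlt_le _ _ (Rdiv_lt_0_compat _ _ size0 lam0)).
move: J_le lt_J => /(Rle_div_r _ _ _ lam0) J_le /(Rlt_div_l _ _ _ lam0) lt_J.
have death_rate (E : {set 'rV[bool]_n}) : (0 < ambiguity_dim v.+1 E <= J)%N ->
    lam * INR (ambiguity_dim v.+1 E) <= INR #|pivots (ambiguity_dim v.+1) E|.
  rewrite pivots_ambiguity_dim => /andP[_ /INR_leq dJ].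
  have [|lost_gt] := Rle_lt_dec (INR #|lost_bits v.+1 E|) tail_size; last nra.
  exact: ambiguity_dim_le_lost.
have big_support (E : {set 'rV[bool]_n}) : (J < ambiguity_dim v.+1 E)%N ->
    tail_size <= INR #|lost_bits v.+1 E|.
  move=> /INR_leq; rewrite S_INR => Jd.
  have [//|lost_lt] := Rle_lt_dec tail_size (INR #|lost_bits v.+1 E|).
  by have := ambiguity_dim_le_lost (Rlt_le _ _ lost_lt); rewrite -/lam; nra.
have death := pure_death_survival_le (@ambiguity_dimS _ _) lam0 p0_ge0 (Rlt_le _ _ p01) p1_le1
  death_rate.
have markov := @prob_ambiguity_markov n v.+1 J tail_size p1 ltac:(lra) size0 big_support.
have J_pow : INR J <= 2 ^ n by have := pos_INR J; nra.
have harmonic := harmonic_ambiguity_le J_pow.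
rewrite PB_RM exp_Ropp -/lam.
have -> : exp (L * sqrt (INR n) * ln 2) * exit_prob n v.+1 p1 =
    2 ^ n * exit_prob n v.+1 p1 / tail_size.
  rewrite /tail_size exp_Ropp; field.
  by split; [exact: Rgt_not_eq (exp_pos _) | lra].
suff : prob p0 (fun E : {set 'rV[bool]_n} => 0 < ambiguity_dim v.+1 E)%N -
    prob p1 (fun E : {set 'rV[bool]_n} => J < ambiguity_dim v.+1 E)%N <=
    (INR n + 1) * / lam / (p1 - p0) by lra.
apply/Rle_div_r; first lra; apply: Rle_trans death _; rewrite Rmult_comm.
by apply: Rmult_le_compat_r; [left; exact: Rinv_0_lt_compat | ].
Qed.

End BlockError.

(** * Amplification of the erasure probability of a bit *)

Definition nat_ceil (x : R) : nat := Z.to_nat (up x).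

Lemma nat_ceil_bounds x : 0 <= x -> x <= INR (nat_ceil x) <= x + 1.
Proof.
move=> x0; have [x_lt x_ge] := archimed x.
by rewrite INR_IZR_INZ Z2Nat.id; [lra | apply: le_IZR; lra].
Qed.

Lemma exp_opp_le_inv x : 0 < x -> exp (- x) <= / x.
Proof.
move=> x0; rewrite exp_Ropp; apply: Rinv_le_contravar => //.
by have := exp_ineq1_le x; lra.
Qed.

Lemma ln_INR_gt_half l : / 2 < ln (INR l.+2).
Proof.
apply: Rlt_le_trans ln_lt_2 _; apply: ln_le; first lra.
by have := @INR_leq 2 l.+2 isT; rewrite /=; lra.
Qed.

Lemma geometric_reach (e X : R) : 0 < e -> 0 <= X ->
  exists i : nat, [/\ X <= (5 / 4) ^ i * e, (5 / 4) ^ i * e <= 5 / 4 * X + e & INR i * e <= 5 * X].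
Proof.
move=> e0 X0.
have reach : exists i, Rleb X ((5 / 4) ^ i * e).
  have [N pow_large] := Pow_x_infinity (5 / 4) ltac:(rewrite Rabs_pos_eq; lra) (X / e).
  exists N; apply/RlebP/Rle_div_l => //; apply: Rge_le.
  by have := pow_large N (Nat.le_refl N); rewrite Rabs_pos_eq //; apply: pow_le; lra.
have [i /RlebP X_le i_min] := ex_minnP reach; exists i.
case: i X_le i_min => [|i] X_le i_min; first by split; rewrite /= ?Rmult_0_l; lra.
have lt_X : (5 / 4) ^ i * e < X.
  by apply: Rnot_le_lt => /RlebP/i_min; rewrite ltnn.
have bernoulli : 1 + INR i.+1 / 4 <= (5 / 4) ^ i.+1.
  by have := Rfunctions.poly i.+1 (/ 4) ltac:(lra); rewrite (_ : 1 + / 4 = 5 / 4); lra.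
have := Rmult_le_compat_r e _ _ (Rlt_le _ _ e0) bernoulli.
by move: X_le lt_X; rewrite -tech_pow_Rmult; split; lra.
Qed.

Section Amplification.
Variables (p : R) (k : nat).
Hypothesis p01 : 0 < p < 1.

Let lnK_ge0 : 0 <= ln (hyper_const p).
Proof. by rewrite -ln_1; apply: ln_le; have := Rhyper_const_ge1 p; lra. Qed.

Lemma exit_prob_boost_step n a l e : exit_prob n k p <= exp (- e) ->
  INR l * ln (hyper_const p) + 1 <= e / 4 -> e / 4 + 1 <= INR a * ln (INR l.+2) ->
  exit_prob (n + a) k p <= exp (- (5 / 4 * e)).
Proof.
move=> exit_n le_l le_a; have [H0 _] := @Rexit_prob_bounds n k p ltac:(lra).
have K1 := Rhyper_const_ge1 p.
have low_le : sqrt (exit_prob n k p) * hyper_const p ^ l <= exp (- (e / 4) - 1).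
  apply: (Rle_trans _ (exp (- (e / 2)) * exp (INR l * ln (hyper_const p)))); last first.
    by rewrite -exp_plus; apply: exp_le_mono; lra.
  apply: Rmult_le_compat; [exact: sqrt_pos | by apply: pow_le; lra | |].
    rewrite -(sqrt_square (exp (- (e / 2)))); last by left; exact: exp_pos.
    by apply: sqrt_le_1_alt; rewrite -exp_plus (_ : _ + _ = - e); [exact: exit_n | field].
  by rewrite -Rpower_pow /Rpower; lra.
have high_le : / INR l.+2 ^ a <= exp (- (e / 4) - 1).
  rewrite -Rpower_pow; last exact: INR_gt0.
  by rewrite /Rpower -exp_Ropp; apply: exp_le_mono; lra.
have exp_m1 : exp (- (1)) <= / 2.
  rewrite exp_Ropp; apply: Rinv_le_contravar; first lra.
  by have := exp_ineq1_le 1; lra.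
apply: Rle_trans (Rexit_prob_boost n k a p01 l) _.
rewrite (_ : - (5 / 4 * e) = - e + - (e / 4)); last field.
rewrite exp_plus; apply: Rmult_le_compat => //.
  apply: Rplus_le_le_0_compat; first by apply: Rmult_le_pos; [exact: sqrt_pos | apply: pow_le; lra].
  by left; apply: Rinv_0_lt_compat; apply: pow_lt; exact: INR_gt0.
move: low_le high_le; rewrite /Rminus exp_plus; have := exp_pos (- (e / 4)).
by nra.
Qed.

Lemma exit_prob_boost_iter n l e i : exit_prob n k p <= exp (- e) ->
  INR l * ln (hyper_const p) + 1 <= e / 4 ->
  exists B : nat, INR B <= (5 / 4) ^ i * e / ln (INR l.+2) + 3 * INR i /\
    exit_prob (n + B) k p <= exp (- ((5 / 4) ^ i * e)).
Proof.
move=> exit_n le_l; have b0 := ln_INR_gt_half l; set b := ln (INR l.+2) in b0 *.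
have lK : 0 <= INR l * ln (hyper_const p) by apply: Rmult_le_pos => //; exact: pos_INR.
have ib : 0 < / b < 2.
  split; first by apply: Rinv_0_lt_compat; lra.
  by rewrite -(Rinv_inv 2); apply: Rinv_lt_contravar; nra.
elim: i => [|i [B [B_le exit_B]]].
  exists 0%N; rewrite addn0 /= !Rmult_1_l; split => //.
  by rewrite /Rdiv; nra.
set f := (5 / 4) ^ i * e in B_le exit_B.
have e_le : e <= f.
  rewrite -{1}(Rmult_1_l e); apply: Rmult_le_compat_r; first lra.
  by apply: pow_R1_Rle; lra.
have [a_ge a_le] := @nat_ceil_bounds ((f / 4 + 1) / b) ltac:(apply: Rmult_le_pos; lra).
exists (B + nat_ceil ((f / 4 + 1) / b))%N; split.
  rewrite plus_INR S_INR.
  have -> : (5 / 4) ^ i.+1 * e / b = f / b + f / 4 / b by rewrite /f /=; field; lra.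
  have : (f / 4 + 1) / b = f / 4 / b + / b by field; lra.
  lra.
rewrite addnA (_ : (5 / 4) ^ i.+1 * e = 5 / 4 * f); last by rewrite /f /=; ring.
apply: (exit_prob_boost_step (l := l)) => //; first lra.
by rewrite -/b; apply/Rle_div_l; lra.
Qed.

Lemma exit_prob_boost_reach n l e X : exit_prob n k p <= exp (- e) ->
  INR l * ln (hyper_const p) + 1 <= e / 4 -> 0 <= X ->
  exists2 B : nat, INR B <= (5 / 4 * X + e) / ln (INR l.+2) + 15 * X / e &
    exit_prob (n + B) k p <= exp (- X).
Proof.
move=> exit_n le_l X0; have b0 := ln_INR_gt_half l.
have lK : 0 <= INR l * ln (hyper_const p) by apply: Rmult_le_pos => //; exact: pos_INR.
have e0 : 0 < e by lra.
have [i [X_le f_le i_le]] := geometric_reach e0 X0.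
have [B [B_le exit_B]] := exit_prob_boost_iter i exit_n le_l.
exists B; last by apply: Rle_trans exit_B _; apply: exp_le_mono; lra.
apply: Rle_trans B_le _; apply: Rplus_le_compat.
  by apply: Rmult_le_compat_r => //; left; apply: Rinv_0_lt_compat; lra.
by apply: (proj1 (Rle_div_r _ _ _ e0)); lra.
Qed.

Definition two_phase_cost (z X : R) : R :=
  7 * z + 8 + (5 / 4 * X + z) / (ln z / 2) + 15 * X / z.

(* Phase one reaches exponent [z = m^(1/4)] with [l = 0], phase two reaches [X] with [l] about
   [m^(1/8)], so that [ln l] is of order [ln m]. *)
Lemma exit_prob_two_phases n (z X : R) : exit_prob n k p <= exp (- (4)) ->
  4 * (ln (hyper_const p) + 1) <= sqrt z -> 1 < z -> 0 <= X ->
  exists2 B : nat, INR B <= two_phase_cost z X &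
    exit_prob (n + B) k p <= exp (- X).
Proof.
move=> exit_n z_large z1 X0; have s0 := sqrt_pos z.
have ss : sqrt z * sqrt z = z by apply: sqrt_sqrt; lra.
have [B1 B1_le exit_B1] :=
  @exit_prob_boost_reach n 0 4 z exit_n ltac:(rewrite /=; lra) ltac:(lra).
have [l [l_le lt_l]] := nfloor_ex (sqrt z) s0.
have lK_le : INR l * ln (hyper_const p) + 1 <= z / 4.
  have : INR l * ln (hyper_const p) <= sqrt z * ln (hyper_const p) by exact: Rmult_le_compat_r.
  by rewrite -{2}ss; nra.
have [B2 B2_le exit_B2] := exit_prob_boost_reach exit_B1 lK_le X0.
exists (B1 + B2)%N; last by rewrite addnA.
have ln_sqrt_z : ln z / 2 <= ln (INR l.+2).
  rewrite -{1}ss ln_mult; try nra.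
  rewrite (_ : _ / 2 = ln (sqrt z)); last field.
  by apply: ln_le; rewrite ?S_INR; nra.
have lnz0 : 0 < ln z by rewrite -ln_1; apply: ln_increasing; lra.
have B1_le' : INR B1 <= 7 * z + 8.
  apply: Rle_trans B1_le _; have l2 := ln_INR_gt_half 0.
  have : (5 / 4 * z + 4) / ln (INR 2) <= (5 / 4 * z + 4) * 2.
    by apply/Rle_div_l; [lra | nra].
  lra.
have B2_le' : (5 / 4 * X + z) / ln (INR l.+2) <= (5 / 4 * X + z) / (ln z / 2).
  apply: Rmult_le_compat_l; first lra.
  by apply: Rinv_le_contravar; lra.
by rewrite plus_INR /two_phase_cost; lra.
Qed.

End Amplification.

Lemma two_phase_cost_ge0 z X : 1 < z -> 0 <= X -> 0 <= two_phase_cost z X.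
Proof.
move=> z1 X0; have lnz : 0 < ln z by rewrite -ln_1; apply: ln_increasing; lra.
rewrite /two_phase_cost; repeat apply: Rplus_le_le_0_compat; try lra;
  by apply: Rmult_le_pos; [lra | left; apply: Rinv_0_lt_compat; lra].
Qed.

Lemma two_phase_cost_lim (z X : nat -> R) : is_lim_seq z p_infty ->
  is_lim_seq (fun m => X m / (z m ^ 2 * ln (z m))) 0 ->
  is_lim_seq (fun m => (two_phase_cost (z m) (X m) + 1) / z m ^ 2) 0.
Proof.
move=> z_oo; set w := fun m => _ / _ => w_lim.
have ln_oo : is_lim_seq (fun m => ln (z m)) p_infty.
  exact: is_lim_seq_comp_infty is_lim_ln_p z_oo.
have inv_z_lim : is_lim_seq (fun m => 1 / z m) 0.
  by apply: (@is_lim_seq_div_infty _ _ 1) => //; exact: is_lim_seq_const.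
have inv_ln_lim : is_lim_seq (fun m => 1 / ln (z m)) 0.
  by apply: (@is_lim_seq_div_infty _ _ 1) => //; exact: is_lim_seq_const.
have ln_div_lim : is_lim_seq (fun m => ln (z m) / z m) 0.
  exact: is_lim_seq_comp_infty is_lim_div_ln_p z_oo.
apply: (is_lim_seq_ext_loc (fun m => 7 * (1 / z m) + 9 * ((1 / z m) * (1 / z m))
    + 5 / 2 * w m + 2 * ((1 / z m) * (1 / ln (z m))) + 15 * (w m * (ln (z m) / z m)))).
  apply: filter_imp (is_lim_seq_gt 1 z_oo) => m z1.
  have lnz : 0 < ln (z m) by rewrite -ln_1; apply: ln_increasing; lra.
  by rewrite /w /two_phase_cost; field; lra.
rewrite (_ : Rbar.Finite 0 = 7 * 0 + 9 * (0 * 0) + 5 / 2 * 0 + 2 * (0 * 0) + 15 * (0 * 0)).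
  by repeat first [apply: is_lim_seq_plus' | apply: is_lim_seq_mult'
    | exact: is_lim_seq_const | done].
by congr Rbar.Finite; ring.
Qed.

Lemma exit_prob_amplify (p : R) (X : nat -> R) : 0 < p < 1 -> (forall m, 0 <= X m) ->
  is_lim_seq (fun m => X m / (sqrt (INR m) * ln (INR m))) 0 ->
  exists2 t : nat -> nat, is_lim_seq (fun m => INR (t m) / sqrt (INR m)) 0 &
    eventually (fun m => forall n k, exit_prob n k p <= exp (- (4)) ->
      exit_prob (n + t m) k p <= exp (- X m)).
Proof.
move=> p01 X0 X_lim; pose z m := sqrt (sqrt (INR m)); pose T m := two_phase_cost (z m) (X m).
have z_oo : is_lim_seq z p_infty by do 2!apply: is_lim_seq_sqrt; exact: is_lim_seq_INR.
have z_large := is_lim_seq_gt 1 z_oo.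
have z_sqr m : z m ^ 2 = sqrt (INR m) by rewrite /= Rmult_1_r sqrt_sqrt //; exact: sqrt_pos.
exists (fun m => nat_ceil (T m)).
  apply: (is_lim_seq_le_le_loc (fun=> 0) _ (fun m => (T m + 1) / z m ^ 2)).
  - apply: filter_imp z_large => m z1; rewrite -z_sqr.
    have [_ ceil_le] : T m <= INR (nat_ceil (T m)) <= T m + 1.
      by apply: nat_ceil_bounds; exact: two_phase_cost_ge0.
    have inv0 : 0 < / z m ^ 2 by apply/Rinv_0_lt_compat/pow_lt; lra.
    by split; [apply: Rmult_le_pos; [exact: pos_INR | lra] | apply: Rmult_le_compat_r; lra].
  - exact: is_lim_seq_const.
  - apply: two_phase_cost_lim z_oo _.
    apply: (is_lim_seq_ext_loc (fun m => 4 * (X m / (sqrt (INR m) * ln (INR m))))).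
      apply: filter_imp z_large => m z1.
      have -> : ln (INR m) = 4 * ln (z m).
        rewrite -(sqrt_sqrt (INR m)) -?z_sqr; last exact: pos_INR.
        by rewrite -pow_add ln_pow /=; lra.
      rewrite -z_sqr; field; split; last lra.
      by apply/Rgt_not_eq; rewrite -ln_1; apply: ln_increasing; lra.
    rewrite -[0](Rmult_0_r 4); apply: is_lim_seq_mult' => //; exact: is_lim_seq_const.
have sqrt_z_large := is_lim_seq_gt (4 * (ln (hyper_const p) + 1)) (is_lim_seq_sqrt z_oo).
apply: filter_imp (filter_and _ _ z_large sqrt_z_large) => m [z1 K_le] n k exit_le.
have [B B_le exit_B] := exit_prob_two_phases p01 exit_le (Rlt_le _ _ K_le) z1 (X0 m).
have B_ceil : (B <= nat_ceil (T m))%N.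
  apply/leP/INR_le; apply: Rle_trans B_le _.
  by case: (nat_ceil_bounds (two_phase_cost_ge0 z1 (X0 m))).
have := Rexit_prob_extend_le (n + B) k (nat_ceil (T m) - B) p01.
by rewrite -addnA subnKC // => /Rle_trans; apply.
Qed.

(** * Capacity *)

Lemma RM_rate_cvg_near (v n : nat -> nat) (x : R) :
  is_lim_seq (fun m => (2 * INR (v m) - INR m) / sqrt (INR m)) x ->
  is_lim_seq (fun m => (INR (n m) - INR m) / sqrt (INR m)) 0 ->
  is_lim_seq (fun m => RM_rate (v m) (n m)) (normal_cdf x).
Proof.
move=> v_lim n_lim; have sqrt_oo := is_lim_seq_sqrt is_lim_seq_INR.
pose d m := (INR (n m) - INR m) / sqrt (INR m).
have sqrt_pos_ev : eventually (fun m => 0 < sqrt (INR m)) by exact: is_lim_seq_gt.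
have ratio_lim : is_lim_seq (fun m => 1 + d m / sqrt (INR m)) 1.
  rewrite (_ : Rbar.Finite 1 = 1 + 0); last by congr Rbar.Finite; ring.
  apply: is_lim_seq_plus'; first exact: is_lim_seq_const.
  exact: (@is_lim_seq_div_infty _ _ 0).
have ratio_pos : eventually (fun m => 1 + d m / sqrt (INR m) > 0).
  have /is_lim_seq_spec/(_ (mkposreal _ Rlt_0_1)) := ratio_lim.
  by apply: filter_imp => m /Rabs_lt_between /=; lra.
have nE m : 0 < sqrt (INR m) -> INR (n m) = INR m * (1 + d m / sqrt (INR m)).
  move=> s0; have ss := sqrt_sqrt _ (pos_INR m).
  have -> : INR (n m) = INR m + d m * sqrt (INR m) by rewrite /d; field; lra.
  by rewrite -{1 3}ss; field; lra.
apply: RM_rate_cvg_normal.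
  apply: (is_lim_seq_ext_loc (fun m => INR m * (1 + d m / sqrt (INR m)))).
    by apply: filter_imp sqrt_pos_ev => m /nE ->.
  apply: is_lim_seq_mult is_lim_seq_INR ratio_lim _.
  exact: (is_Rbar_mult_p_infty_pos 1 Rlt_0_1).
apply: (is_lim_seq_ext_loc (fun m =>
    ((2 * INR (v m) - INR m) / sqrt (INR m) - d m) / sqrt (1 + d m / sqrt (INR m)))).
  apply: filter_imp (filter_and _ _ sqrt_pos_ev ratio_pos) => m [s0 r0].
  have r1 : 0 < sqrt (1 + d m / sqrt (INR m)) by exact: sqrt_lt_R0.
  have sqrt_nE : sqrt (INR (n m)) = sqrt (INR m) * sqrt (1 + d m / sqrt (INR m)).
    by rewrite (nE m s0) sqrt_mult_alt //; exact: pos_INR.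
  by rewrite sqrt_nE; move: (sqrt (1 + _)) r1 => r r1; rewrite /d; field; lra.
rewrite (_ : Rbar.Finite x = (x - 0) / sqrt 1); last by rewrite sqrt_1; congr Rbar.Finite; field.
apply: is_lim_seq_div'; [exact: is_lim_seq_minus' | | by rewrite sqrt_1; lra].
by apply: is_lim_seq_continuous ratio_lim; apply: continuity_pt_sqrt; lra.
Qed.

Lemma exit_prob_le_rate n v p : 0 <= p <= 1 -> exit_prob n v.+1 p * (1 - p) <= RM_rate v n.
Proof.
move=> p01; have area q := area_theorem n v.+1 q.
have above : exit_prob n v.+1 p * (1 - p) <= mean_ambiguity n v.+1 1 - mean_ambiguity n v.+1 p.
  apply: (mean_value_ge (df := exit_prob n v.+1)) => [|x _|x x_in]; [lra | exact: area |].
  by apply: Rexit_prob_nondecreasing; lra.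
have below : 0 * (p - 0) <= mean_ambiguity n v.+1 p - mean_ambiguity n v.+1 0.
  apply: (mean_value_ge (df := exit_prob n v.+1)) => [|x _|x x_in]; [lra | exact: area |].
  by have := @Rexit_prob_bounds n v.+1 x; lra.
by move: above below; rewrite mean_ambiguity0 RM_rate_mean_ambiguity; lra.
Qed.

(* By the area theorem the gap between the rates of the two codes is the integral of
   [H_n - H_(n+a)], which is at least about the integral of [H_n (1 - H_n)]. *)
Lemma exit_prob_rate_gap n a v (p1 p2 eta eta' : R) :
  0 < p1 < p2 -> p2 < 1 -> 0 <= eta <= exit_prob n v.+1 p1 ->
  0 <= eta' <= 1 - exit_prob n v.+1 p2 ->
  (eta * eta' - / 2 ^ a) * (p2 - p1) <= RM_rate v n - RM_rate v (n + a).
Proof.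
set k := v.+1 => p12 p2_lt1 [eta0 eta_le] [eta'0 eta'_le].
pose gap p := mean_ambiguity n k p - mean_ambiguity (n + a) k p.
have dgap p : is_derive gap p (exit_prob n k p - exit_prob (n + a) k p).
  exact: is_derive_minus (area_theorem n k p) (area_theorem (n + a) k p).
have gap0 : gap 0 = 0 by rewrite /gap !mean_ambiguity0; ring.
have gap1 : gap 1 = RM_rate v n - RM_rate v (n + a) by rewrite !RM_rate_mean_ambiguity.
have gap_incr s t : 0 <= s -> s <= t -> t <= 1 -> gap s <= gap t.
  move=> s0 st t1; suff : 0 * (t - s) <= gap t - gap s by lra.
  apply: (mean_value_ge st (fun x _ => dgap x)) => x x_in.
  by have := @Rexit_prob_extend_le n k x a ltac:(lra); lra.
have middle : (eta * eta' - / 2 ^ a) * (p2 - p1) <= gap p2 - gap p1.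
  apply: (mean_value_ge _ (fun x _ => dgap x)) => [|x x_in]; first lra.
  have := @Rexit_prob_sqr n k x a ltac:(lra).
  have := @Rexit_prob_nondecreasing n k p1 x ltac:(lra) ltac:(lra) ltac:(lra).
  have := @Rexit_prob_nondecreasing n k x p2 ltac:(lra) ltac:(lra) ltac:(lra).
  have := @Rexit_prob_bounds n k x ltac:(lra).
  have : 0 < / 2 ^ a by apply: Rinv_0_lt_compat; apply: pow_lt; lra.
  rewrite /Rdiv; set H := exit_prob n k x; move: (/ 2 ^ a) => i i0 [H0 H1] H_le le_H sqr_le.
  have : eta * eta' <= H * (1 - H) by apply: Rmult_le_compat; lra.
  nra.
have := gap_incr 0 p1; have := gap_incr p2 1; lra.
Qed.

Section RateAtTheThreshold.
Variables (v : nat -> nat) (x : R).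
Hypothesis v_lim : is_lim_seq (fun m => (2 * INR (v m) - INR m) / sqrt (INR m)) x.

Lemma RM_rate_cvg_shortened (t : nat -> nat) (a : nat) :
  is_lim_seq (fun m => INR (t m) / sqrt (INR m)) 0 -> eventually (fun m => t m <= m)%N ->
  is_lim_seq (fun m => RM_rate (v m) (m - t m + a)) (normal_cdf x).
Proof.
move=> t_lim t_le; apply: RM_rate_cvg_near v_lim _.
apply: (is_lim_seq_ext_loc (fun m => INR a / sqrt (INR m) - INR (t m) / sqrt (INR m))).
  apply: filter_imp t_le => m tm; rewrite /Rdiv -Rmult_minus_distr_r plus_INR; congr (_ * _).
  have : INR m = INR (m - t m) + INR (t m) by rewrite -plus_INR -[in LHS](subnK tm).
  lra.
rewrite (_ : Rbar.Finite 0 = 0 - 0); last by congr Rbar.Finite; ring.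
apply: is_lim_seq_minus' t_lim; apply: (@is_lim_seq_div_infty _ _ (INR a)).
  exact: is_lim_seq_const.
exact: is_lim_seq_sqrt is_lim_seq_INR.
Qed.

Lemma small_shortening (t : nat -> nat) :
  is_lim_seq (fun m => INR (t m) / sqrt (INR m)) 0 -> eventually (fun m => t m <= m)%N.
Proof.
move=> t_lim; have t_lt := is_lim_seq_lt t_lim Rlt_0_1.
have s1 := is_lim_seq_gt 1 (is_lim_seq_sqrt is_lim_seq_INR).
apply: filter_imp (filter_and _ _ t_lt s1) => m [].
move=> tm s_gt1; have ss := sqrt_sqrt _ (pos_INR m); apply/leP/INR_le.
by move/Rlt_div_l: tm => /(_ ltac:(lra)); nra.
Qed.

Lemma exit_prob_small (t : nat -> nat) (p eta : R) :
  is_lim_seq (fun m => INR (t m) / sqrt (INR m)) 0 ->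
  0 < p < 1 - normal_cdf x -> 0 < eta ->
  eventually (fun m => exit_prob (m - t m) (v m).+1 p <= eta).
Proof.
move=> t_lim p_range eta0; have t_le := small_shortening t_lim.
have rate_n := RM_rate_cvg_shortened 0 t_lim t_le.
pose q := (p + (1 - normal_cdf x)) / 2.
have cdf0 := proj1 (normal_cdf_bounds x).
have q1 : 0 < 1 - q by rewrite /q; lra.
pose eta' := 1 - (normal_cdf x + (1 - q)) / 2 / (1 - q).
have eta'0 : 0 < eta'.
  suff : (normal_cdf x + (1 - q)) / 2 / (1 - q) < 1 by rewrite /eta'; lra.
  by apply/Rlt_div_l; rewrite /q in q1 *; lra.
have ee0 : 0 < eta * eta' / 2 by have := Rmult_lt_0_compat _ _ eta0 eta'0; lra.
have [a a_large] : exists a : nat, / 2 ^ a <= eta * eta' / 2.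
  have [a pow_small] := pow_lt_1_zero (/ 2) ltac:(rewrite Rabs_pos_eq; lra) _ ee0.
  by exists a; have := pow_small a (Nat.le_refl a); rewrite pow_inv => /Rabs_lt_between; lra.
have rate_na := RM_rate_cvg_shortened a t_lim t_le.
have gap_lim := is_lim_seq_minus' _ _ _ _ rate_n rate_na.
rewrite Rminus_diag in gap_lim.
have gap_pos : 0 < eta * eta' / 2 * (q - p) by apply: Rmult_lt_0_compat; rewrite // /q; lra.
have rate_lt : normal_cdf x < (1 - eta') * (1 - q).
  by rewrite /eta' (_ : _ * _ = (normal_cdf x + (1 - q)) / 2); [rewrite /q; lra | field; lra].
have gap_small := is_lim_seq_lt gap_lim gap_pos.
have rate_small := is_lim_seq_lt rate_n rate_lt.
apply: filter_imp (filter_and _ _ gap_small rate_small) => m []; rewrite !addn0 => gap_m rate_m.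
have [//|H_large] := Rle_lt_dec (exit_prob (m - t m) (v m).+1 p) eta; exfalso.
have exit_q : exit_prob (m - t m) (v m).+1 q <= 1 - eta'.
  apply: (Rmult_le_reg_r (1 - q)) => //; apply: Rlt_le; apply: Rle_lt_trans rate_m.
  by apply: exit_prob_le_rate; rewrite /q; lra.
have := @exit_prob_rate_gap (m - t m) a (v m) p q eta eta' ltac:(rewrite /q; lra)
  ltac:(rewrite /q; lra) ltac:(lra) ltac:(lra).
have : eta * eta' / 2 * (q - p) <= (eta * eta' - / 2 ^ a) * (q - p).
  by apply: Rmult_le_compat_r; rewrite /q; lra.
lra.
Qed.

End RateAtTheThreshold.

Section BlockCapacity.
Variables (v : nat -> nat) (x : R).
Hypothesis v_lim : is_lim_seq (fun m => (2 * INR (v m) - INR m) / sqrt (INR m)) x.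

Let c := (Rabs x + 1) / 2.
Let L m := 4 * sqrt (ln (INR m)).

Let sqrt_oo : is_lim_seq (fun m => sqrt (INR m)) p_infty.
Proof. exact: is_lim_seq_sqrt is_lim_seq_INR. Qed.

Let sqrt_ln_oo : is_lim_seq (fun m => sqrt (ln (INR m))) p_infty.
Proof.
by apply/is_lim_seq_sqrt/(is_lim_seq_comp_infty is_lim_ln_p); exact: is_lim_seq_INR.
Qed.

Lemma RM_order_near_half :
  eventually (fun m => INR (v m) <= INR m / 2 + c * sqrt (INR m) /\ (v m <= m)%N).
Proof.
have x_lt : x < Rabs x + 1 by have := Rle_abs x; lra.
have s_large := is_lim_seq_gt (2 * c + 1) sqrt_oo.
apply: filter_imp (filter_and _ _ (is_lim_seq_lt v_lim x_lt) s_large) => m [].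
have c0 : 0 < c by rewrite /c; have := Rabs_pos x; lra.
move=> ratio_lt s_gt; have ss := sqrt_sqrt _ (pos_INR m).
move/Rlt_div_l: ratio_lt => /(_ ltac:(lra)) v_lt.
have v_le : INR (v m) <= INR m / 2 + c * sqrt (INR m) by rewrite /c; lra.
by split => //; apply/leP/INR_le; nra.
Qed.

Lemma sqrt_ln_range : eventually (fun m => 8 * c <= L m <= sqrt (INR m)).
Proof.
have ln_div := is_lim_seq_comp_infty is_lim_div_ln_p is_lim_seq_INR.
have sixteenth : 0 < / 16 by lra.
apply: filter_imp (filter_and _ _ (is_lim_seq_gt 1 sqrt_oo)
  (filter_and _ _ (is_lim_seq_gt (8 * c) sqrt_ln_oo) (is_lim_seq_lt ln_div sixteenth))).
move=> m [s1 [ln_large]]; have m0 : 0 < INR m by have := sqrt_sqrt _ (pos_INR m); nra.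
move=> /(Rlt_div_l _ _ _ m0) ln_le; rewrite /L; have := sqrt_pos (ln (INR m)).
split; first lra.
rewrite -(sqrt_square 4) -?sqrt_mult_alt; try lra.
by apply: sqrt_le_1_alt; lra.
Qed.

Lemma amplified_exponent_lim :
  is_lim_seq (fun m => 2 * (L m * sqrt (INR m) * ln 2) / (sqrt (INR m) * ln (INR m))) 0.
Proof.
apply: (is_lim_seq_ext_loc (fun m => 8 * ln 2 / sqrt (ln (INR m)))); last first.
  by apply: (@is_lim_seq_div_infty _ _ (8 * ln 2)) => //; exact: is_lim_seq_const.
apply: filter_imp (filter_and _ _ (is_lim_seq_gt 0 sqrt_oo) (is_lim_seq_gt 0 sqrt_ln_oo)).
move=> m [s0 l0].
have ln0 : 0 <= ln (INR m).
  by apply: Rnot_lt_le => ln_neg; move: l0; rewrite sqrt_neg_0; lra.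
by rewrite /L -{3}(sqrt_sqrt _ ln0); field; lra.
Qed.

Lemma block_error_terms_le m d : 0 < d -> 2 <= L m -> 1 < sqrt (INR m) ->
  exp (- (L m * sqrt (INR m) * ln 2)) + (INR m + 1) * exp (- (L m ^ 2 / 4)) / d
    <= (1 + 2 / d) / sqrt (INR m).
Proof.
move=> d0 L2 s1; have ss := sqrt_sqrt _ (pos_INR m); have m1 : 1 < INR m by nra.
have lnm : 0 < ln (INR m) by rewrite -ln_1; apply: ln_increasing; lra.
have -> : L m ^ 2 / 4 = INR 4 * ln (INR m).
  by rewrite /L -[in RHS](sqrt_sqrt (ln (INR m))) /=; [field | lra].
rewrite (_ : (1 + 2 / d) / _ = / sqrt (INR m) + 2 / sqrt (INR m) / d); last by field; lra.
apply: Rplus_le_compat.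
  have Ls : sqrt (INR m) <= L m * sqrt (INR m) * ln 2.
    rewrite Rmult_assoc (Rmult_comm (sqrt _)) -Rmult_assoc -{1}[sqrt _]Rmult_1_l.
    by apply: Rmult_le_compat_r; [lra | have := ln_lt_2; nra].
  apply: Rle_trans (exp_opp_le_inv _) _; first lra.
  by apply: Rinv_le_contravar; lra.
apply: Rmult_le_compat_r; first by left; exact: Rinv_0_lt_compat.
rewrite exp_Ropp -[exp _]/(Rpower (INR m) (INR 4)) Rpower_pow; last lra.
have m4 : 1 <= INR m ^ 2 by apply: pow_R1_Rle; lra.
apply/Rle_div_l; first by apply: pow_lt; lra.
rewrite (_ : 2 / _ * _ = 2 * INR m ^ 4 / sqrt (INR m)); last by field; lra.
apply/Rle_div_r; first lra.
rewrite (_ : INR m ^ 4 = INR m ^ 2 * INR m ^ 2); last ring.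
nra.
Qed.

Lemma PB_RM_cvg0 p : 0 <= p < 1 - normal_cdf x ->
  is_lim_seq (fun m => PB (RM (v m) m) p) 0.
Proof.
move=> p_range; have [cdf0 _] := normal_cdf_bounds x.
pose q := (p + (1 - normal_cdf x)) / 2; have q_range : p < q < 1 - normal_cdf x by rewrite /q; lra.
have X0 m : 0 <= 2 * (L m * sqrt (INR m) * ln 2).
  have [l2 _] := ln2_bounds; have := sqrt_pos (INR m); have := sqrt_pos (ln (INR m)).
  by rewrite /L => ? ?; repeat apply: Rmult_le_pos; lra.
have [t t_lim amplify] := @exit_prob_amplify q _ ltac:(lra) X0 amplified_exponent_lim.
have small := @exit_prob_small v x v_lim t q (exp (- (4))) t_lim ltac:(lra) (exp_pos _).
apply: (is_lim_seq_le_le_loc (fun=> 0) _ (fun m => (1 + 2 / (q - p)) / sqrt (INR m))).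
- apply: filter_imp (filter_and _ _ (filter_and _ _ amplify small) (filter_and _ _
    (small_shortening t_lim) (filter_and _ _ (filter_and _ _ RM_order_near_half sqrt_ln_range)
    (is_lim_seq_gt 1 sqrt_oo)))) => m [[amplify_m small_m] [tm [[[v_near v_le] L_range] s1]]].
  split; first by rewrite PB_RM; apply: (proj1 (Rprob_bounds _ _)); lra.
  have := amplify_m _ _ small_m; rewrite subnK // => exit_q.
  have m_gt0 : (0 < m)%N by case: (m) s1 => //; rewrite /= sqrt_0; lra.
  have c_half : / 2 <= c by rewrite /c; have := Rabs_pos x; lra.
  have := @PB_RM_le m (v m) c (L m) m_gt0 v_le ltac:(lra) L_range ltac:(lra) v_near p q
    ltac:(lra) ltac:(lra) ltac:(lra).
  move=> /Rle_trans; apply; apply: Rle_trans (block_error_terms_le _ _ s1); try lra.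
  apply: Rplus_le_compat_r.
  apply: Rle_trans (Rmult_le_compat_l _ _ _ (Rlt_le _ _ (exp_pos _)) exit_q) _.
  by rewrite -exp_plus; right; congr exp; ring.
- exact: is_lim_seq_const.
- by apply: (@is_lim_seq_div_infty _ _ (1 + 2 / (q - p))) => //; exact: is_lim_seq_const.
Qed.

End BlockCapacity.

Theorem theorem7 (r : R) (hr : 0 < r < 1) :
  Un_cv (fun m => RM_rate (v_seq r m) m) r /\
  (forall p, 0 <= p < 1 - r -> Un_cv (fun m => PB (RM (v_seq r m) m) p) 0).
Proof.
have cdf_r := normal_cdf_Qinv hr; have v_lim := @v_seq_cvg r.
split=> [|p p_range]; apply/is_lim_seq_Reals.
  by have := @RM_rate_cvg_normal _ id _ is_lim_seq_INR v_lim; rewrite cdf_r.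
by apply: (PB_RM_cvg0 v_lim); rewrite cdf_r.
Qed.
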